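(* Let $\mu_0\in\mathcal M_c^+$ be a non-null measure such that $\langle\mu_0,m\rangle<+\infty$, and set $M_0:=\langle\mu_0,m\rangle\in(0,+\infty)$, $K:=\langle\mu_0,m^2\rangle\in(0,+\infty]$, $T_{\rm gel}:=1/K\in[0,+\infty)$, and $g_0(x):=\langle\mu_0,mx^m\rangle$ for $x\in[0,1]$. Then Flory's equation has a unique solution $(\mu_t)_{t\ge0}$ on $\mathbb R^+=[0,+\infty)$ with initial condition $\mu_0$. It has the following properties, where $M_t:=\langle\mu_t,m\rangle$. (1) We have $M_t=g_0(l_t)$, where $l_t=1$ for $t\le T_{\rm gel}$ and, for $t>T_{\rm gel}$, $l_t$ is uniquely defined by $$l_t=e^{-t(M_0-g_0(l_t))},\qquad l_t\in[0,1).$$ Therefore $t\mapsto M_t$ is continuous on $[0,+\infty)$, constant on $[0,T_{\rm gel}]$, strictly decreasing on $[T_{\rm gel},+\infty)$ and analytic on $\mathbb R^+\setminus\{T_{\rm gel}\}$. (2) The function $\phi_t(x)=xe^{t(M_0-g_0(x))}$, $x\in[0,1]$, has a right inverse $h_t:[0,1]\to[0,l_t]$ (i.e. $\phi_t(h_t(x))=x$ for all $x\in[0,1]$). The generating function $g_t(x):=\langle\mu_t,mx^m\rangle$, $x\in[0,1]$, is given for $t\ge0$ by $g_t(x)=g_0(h_t(x))$. (3) Let $m_0=\inf\operatorname{supp}\mu_0\ge0$. Then, as $t\to+\infty$, $$M_t\,e^{m_0t}\to m_0\,\mu_0(\{m_0\}),$$ and for every $\epsilon>0$, $M_t\,e^{(m_0+\epsilon)t}\to+\infty$.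 (4) The second moment $\langle\mu_t,m^2\rangle$ is finite for $t\in\mathbb R^+\setminus\{T_{\rm gel}\}$ and infinite at $t=T_{\rm gel}$.
   Context: $\mathcal M_c^+$ is the set of non-negative Radon measures on $(0,+\infty)$. For $\mu\in\mathcal M_c^+$ and $f\ge0$ or $f\in L^1(\mu)$, $\langle\mu,f\rangle=\int_{(0,+\infty)}f(m)\,\mu(\mathrm dm)$; $m$ also denotes the function $m\mapsto m$, $m^2$ the function $m\mapsto m^2$, etc. For $\phi:(0,+\infty)\to\mathbb R$, $\Delta\phi(m,m')=\phi(m+m')-\phi(m)-\phi(m')$. $C_c(0,+\infty)$ is the space of continuous functions on $(0,+\infty)$ with compact support. Conventions: $1/(+\infty)=0$; if $m_0=0$ then $m_0\mu_0(\{m_0\})=0$. Definition (solution of Flory's equation). Given $\mu_0\in\mathcal M_c^+$ with $\langle\mu_0,m\rangle<+\infty$, a family $(\mu_t)_{t\ge0}\subset\mathcal M_c^+$ solves Flory's equation if: (i) for every $t>0$, $\int_0^t\langle\mu_s,m\rangle^2\,\mathrm ds<+\infty$; (ii) for all $\phi\in C_c(0,+\infty)$ and $t>0$, $$\langle\mu_t,\phi\rangle=\langle\mu_0,\phi\rangle+\frac12\int_0^t\langle\mu_s(\mathrm dm)\mu_s(\mathrm dm'),mm'\Delta\phi(m,m')\rangle\,\mathrm ds-\int_0^t\langle\mu_s,m\,\phi\rangle\,\langle\mu_0-\mu_s,m\rangle\,\mathrm ds,$$ where $\langle\mu_s,m\,\phi\rangle=\int m\,\phi(m)\,\mu_s(\mathrm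 dm)$ and $\langle\mu_0-\mu_s,m\rangle=\langle\mu_0,m\rangle-\langle\mu_s,m\rangle$; (iii) if $\langle\mu_0,m^2\rangle<+\infty$, then $t\mapsto\langle\mu_t,m^2\rangle$ is bounded in a right neighborhood of $0$.
   Formalization: In (3) the exponents m_0 t and (m_0+ε)t are replaced by m_0 M_0 t and (m_0+ε)M_0 t: as printed (3) fails unless M_0=1, e.g. for μ_0=cδ_1, where M_t ~ c e^{-ct}, so M_t e^t tends to 0 if c>1 and to +∞ if c<1. *)

(* Defs.v *)
From HB Require Import structures.
From mathcomp Require Import all_boot all_order all_algebra.
From mathcomp Require Import all_classical all_reals all_analysis.
From mathcomp Require Import measurable_realfun.
Import Order.TTheory GRing.Theory Num.Theory.
Import numFieldNormedType.Exports.

Set Implicit Arguments.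
Unset Strict Implicit.
Unset Printing Implicit Defensive.

Local Open Scope classical_set_scope.
Local Open Scope ring_scope.

(* Measures on (0, +oo) are represented by Borel measures on the line that do
   not charge ]-oo, 0]. On (0, +oo), a Borel measure is Radon as soon as it is
   finite on compact sets. *)
Notation borel_measure R :=
  {measure set (measurableTypeR R) -> \bar R} (R in scope type_scope).

Section Flory.
Context {R : realType}.
Implicit Types (mu : borel_measure R) (f phi : R -> R) (t x : R).

Definition radon_pos mu : Prop :=
  mu `]-oo, 0]%classic = 0%E /\
  forall C : set R, compact C -> C `<=` `]0, +oo[ -> (mu C < +oo)%E.

Definition pairing mu f : \bar R := (\int[mu]_(m in `]0%R, +oo[) (f m)%:E)%E.

Definition moment1 mu : \bar R := pairing mu (fun m => m).
Definition moment2 mu : \bar R := pairing mu (fun m => m ^+ 2).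

(* For x = 0 the integrand vanishes on (0, +oo), since 0 `^ m = 0 if m != 0. *)
Definition genfun mu x : \bar R := pairing mu (fun m => m * x `^ m).

(* The inverse is that of extended reals, for which +oo^-1 = 0. *)
Definition gel_time mu : R := fine (moment2 mu)^-1%E.

Definition Delta phi (m m' : R) : R := phi (m + m') - phi m - phi m'.

(* The values of phi outside (0, +oo) are irrelevant. *)
Definition Cc_pos phi : Prop :=
  (forall m : R, 0 < m -> {for m, continuous phi}) /\
  exists C : set R, [/\ compact C, C `<=` `]0, +oo[ &
    forall m : R, 0 < m -> ~ C m -> phi m = 0].

Definition coag_term mu phi : \bar R :=
  (\int[mu]_(m in `]0%R, +oo[) \int[mu]_(m' in `]0%R, +oo[)
     (m * m' * Delta phi m m')%:E)%E.

Definition gel_term mu0 mu phi : \bar R :=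
  (pairing mu (fun m => (m * phi m)%R) * (moment1 mu0 - moment1 mu))%E.

Local Notation leb := (@lebesgue_measure R).

(* Only the times t >= 0 matter. The measurability and integrability clauses say
   that the time integrals are meaningful: the library also assigns a value to
   the integral of a non-measurable function. *)
Definition flory_solution mu0 (mu : R -> borel_measure R) : Prop :=
  [/\ forall t, 0 <= t -> radon_pos (mu t),
      forall A, measurable A -> mu 0 A = mu0 A,
      forall t, 0 < t ->
        measurable_fun `[0, t] (fun s : measurableTypeR R => moment1 (mu s)) /\
        (\int[leb]_(s in `[0%R, t]) (moment1 (mu s) ^+ 2) < +oo)%E,
      forall phi t, Cc_pos phi -> 0 < t ->
        [/\ leb.-integrable `[0, t] (fun s => coag_term (mu s) phi),
            leb.-integrable `[0, t] (fun s => gel_term mu0 (mu s) phi) &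
            (pairing (mu t) phi = pairing mu0 phi
               + (2^-1)%:E * \int[leb]_(s in `[0%R, t]) coag_term (mu s) phi
               - \int[leb]_(s in `[0%R, t]) gel_term mu0 (mu s) phi)%E]
    & (moment2 mu0 < +oo)%E -> exists delta C : R, 0 < delta /\
        forall t, 0 <= t <= delta -> (moment2 (mu t) <= C%:E)%E].

(* Local power series expansions relative to D: at an endpoint of D belonging
   to D, this is one-sided analyticity. *)
Definition analytic_on (D : set R) f : Prop :=
  forall t, D t -> exists r : R, 0 < r /\ exists a : nat -> R,
    forall s, D s -> `|s - t| < r -> pseries a (s - t) @ \oo --> f s.

Definition supp_pos mu : set R :=
  [set x | 0 < x /\ forall U : set R, open U -> U x -> (0 < mu U)%E].

(* Writing m0 = inf_supp mu0 and M0 = moment1 mu0, the mass M_t decays like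
   l_t `^ m0 = expR (- (m0 * (M0 - M_t) * t)), that is with exponential rate
   m0 * M0; this is m0 for the normalization M0 = 1. For instance, if mu0 is
   c times the Dirac mass at 1, then M_t is equivalent to c * expR (- (c * t)). *)
Definition inf_supp mu : R := inf (supp_pos mu).

End Flory.

(* Main.v *)
(* Let nu(dm) = m mu_0(dm), let G be the Laplace transform of nu, so that
   M_0 = G 0, and put
     mu_t(dm) = e^{- t M_0 m} / m * sum_k (t m)^k / (k + 1)! nu^{*(k + 1)}(dm).
   Differentiating this power series term by term in t gives Flory's equation.
   The Laplace transform L(t, z) of sum_k (t m)^k / (k + 1)! nu^{*(k + 1)} solves
   a Burgers equation, hence is constant along characteristics:
   L(t, w + t G w) = G w as long as w exceeds the largest root u_t of
   w = t (M_0 - G w). This yields M_t = G u_t, that is l_t = e^{- u_t}, and since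
   w |-> M_0 - G w is strictly concave with slope K at 0, u_t > 0 if and only if
   t > 1 / K. The asymptotics follow from G w e^{m_0 w} --> nu {m_0} and from
   t M_0 - u_t = t M_t --> 0. Above the gelation time, the series defining
   M_t converges absolutely with some room to spare, whence analyticity.
   Uniqueness: when psi vanishes above b, the rate of change of
   <mu_t, m psi> only involves test functions of the same kind, so the
   difference of two solutions satisfies a Gronwall inequality. *)

Require Import Defs.
From HB Require Import structures.
From mathcomp Require Import all_boot all_order all_algebra.
From mathcomp Require Import all_classical all_reals all_analysis.
From mathcomp Require Import measurable_realfun.
From mathcomp Require Import ring lra.
Import Order.TTheory GRing.Theory Num.Theory.
Import numFieldNormedType.Exports.

Set Implicit Arguments.
Unset Strict Implicit.
Unset Printing Implicit Defensive.

Local Open Scope classical_set_scope.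
Local Open Scope ring_scope.

(** * The power series measures *)

(** In the weak equation the loss by coagulation, proportional to $\langle\mu_s,m\rangle$, and the
    loss to the gel, proportional to $M_0-\langle\mu_s,m\rangle$, add up to a loss at the constant
    rate M_0. This cancellation makes the equation solvable, and it closes the uniqueness estimate
    on masses below a bound.

    Convolution powers are never formed: the measures a_k = m^k nu^{*(k + 1)} / (k + 1)! come from
    the recursion (k + 1) a_{k+1} = (m / 2) sum_i a_i * a_{k-i}, the Burgers equation read
    coefficient by coefficient. They are kept as one sigma-finite measure on nat * R, so that sums
    over k and integrals over mass and time are all exchanged by Tonelli's theorem.

    The time derivative is used only in integrated form, as an identity in [0, +oo] with the loss
    added on the left. It says nothing when both sides are infinite, and the convergence of the
    series is not known beforehand: truncations of the series, which satisfy the Burgers equation as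
    an inequality, give the upper bound, and equality follows once everything is finite. *)

Section weighted_image.
Local Open Scope ereal_scope.
Context d d' (T : measurableType d) (T' : measurableType d') (R : realType).
Variables (mu : {measure set T -> \bar R}) (w : T -> R) (f : T -> T').
Variables (mw : measurable_fun setT w) (mf : measurable_fun setT f).

(* The image by f of the measure of density |w| with respect to mu. The proof
   arguments let the measure structure be inferred. *)
Definition wimage (_ : measurable_fun setT w) (_ : measurable_fun setT f)
  (A : set T') : \bar R := \int[mu]_(x in f @^-1` A) `|w x|%:E.

Let mabs : measurable_fun setT (fun x => `|w x|%:E).
Proof. by apply/measurable_EFinP; exact: measurableT_comp. Qed.

Let wimage0 : wimage mw mf set0 = 0.
Proof. by rewrite /wimage preimage_set0 integral_set0. Qed.

Let wimage_ge0 A : 0 <= wimage mw mf A.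
Proof. by apply: integral_ge0 => x _; rewrite lee_fin. Qed.

Let mpre A : measurable A -> measurable (f @^-1` A).
Proof. by move=> mA; rewrite -[X in measurable X]setTI; exact: mf. Qed.

Let wimage_sigma_additive : semi_sigma_additive (wimage mw mf).
Proof.
move=> F mF tF mUF; rewrite /wimage preimage_bigcup.
apply: (@semi_sigma_additive_nng_induced _ _ _ mu (fun x => `|w x|%:E)) => //.
- by move=> n; exact: mpre.
- apply/trivIsetP => /= i j _ _ ij; rewrite -preimage_setI.
  by move/trivIsetP : tF => /(_ _ _ _ _ ij) ->//; rewrite preimage_set0.
- by rewrite -preimage_bigcup; exact: mpre.
Qed.

HB.instance Definition _ := isMeasure.Build _ _ _ (wimage mw mf)
  wimage0 wimage_ge0 wimage_sigma_additive.

Import HBNNSimple.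

Lemma integral_wimage (g : T' -> \bar R) :
  measurable_fun setT g -> (forall x, 0 <= g x) ->
  \int[wimage mw mf]_x g x = \int[mu]_x (g (f x) * `|w x|%:E).
Proof.
move=> mg g0; pose g_ := nnsfun_approx measurableT mg.
have w0 x : 0 <= (`|w x|)%:E :> \bar R by rewrite lee_fin.
transitivity (limn (fun n => \int[wimage mw mf]_x (g_ n x)%:E)).
  rewrite -monotone_convergence//.
  - by apply: eq_integral => y _; apply/esym/cvg_lim => //; exact: cvg_nnsfun_approx.
  - by move=> n; exact/measurable_EFinP/measurable_funP.
  - by move=> n y _; rewrite lee_fin.
  - by move=> y _ m n mn; rewrite lee_fin; exact/lefP/nd_nnsfun_approx.
transitivity (limn (fun n => \int[mu]_x ((g_ n (f x))%:E * `|w x|%:E))); last first.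
  rewrite -monotone_convergence//.
  - apply: eq_integral => y _; apply/cvg_lim => //.
    by apply: cvgeZr => //; exact: cvg_nnsfun_approx.
  - move=> n; apply: emeasurable_funM => //.
    by apply/measurable_EFinP; apply: measurableT_comp.
  - by move=> n y _; rewrite mule_ge0// lee_fin.
  - move=> y _ m n mn; apply: lee_pmul => //; rewrite lee_fin//.
    exact/lefP/nd_nnsfun_approx.
congr (limn _); apply/funext => n.
transitivity (\sum_(r \in range (g_ n))
    \int[mu]_x ((r * \1_(g_ n @^-1` [set r]) (f x))%:E * `|w x|%:E)); last first.
  rewrite -ge0_integral_fsum//; last 2 first.
  - move=> r; apply: emeasurable_funM => //.
    apply/measurable_EFinP/measurable_funM => //.
    by apply: measurableT_comp => //; exact: measurable_indic.
  - by move=> r x _; rewrite mule_ge0// nnfun_muleindic_ge0.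
  apply: eq_integral => x _; rewrite -ge0_mule_fsuml; last first.
    by move=> r; exact: nnfun_muleindic_ge0.
  by rewrite [in RHS]fimfunE -fsumEFin.
rewrite integral_nnsfun//= patch_setT sintegralE.
apply: eq_fsbigr => r /[!inE] -[x _ <-].
under eq_integral do rewrite EFinM -muleA.
rewrite ge0_integralZl//; last 2 first.
- apply: emeasurable_funM => //; apply/measurable_EFinP => //.
  by apply: measurableT_comp => //; exact: measurable_indic.
- by rewrite lee_fin.
congr (_ * _); rewrite /= /wimage [LHS]integral_mkcond.
by apply: eq_integral => y _; rewrite muleC epatch_indic.
Qed.

End weighted_image.

(** Markov's inequality bounds the measure of [F n] by the integral of [w n]. *)
Lemma sigma_finite_le d (T : measurableType d) (R : realType)
    (mu : {measure set T -> \bar R}) (F : (set T)^nat) (w : nat -> T -> \bar R) :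
  \bigcup_n F n = setT -> (forall n, measurable (F n)) ->
  (forall n, measurable_fun setT (w n)) -> (forall n x, 0 <= w n x)%E ->
  (forall n x, F n x -> 1 <= w n x)%E ->
  (forall n, \int[mu]_x w n x < +oo)%E -> sigma_finite setT mu.
Proof.
move=> Fcov mF mw w0 w1 woo; exists F => // n; split => //.
apply: le_lt_trans (woo n); rewrite -[mu _]mul1e -(integral_cst mu (mF n)).
apply: (@le_trans _ _ (\int[mu]_(x in F n) w n x)%E).
  by apply: ge0_le_integral => //; [exact: measurable_funTS|exact: w1].
by apply: ge0_subset_integral.
Qed.

Section sigma_finite_pack.
Context d (T : measurableType d) (R : realType) (mu : {measure set T -> \bar R}).

(** An alias of [mu] that takes the proof of sigma-finiteness as an argument, so that the structure
    can be inferred from the term. *)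
Definition sf_pack (_ : sigma_finite setT mu) : set T -> \bar R := mu.

Variable h : sigma_finite setT mu.
HB.instance Definition _ := Measure.on (sf_pack h).
HB.instance Definition _ := Measure_isSigmaFinite.Build _ _ _ (sf_pack h) h.
End sigma_finite_pack.

Lemma measurable_fun_natprod d d' (T : measurableType d) (T' : measurableType d')
    (f : nat * T -> T') :
  (forall k, measurable_fun setT (fun x => f (k, x))) -> measurable_fun setT f.
Proof.
move=> mf _ A mA; rewrite setTI.
rewrite (_ : f @^-1` A = \bigcup_k ([set k] `*` ((fun x => f (k, x)) @^-1` A))).
  apply: bigcup_measurable => k _; apply: measurableX => //.
  by rewrite -[X in measurable X]setTI; exact: mf.
by apply/seteqP; split => [[k x] /= fA|[k x] [k' _ [/= -> ]]//]; exists k.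
Qed.

(** * Measures with finite Laplace transform and the coefficient recursion *)

Section tame.
Context {R : realType}.
Local Notation mR := (measurableTypeR R).

(* The measures of the power series solution: they live on (0, +oo) and have a
   finite Laplace transform on (0, +oo). *)
Record tame := Tame {
  tame_measure :> {sigma_finite_measure set mR -> \bar R} ;
  tame_supp : tame_measure `]-oo, 0]%classic = 0%E ;
  tame_lap : forall z, 0 < z ->
    (\int[tame_measure]_m (expR (- (z * m)))%:E < +oo)%E }.

Lemma measurable_expRNM (z : R) : measurable_fun setT (fun m : mR => expR (- (z * m))).
Proof.
by apply: measurableT_comp => //; apply: measurable_funN; exact: mulrl_measurable.
Qed.

Lemma bigcup_itvNyn : \bigcup_n `]-oo, n%:R]%classic = setT :> set mR.
Proof.
rewrite -subTset => x _; exists (Num.truncn `|x|).+1 => //=.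
rewrite in_itv/= (le_trans (ler_norm x))// ltW//.
by have := truncnS_gt `|x|.
Qed.

Lemma expR_itvNyn (n : nat) (x : R) : x <= n%:R -> 1 <= expR n%:R * expR (- (1 * x)).
Proof.
by move=> xn; rewrite -expRD -[leLHS]expR0 ler_expR mul1r subr_ge0.
Qed.

Lemma laplace_sigma_finite (mu : borel_measure R) :
  (\int[mu]_m (expR (- (1 * m)))%:E < +oo)%E -> sigma_finite setT mu.
Proof.
move=> muoo.
have mE (n : nat) : measurable_fun setT (fun m : mR => (expR n%:R * expR (- (1 * m)))%:E).
  by apply/measurable_EFinP; apply: measurable_funM => //; exact: measurable_expRNM.
apply: (@sigma_finite_le _ mR R mu (fun n => `]-oo, n%:R]%classic)
  (fun n m => (expR n%:R * expR (- (1 * m)))%:E)) => //.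
- exact: bigcup_itvNyn.
- by move=> n x; rewrite /= in_itv/= lee_fin => /expR_itvNyn.
move=> n; under eq_integral do rewrite EFinM.
rewrite ge0_integralZl//.
- by rewrite lte_mul_pinfty// lee_fin expR_ge0.
- by apply/measurable_EFinP; exact: measurable_expRNM.
Qed.

Definition mk_tame (mu : borel_measure R) (supp : mu `]-oo, 0]%classic = 0%E)
    (lap : forall z, 0 < z -> (\int[mu]_m (expR (- (z * m)))%:E < +oo)%E) : tame :=
  @Tame (sf_pack (laplace_sigma_finite (lap 1 ltr01))) supp lap.

Section supp.
Variables (mu : borel_measure R) (mu0 : mu `]-oo, 0]%classic = 0%E).

Lemma supp_ae (P : set R) : (forall m, 0 < m -> P m) -> {ae mu, forall m, P m}.
Proof.
move=> hP; exists `]-oo, 0]%classic; split => //.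
by move=> m /= nP; rewrite in_itv/= leNgt; apply/negP => /hP.
Qed.

Lemma eq_supp_integral (f g : mR -> \bar R) :
  measurable_fun setT f -> measurable_fun setT g ->
  (forall m, 0 < m -> f m = g m) -> (\int[mu]_m f m = \int[mu]_m g m)%E.
Proof.
by move=> mf mg fg; apply: ae_eq_integral => //; apply: supp_ae => m /fg.
Qed.

Lemma le_supp_integral (f g : mR -> \bar R) :
  measurable_fun setT f -> measurable_fun setT g ->
  (forall m, 0 <= f m)%E -> (forall m, 0 <= g m)%E ->
  (forall m, (0 < m)%R -> f m <= g m)%E ->
  (\int[mu]_m f m <= \int[mu]_m g m)%E.
Proof.
move=> mf mg f0 g0 fg; apply: ae_ge0_le_integral => //.
by apply: supp_ae => m /fg.
Qed.

Lemma supp_integral (f : mR -> \bar R) : measurable_fun setT f ->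
  (\int[mu]_(m in `]0%R, +oo[) f m = \int[mu]_m f m)%E.
Proof.
move=> mf; rewrite integral_mkcond; apply: eq_supp_integral => //.
  apply: (measurable_restrictT f _).1; first exact: measurable_itv.
  exact: measurable_funTS.
by move=> m m0; rewrite patchE mem_set//= in_itv/= m0.
Qed.

End supp.

(** The factor 1/2 is that of the collision term; the division by [k.+1] comes from integrating the
    power t^k in time. *)
Definition tame_mass_weight (k : nat) : mR * mR -> R :=
  fun p => (p.1 + p.2) / (2 * k.+1%:R).

Lemma measurable_tame_mass_weight k : measurable_fun setT (tame_mass_weight k).
Proof. by apply: measurable_funM => //; exact: measurable_funD. Qed.

Lemma measurable_addp : measurable_fun setT (fun p : mR * mR => p.1 + p.2 : mR).
Proof. exact: measurable_funD. Qed.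

(* m / (2 (k + 1)) times the convolution of a and b. *)
Definition wconv k (a b : tame) : borel_measure R :=
  wimage (a \x b)%E (measurable_tame_mass_weight k) measurable_addp.

Lemma integral_wconv k (a b : tame) (g : mR -> \bar R) :
  measurable_fun setT g -> (forall x, 0 <= g x)%E ->
  (\int[wconv k a b]_m g m =
   \int[a]_x \int[b]_y (g (x + y)%R * `|(x + y) / (2 * k.+1%:R)|%:E))%E.
Proof.
move=> mg g0; rewrite integral_wimage//.
rewrite fubini_tonelli1//.
  apply: emeasurable_funM.
    by apply: (measurableT_comp mg); exact: measurable_addp.
  apply/measurable_EFinP; apply: measurableT_comp => //.
  exact: measurable_tame_mass_weight.
by move=> p; rewrite mule_ge0// lee_fin.
Qed.

Lemma wconv_supp k (a b : tame) : wconv k a b `]-oo, 0]%classic = 0%E.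
Proof.
have mi : measurable_fun setT (fun m : mR => (\1_(`]-oo, 0]%classic : set mR) m)%:E : \bar R).
  by apply/measurable_EFinP; exact: measurable_indic.
transitivity (\int[wconv k a b]_m (\1_(`]-oo, 0]%classic : set mR) m)%:E)%E.
  by rewrite integral_indic// setIT.
rewrite integral_wconv//.
pose F (p : mR * mR) := ((\1_(`]-oo, 0]%classic : set mR) (p.1 + p.2)%R)%:E *
  `|(p.1 + p.2) / (2 * k.+1%:R)|%:E : \bar R)%E.
have mF : measurable_fun setT F.
  apply: emeasurable_funM.
    by apply: (measurableT_comp mi); exact: measurable_addp.
  apply/measurable_EFinP; apply: measurableT_comp => //.
  exact: measurable_tame_mass_weight.
have F0 p : (0 <= F p)%E by rewrite mule_ge0// lee_fin.
rewrite -[RHS](integral0 a setT); apply: (eq_supp_integral (tame_supp a)) => //.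
  exact: (measurable_fun_fubini_tonelli_F F).
move=> x x0; rewrite -[RHS](integral0 b setT).
apply: (eq_supp_integral (tame_supp b)) => //.
  exact: (measurableT_comp mF (pair1_measurable _)).
move=> y y0; rewrite indicE memNset ?mul0e//= in_itv/=.
by apply/negP; rewrite -ltNge addr_gt0.
Qed.

(** Half of the exponent pays for the factor [x], by y <= e^y at y = z x / 2. Mass weights are
    absorbed in this way throughout. *)
Lemma mulr_expRN_le (z x : R) : 0 < z ->
  x * expR (- (z * x)) <= 2 / z * expR (- (z / 2 * x)).
Proof.
move=> z0; have -> : - (z * x) = - (z / 2 * x) - (z / 2 * x) by field.
rewrite expRD mulrA ler_wpM2r ?expR_ge0// expRN.
rewrite ler_pdivrMr ?expR_gt0//.
have : z / 2 * x <= expR (z / 2 * x).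
  by rewrite (le_trans _ (expR_ge1Dx _))// lerDr.
move=> h; apply: (@le_trans _ _ (2 / z * (z / 2 * x))).
  suff -> : 2 / z * (z / 2 * x) = x by [].
  by field; rewrite gt_eqF.
by rewrite ler_wpM2l// divr_ge0// ltW.
Qed.

Lemma wconv_lap k (a b : tame) z : 0 < z ->
  (\int[wconv k a b]_m (expR (- (z * m)))%:E < +oo)%E.
Proof.
move=> z0; have z20 : 0 < z / 2 by rewrite divr_gt0.
have mE (y : R) : measurable_fun setT (fun m : mR => (expR (- (y * m)))%:E : \bar R).
  by apply/measurable_EFinP; exact: measurable_expRNM.
rewrite integral_wconv//.
pose F (p : mR * mR) := ((expR (- (z * (p.1 + p.2)))%R)%:E *
  `|(p.1 + p.2) / (2 * k.+1%:R)|%:E : \bar R)%E.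
have mF : measurable_fun setT F.
  apply: emeasurable_funM.
    by apply: (measurableT_comp (mE z)); exact: measurable_addp.
  apply/measurable_EFinP; apply: measurableT_comp => //.
  exact: measurable_tame_mass_weight.
have F0 p : (0 <= F p)%E by rewrite mule_ge0// lee_fin// expR_ge0.
(* Once the mass weight is absorbed, the remaining exponential of x + y factorizes over the two
   measures, up to this constant. *)
pose c := (2 / z / (2 * k.+1%:R) : R).
have c0 : 0 <= c by rewrite !divr_ge0// ?ltW// mulr_ge0.
have cE x : 0 <= c * expR (- (z / 2 * x)) by rewrite mulr_ge0// expR_ge0.
have E0 : (0 <= \int[b]_y (expR (- (z / 2 * y)))%:E)%E.
  by apply: integral_ge0 => y _; rewrite lee_fin expR_ge0.
apply: (@le_lt_trans _ _ (\int[a]_x ((c * expR (- (z / 2 * x)))%:E *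
    \int[b]_y (expR (- (z / 2 * y)))%:E))%E).
  apply: (le_supp_integral (tame_supp a)) => //.
  - exact: (measurable_fun_fubini_tonelli_F F).
  - apply: emeasurable_funM => //; apply/measurable_EFinP.
    by apply: measurable_funM => //; exact: measurable_expRNM.
  - by move=> x; apply: integral_ge0 => y _; exact: (F0 (x, y)).
  - by move=> x; rewrite mule_ge0// lee_fin.
  move=> x x0; rewrite -ge0_integralZl//; last by rewrite lee_fin.
  apply: (le_supp_integral (tame_supp b)) => //.
  - exact: (measurableT_comp mF (pair1_measurable _)).
  - exact: emeasurable_funM.
  - by move=> y; rewrite mule_ge0// lee_fin ?expR_ge0.
  move=> y y0; rewrite /= -!EFinM lee_fin ger0_norm; last first.
    by rewrite divr_ge0 ?addr_ge0 ?ltW// mulr_gt0.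
  have -> : c * expR (- (z / 2 * x)) * expR (- (z / 2 * y)) =
      2 / z * expR (- (z / 2 * (x + y))) / (2 * k.+1%:R).
    rewrite mulrDr opprD expRD /c.
    by move: (2 * k.+1%:R)^-1 (z^-1) (expR _) (expR _) => *; ring.
  rewrite mulrA ler_wpM2r ?invr_ge0// mulrC; exact: mulr_expRN_le.
rewrite ge0_integralZr//; last 2 first.
- by apply/measurable_EFinP; apply: measurable_funM => //; exact: measurable_expRNM.
- by move=> x _; rewrite lee_fin.
under eq_integral do rewrite EFinM.
rewrite ge0_integralZl//.
rewrite !lte_mul_pinfty// ?tame_lap// ?mule_ge0//.
  by apply: integral_ge0 => y _; rewrite lee_fin expR_ge0.
rewrite fin_numM// ge0_fin_numE ?tame_lap//.
by apply: integral_ge0 => y _; rewrite lee_fin expR_ge0.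
Qed.

Lemma measurable_nat_fst d (T : measurableType d) (c : nat -> R) :
  measurable_fun setT (fun x : nat * T => c x.1).
Proof. by apply: measurable_fun_natprod => k; exact: (measurable_cst (c k)). Qed.

Lemma measurable_nat_expRNM (c : nat -> R) z :
  measurable_fun setT (fun x : nat * mR => c x.1 * expR (- (z * x.2))).
Proof.
apply: measurable_funM; first exact: measurable_nat_fst.
exact: (measurableT_comp (measurable_expRNM z) measurable_snd).
Qed.

Lemma nneseries_trunc (u : nat -> \bar R) n : (forall k, 0 <= u k)%E ->
  (forall k, (n <= k)%N -> u k = 0%E) -> (\sum_(k <oo) u k = \sum_(k < n) u k)%E.
Proof.
move=> u0 un; rewrite (nneseries_split 0 n)// add0n big_mkord.
by rewrite eseries0 ?adde0// => k nk _; exact: un.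
Qed.

Section power_series.
Variable b0 : tame.

Definition tame_step (bs : seq tame) k : borel_measure R :=
  msum (fun i => wconv k (nth b0 bs i) (nth b0 bs (k - i))) k.+1.

Lemma tame_step_supp bs k : tame_step bs k `]-oo, 0]%classic = 0%E.
Proof. by rewrite /tame_step/= /msum big1// => i _; rewrite wconv_supp. Qed.

Lemma tame_step_lap bs k z : 0 < z ->
  (\int[tame_step bs k]_m (expR (- (z * m)))%:E < +oo)%E.
Proof.
move=> z0; rewrite ge0_integral_measure_sum//; last first.
  by apply/measurable_EFinP; exact: measurable_expRNM.
by apply: lte_sum_pinfty => i _; exact: wconv_lap.
Qed.

(** Course-of-values recursion: the measure of index k + 1 involves all the earlier ones, so the
    whole list is carried along. *)
Fixpoint tame_seqs k : seq tame :=
  if k is k'.+1 then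
    rcons (tame_seqs k')
      (mk_tame (tame_step_supp (tame_seqs k') k') (@tame_step_lap (tame_seqs k') k'))
  else [:: b0].

(* tame_coef k = m^k nu^{*(k + 1)} / (k + 1)! when b0 = nu. *)
Definition tame_coef k : tame := nth b0 (tame_seqs k) k.

Lemma size_tame_seqs k : size (tame_seqs k) = k.+1.
Proof. by elim: k => //= k IH; rewrite size_rcons IH. Qed.

Lemma nth_tame_seqs k i : (i <= k)%N -> nth b0 (tame_seqs k) i = tame_coef i.
Proof.
elim: k => [|k IH]; first by rewrite leqn0 => /eqP ->.
rewrite leq_eqVlt => /predU1P[->//|ik].
by rewrite /= nth_rcons size_tame_seqs ik IH.
Qed.

Lemma integral_tame_coefS k (g : mR -> \bar R) :
  measurable_fun setT g -> (forall x, 0 <= g x)%E ->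
  (\int[tame_coef k.+1]_m g m = \sum_(i < k.+1)
     \int[tame_coef i]_x \int[tame_coef (k - i)]_y
       (g (x + y)%R * `|(x + y) / (2 * k.+1%:R)|%:E))%E.
Proof.
move=> mg g0; rewrite /tame_coef/= nth_rcons size_tame_seqs ltnn eqxx.
rewrite ge0_integral_measure_sum//; apply: eq_bigr => i _.
have ik : (i <= k)%N by rewrite -ltnS.
by rewrite integral_wconv// !nth_tame_seqs// leq_subr.
Qed.

(** The index k is kept as a coordinate: a power series in t with coefficients integrated against
    [tame_coef k] becomes a single integral of t^k against this measure. *)
Definition pos_nat_measure : {measure set (nat * mR)%type -> \bar R} :=
  mseries (fun k => wimage (tame_coef k) (measurable_cst (1 : R)) (pair1_measurable k)) 0.

Lemma integral_pos_nat_measure (F : nat * mR -> \bar R) :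
  measurable_fun setT F -> (forall x, 0 <= F x)%E ->
  (\int[pos_nat_measure]_x F x = \sum_(k <oo) \int[tame_coef k]_m F (k, m))%E.
Proof.
move=> mF F0; rewrite ge0_integral_measure_series//.
apply: eq_eseriesr => k _; rewrite integral_wimage//.
by apply: eq_integral => x _; rewrite normr1 mule1.
Qed.

(** The truncation in k is there because nothing is known at this stage about the convergence of the
    series. *)
Lemma pos_nat_measure_lap z n : 0 < z ->
  (\int[pos_nat_measure]_x ((x.1 < n)%N%:R * expR (- (z * x.2)))%:E < +oo)%E.
Proof.
move=> z0; rewrite integral_pos_nat_measure//=; last first.
  by apply/measurable_EFinP; exact: (measurable_nat_expRNM (fun k => (k < n)%N%:R)).
rewrite (@nneseries_trunc _ n).
- apply: lte_sum_pinfty => i _; rewrite ltn_ord.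
  by under eq_integral do rewrite mul1r; exact: tame_lap.
- by move=> k; apply: integral_ge0 => x _; rewrite lee_fin mulr_ge0// expR_ge0.
- by move=> k nk; apply: integral0_eq => x _; rewrite ltnNge nk mul0r.
Qed.

Lemma pos_nat_sigma_finite : sigma_finite setT pos_nat_measure.
Proof.
pose w n (x : nat * mR) := ((x.1 < n.+1)%N%:R * expR (- (1 * x.2)))%:E : \bar R.
have mw n : measurable_fun setT (w n).
  by apply/measurable_EFinP; exact: (measurable_nat_expRNM (fun k => (k < n.+1)%N%:R)).
have w0 n x : (0 <= w n x)%E by rewrite lee_fin mulr_ge0// expR_ge0.
apply: (@sigma_finite_le _ (nat * mR)%type R pos_nat_measure
  (fun n => [set k | (k <= n)%N] `*` `]-oo, n%:R]%classic)
  (fun n x => (expR n%:R)%:E * w n x)%E).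
- rewrite -subTset => -[k x] _.
  have [n _ /= xn] : (\bigcup_n `]-oo, n%:R]%classic : set mR) x.
    by rewrite bigcup_itvNyn.
  exists (maxn k n) => //=; split => /=; first exact: leq_maxl.
  move: xn; rewrite !in_itv/= => /le_trans; apply.
  by rewrite ler_nat leq_maxr.
- by move=> n; apply: measurableX => //; exact: measurable_itv.
- by move=> n; exact: emeasurable_funM.
- by move=> n x; rewrite mule_ge0// lee_fin expR_ge0.
- move=> n [k x] [/= kn]; rewrite in_itv/= => xn.
  have := expR_itvNyn xn.
  have -> : w n (k, x) = (expR (- (1 * x)))%:E.
    by rewrite /w/= ltnS kn; congr EFin; exact: mul1r.
  by rewrite -EFinM lee_fin.
- move=> n; rewrite ge0_integralZl//.
  by rewrite lte_mul_pinfty// ?lee_fin ?expR_ge0//; exact: pos_nat_measure_lap.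
Qed.

(** Closing this sigma type by [Qed] keeps the construction opaque: from here on only the
    integration formula is available. *)
Lemma pos_nat_spec : {Pi : {sigma_finite_measure set (nat * mR)%type -> \bar R} |
  forall F : nat * mR -> \bar R, measurable_fun setT F -> (forall x, 0 <= F x)%E ->
    (\int[Pi]_x F x = \sum_(k <oo) \int[tame_coef k]_m F (k, m))%E}.
Proof. exists (sf_pack pos_nat_sigma_finite); exact: integral_pos_nat_measure. Qed.

Definition pos_nat : {sigma_finite_measure set (nat * mR)%type -> \bar R} :=
  sval pos_nat_spec.

Lemma pos_nat_lap z n : 0 < z ->
  (\int[pos_nat]_x ((x.1 < n)%N%:R * expR (- (z * x.2)))%:E < +oo)%E.
Proof.
move=> z0; have := pos_nat_measure_lap n z0.
have mI : measurable_fun setT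
    (fun x : nat * mR => ((x.1 < n)%N%:R * expR (- (z * x.2)))%:E : \bar R).
  by apply/measurable_EFinP; exact: (measurable_nat_expRNM (fun k => (k < n)%N%:R)).
rewrite integral_pos_nat_measure// (svalP pos_nat_spec)//.
Qed.

End power_series.
End tame.

(** * The recursion as an identity for integrals *)

Section pos_nat_theory.
Context {R : realType}.
Local Notation mR := (measurableTypeR R).
Local Notation X := (nat * mR)%type.
Variable b0 : tame (R := R).
Local Notation Pi := (pos_nat b0).

Lemma integral_pos_nat (F : X -> \bar R) :
  measurable_fun setT F -> (forall x, 0 <= F x)%E ->
  (\int[Pi]_x F x = \sum_(k <oo) \int[tame_coef b0 k]_m F (k, m))%E.
Proof. exact: (svalP (pos_nat_spec b0)). Qed.

Lemma pos_nat_supp : Pi [set x | x.2 <= 0] = 0%E.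
Proof.
have mN : measurable ([set x | x.2 <= 0] : set X).
  rewrite [X in measurable X](_ : _ = setT `*` `]-oo, 0]%classic).
    by apply: measurableX => //; exact: measurable_itv.
  by apply/seteqP; split => -[k x] /=; rewrite in_itv//= => -[].
transitivity (\int[Pi]_x (\1_([set x | x.2 <= 0] : set X) x)%:E)%E.
  by rewrite integral_indic// setIT.
rewrite integral_pos_nat//; last first.
  by apply/measurable_EFinP; exact: measurable_indic.
apply: eseries0 => k _ _; rewrite -[RHS](integral0 (tame_coef b0 k) setT).
apply: (eq_supp_integral (tame_supp _)) => //.
  apply/measurable_EFinP.
  exact: (measurableT_comp (measurable_indic mN) (pair1_measurable k)).
by move=> m m0; rewrite indicE memNset//= leNgt m0.
Qed.

Lemma pos_nat_ae (P : set X) : (forall x, 0 < x.2 -> P x) -> {ae Pi, forall x, P x}.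
Proof.
move=> hP; exists [set x | x.2 <= 0]; split => //.
- rewrite [X in measurable X](_ : _ = setT `*` `]-oo, 0]%classic).
    by apply: measurableX => //; exact: measurable_itv.
  by apply/seteqP; split => -[k x] /=; rewrite in_itv//= => -[].
- exact: pos_nat_supp.
- by move=> x /= nP; rewrite leNgt; apply/negP => /hP.
Qed.

Lemma eq_pos_integral (f g : X -> \bar R) :
  measurable_fun setT f -> measurable_fun setT g ->
  (forall x, 0 < x.2 -> f x = g x) -> (\int[Pi]_x f x = \int[Pi]_x g x)%E.
Proof.
by move=> mf mg fg; apply: ae_eq_integral => //; apply: pos_nat_ae => m /fg.
Qed.

Lemma le_pos_integral (f g : X -> \bar R) :
  measurable_fun setT f -> measurable_fun setT g ->
  (forall m, 0 <= f m)%E -> (forall m, 0 <= g m)%E ->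
  (forall m, (0 < m.2)%R -> f m <= g m)%E ->
  (\int[Pi]_m f m <= \int[Pi]_m g m)%E.
Proof.
move=> mf mg f0 g0 fg; apply: ae_ge0_le_integral => //.
by apply: pos_nat_ae => m /fg.
Qed.

Lemma integral_pos_nat0 (F : X -> \bar R) :
  measurable_fun setT F -> (forall x, 0 <= F x)%E ->
  (forall k m, F (k.+1, m) = 0)%E ->
  (\int[Pi]_x F x = \int[b0]_m F (0%N, m))%E.
Proof.
move=> mF F0 Fz; rewrite integral_pos_nat//.
rewrite (@nneseries_trunc _ _ 1%N) ?big_ord1//.
  by move=> k; apply: integral_ge0.
by case=> // k _; apply: integral0_eq => m _; exact: Fz.
Qed.

Lemma nneseries_antidiagonal (J : nat -> nat -> \bar R) :
  (forall i j, 0 <= J i j)%E ->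
  (\sum_(k <oo) \sum_(i < k.+1) J i (k - i)%N = \sum_(i <oo) \sum_(j <oo) J i j)%E.
Proof.
move=> J0; pose J' i k := if (i <= k)%N then J i (k - i)%N else 0%E.
have J'0 i k : (0 <= J' i k)%E by rewrite /J'; case: ifP.
transitivity (\sum_(k <oo) \sum_(i <oo) J' i k)%E.
  apply: eq_eseriesr => k _; rewrite (@nneseries_trunc _ _ k.+1)//.
    by apply: eq_bigr => i _; rewrite /J' -ltnS ltn_ord.
  by move=> i ki; rewrite /J' leqNgt ki.
rewrite nneseries_interchange//; apply: eq_eseriesr => i _.
rewrite (nneseries_split 0 i)// add0n big1_seq ?add0e; last first.
  move=> k; rewrite mem_index_iota /= => ki.
  by rewrite /J' leqNgt ki.
rewrite -nneseries_addn//; apply: eq_eseriesr => j _.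
by rewrite /J' leq_addl addnK.
Qed.

Lemma measurable_pos_natM (H : X -> \bar R) : measurable_fun setT H ->
  measurable_fun setT (fun p : X * X =>
    H ((p.1.1 + p.2.1).+1, p.1.2 + p.2.2)%R * (`|p.1.2 + p.2.2| / 2)%:E)%E.
Proof.
move=> mH.
have m2 : measurable_fun setT (fun p : X * X => p.1.2 + p.2.2 : mR).
  by apply: measurable_funD; apply: measurableT_comp.
apply: emeasurable_funM.
  apply: (measurableT_comp mH); apply: measurable_fun_pair => //.
  apply: (@measurableT_comp _ _ _ _ _ _ succn) => //.
  by apply: measurable_fun_addn; apply: measurableT_comp.
by apply/measurable_EFinP; apply: measurable_funM => //; exact: measurableT_comp.
Qed.

(** The recursion in weak form. Weighting by the index k, which amounts to differentiating in t,
    turns [Pi] into its self-convolution with the index raised by one; the weight cancels the factor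
    1 / (k + 1) of [wconv], and half the mass remains. *)
Lemma integral_pos_natM (H : X -> \bar R) :
  measurable_fun setT H -> (forall x, 0 <= H x)%E ->
  (\int[Pi]_x (x.1%:R%:E * H x) = \int[Pi]_x \int[Pi]_y
     (H ((x.1 + y.1).+1, x.2 + y.2)%R * (`|x.2 + y.2| / 2)%:E))%E.
Proof.
move=> mH H0.
have mk : measurable_fun setT (fun x : X => x.1%:R%:E : \bar R).
  by apply/measurable_EFinP; exact: (measurable_nat_fst (fun k => k%:R)).
rewrite integral_pos_nat; last 2 first.
- exact: emeasurable_funM.
- by move=> x; rewrite mule_ge0// lee_fin.
pose F (p : X * X) := (H ((p.1.1 + p.2.1).+1, p.1.2 + p.2.2)%R * (`|p.1.2 + p.2.2| / 2)%:E)%E.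
have F0 p : (0 <= F p)%E by rewrite mule_ge0// lee_fin divr_ge0.
have mF : measurable_fun setT F by exact: measurable_pos_natM.
pose J i j := (\int[tame_coef b0 i]_x \int[tame_coef b0 j]_y F ((i, x), (j, y)))%E.
have J0 i j : (0 <= J i j)%E.
  by apply: integral_ge0 => x _; apply: integral_ge0 => y _.
have mJ i j : measurable_fun setT (fun p : mR * mR => F ((i, p.1), (j, p.2))).
  by apply: (measurableT_comp mF); apply: measurable_fun_pair; apply: measurable_fun_pair.
transitivity (\sum_(i <oo) \sum_(j <oo) J i j)%E; last first.
  rewrite integral_pos_nat; last 2 first.
  - exact: (measurable_fun_fubini_tonelli_F F).
  - by move=> x; apply: integral_ge0 => y _; exact: F0 (x, y).
  apply: eq_eseriesr => i _.
  under [RHS]eq_integral => x _.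
    rewrite integral_pos_nat; last 2 first.
    - exact: (measurableT_comp mF (pair1_measurable _)).
    - by move=> y; exact: F0 ((i, x), y).
    over.
  rewrite integral_nneseries// => j.
    exact: (measurable_fun_fubini_tonelli_F _ (mJ i j)).
  by move=> x _; apply: integral_ge0 => y _; exact: F0 ((i, x), (j, y)).
rewrite -nneseries_antidiagonal//.
(* The term of index 0 is killed by the weight k; the remaining indices k + 1 are those to which the
   recursion applies. *)
rewrite [LHS](nneseries_split 0 1); last first.
  by move=> k _; apply: integral_ge0 => x _; rewrite mule_ge0// lee_fin.
rewrite add0n big_nat1 integral0_eq ?add0e; last by move=> x _; rewrite mul0e.
rewrite -nneseries_addn; last first.
  by move=> k; apply: integral_ge0 => x _; rewrite mule_ge0// lee_fin.
apply: eq_eseriesr => k _; rewrite addn1.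
transitivity (k.+1%:R%:E * \int[tame_coef b0 k.+1]_m H (k.+1, m))%E.
  rewrite -ge0_integralZl//; last exact: (measurableT_comp mH (pair1_measurable _)).
rewrite integral_tame_coefS//; last first.
  exact: (measurableT_comp mH (pair1_measurable _)).
rewrite ge0_sume_distrr; last first.
  move=> i _; apply: integral_ge0 => x _; apply: integral_ge0 => y _.
  by rewrite mule_ge0// lee_fin.
apply: eq_bigr => i _.
have mK : measurable_fun setT (fun p : mR * mR =>
    (H (k.+1, (p.1 + p.2)%R) * `|(p.1 + p.2)%R / (2 * k.+1%:R)|%:E)%E).
  have m2 : measurable_fun setT (fun p : mR * mR => p.1 + p.2 : mR).
    exact: measurable_funD.
  apply: emeasurable_funM.
    by apply: (measurableT_comp mH); exact: measurable_fun_pair.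
  by apply/measurable_EFinP; apply: measurableT_comp => //; exact: measurable_funM.
have K0 p : (0 <= H (k.+1, (p.1 + p.2)%R) * `|(p.1 + p.2)%R / (2 * k.+1%:R)|%:E)%E.
  by rewrite mule_ge0// lee_fin.
rewrite -ge0_integralZl//; last 2 first.
- exact: (measurable_fun_fubini_tonelli_F _ mK).
- by move=> x _; apply: integral_ge0 => y _; exact: (K0 (x, y)).
apply: eq_integral => x _; rewrite -ge0_integralZl//; last 2 first.
- exact: (measurableT_comp mK (pair1_measurable _)).
- by move=> y _; exact: (K0 (x, y)).
apply: eq_integral => y _; rewrite /F/= subnKC; last by rewrite -ltnS.
rewrite muleCA; congr (_ * _)%E; rewrite -EFinM; congr EFin.
rewrite normrM normfV [`|2 * _|]ger0_norm//.
have := pnatr_eq0 R k.+1; move: (k.+1%:R) => c /= /negbT c0.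
by field.
Qed.

End pos_nat_theory.

(** * Duhamel formula *)

Section duhamel.
Context {R : realType}.
Local Notation leb := (@lebesgue_measure R).

Lemma everywhere_FTC2 (F f : R -> R) a b : a <= b ->
  (forall x : R, is_derive x 1 F (f x)) -> continuous f ->
  (\int[leb]_(s in `[a, b]) (f s)%:E = (F b - F a)%:E)%E.
Proof.
rewrite le_eqVlt => /predU1P[<- _ _|ab dF cf].
  by rewrite set_itv1 integral_set1 subrr.
have cF : continuous F.
  move=> x; apply/differentiable_continuous/derivable1_diffP.
  by have := dF x => -[].
rewrite (@continuous_FTC2 _ f F)//.
- exact: continuous_subspaceT.
- split=> [x _|//|//].
  + by have := dF x => -[].
  + exact/cvg_at_right_filter/cF.
  + exact/cvg_at_left_filter/cF.
- by move=> x _; rewrite derive1E; have := dF x => dFx; rewrite derive_val.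
Qed.

Lemma integrable_continuous (f : R -> R) a b : continuous f ->
  leb.-integrable `[a, b] (EFin \o f).
Proof.
move=> cf; apply: continuous_compact_integrable; first exact: segment_compact.
exact: continuous_subspaceT.
Qed.

Lemma continuous_expR_affine (w c m : R) : continuous (fun s : R => expR (- ((w + s * c) * m))).
Proof.
move=> s; apply: (continuous_comp (f := fun s : R => - ((w + s * c) * m))); last exact: continuous_expR.
apply: cvgN; apply: cvgMr_tmp; apply: cvgD; first exact: cvg_cst.
exact: cvgMr_tmp.
Qed.

(** For [k = 0] the exponent [k.-1] is harmless, as its coefficient vanishes. *)
Lemma is_derive_duhamel (k : nat) (w c m s : R) :
  is_derive s 1 (fun s => s ^+ k * expR (- ((w + s * c) * m)))
    (k%:R * s ^+ k.-1 * expR (- ((w + s * c) * m))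
     - c * m * s ^+ k * expR (- ((w + s * c) * m))).
Proof.
have dX : is_derive s (1:R) (fun s => s ^+ k) (k%:R * s ^+ k.-1).
  have -> : (fun s : R => s ^+ k) = (id : R -> R) ^+ k by apply/funext => x; rewrite exprfctE.
  by apply: is_derive_eq; rewrite /GRing.scale/=; ring.
apply: is_derive_eq.
rewrite /GRing.scale/=; ring.
Qed.

(** Each integral is placed on the side where it carries a plus sign. For nonnegative [c] and [m]
    the identity can then be integrated against [Pi] in [0, +oo] without any finiteness. *)
Lemma duhamel_pointwise (k : nat) (w c m t : R) : 0 <= t ->
  ((t ^+ k * expR (- ((w + t * c) * m)))%:E +
   \int[leb]_(s in `[0%R, t]) (c * m * s ^+ k * expR (- ((w + s * c) * m)))%:E =
   (0 ^+ k * expR (- (w * m)))%:E +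
   \int[leb]_(s in `[0%R, t]) (k%:R * s ^+ k.-1 * expR (- ((w + s * c) * m)))%:E)%E.
Proof.
move=> t0; have ce := @continuous_expR_affine w c m.
have cX n : continuous (fun s : R => s ^+ n) by exact: exprn_continuous.
have cA : continuous (fun s : R => c * m * s ^+ k * expR (- ((w + s * c) * m))).
  by move=> s; apply: cvgM => //; [apply: cvgMl_tmp; exact: cX|exact: ce].
have cB : continuous (fun s : R => k%:R * s ^+ k.-1 * expR (- ((w + s * c) * m))).
  by move=> s; apply: cvgM => //; [apply: cvgMl_tmp; exact: cX|exact: ce].
have := everywhere_FTC2 t0 (is_derive_duhamel k w c m) _.
rewrite mul0r addr0 => /(_ _)/wrap[].
  by move=> s; apply: cvgB; [exact: cB|exact: cA].
under eq_integral do rewrite EFinB.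
have iA := integrable_continuous 0 t cA.
have iB := integrable_continuous 0 t cB.
rewrite integralB_EFin// -(fineK (integrable_fin_num _ iA))//.
rewrite -(fineK (integrable_fin_num _ iB))//.
rewrite -EFinB => -[e]; rewrite -!EFinD; congr EFin.
by move: e; lra.
Qed.

Local Notation mR := (measurableTypeR R).
Local Notation X := (nat * mR)%type.

Section tonelli.
Context d (T : measurableType d) (mu : {sigma_finite_measure set T -> \bar R}).
Variables (D : set mR) (F : mR * T -> \bar R).
Hypotheses (mD : measurable D) (mF : measurable_fun setT F).
Hypothesis F0 : forall s x, D s -> (0 <= F (s, x))%E.

(** [F] is nonnegative only at the times of [D], hence the cut-off by an indicator before Tonelli's
    theorem is applied. *)
Let G (p : mR * T) := (F p * (\1_D p.1)%:E)%E.

Let mG : measurable_fun setT G.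
Proof.
apply: emeasurable_funM => //; apply/measurable_EFinP.
exact: (measurableT_comp (measurable_indic mD) measurable_fst).
Qed.

Let G0 p : (0 <= G p)%E.
Proof.
case: p => s x; rewrite /G/= indicE; have [Ds|nDs] := pselect (D s).
  by rewrite mem_set// mule1 F0.
by rewrite memNset// mule0.
Qed.

Let intG s : (\int[mu]_x G (s, x) = ((fun s => \int[mu]_x F (s, x)) \_ D) s)%E.
Proof.
rewrite patchE; case: ifPn => Ds.
  by apply: eq_integral => x _; rewrite /G/= indicE Ds mule1.
by apply: integral0_eq => x _; rewrite /G/= indicE (negbTE Ds) mule0.
Qed.

Lemma tonelli_time :
  (\int[leb]_(s in D) \int[mu]_x F (s, x) = \int[mu]_x \int[leb]_(s in D) F (s, x))%E.
Proof.
transitivity (\int[leb]_s \int[mu]_x G (s, x))%E.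
  by rewrite integral_mkcond; apply: eq_integral => s _; rewrite intG.
rewrite (fubini_tonelli G)//; apply: eq_integral => x _.
by rewrite [RHS]integral_mkcond; apply: eq_integral => s _; rewrite epatch_indic.
Qed.

Lemma measurable_time : measurable_fun D (fun s : mR => \int[mu]_x F (s, x))%E.
Proof.
apply/(measurable_restrictT _ mD).
apply: eq_measurable_fun (measurable_fun_fubini_tonelli_F (m2 := mu) G mG G0).
by move=> s _; rewrite -intG.
Qed.

Lemma measurable_time_integral :
  measurable_fun setT (fun x : T => \int[leb]_(s in D) F (s, x))%E.
Proof.
apply: eq_measurable_fun (measurable_fun_fubini_tonelli_G (m1 := leb) G mG G0).
by move=> x _; rewrite [RHS]integral_mkcond; apply: eq_integral => s _; rewrite epatch_indic.
Qed.

End tonelli.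

Lemma measurable_time_expn : measurable_fun setT (fun p : mR * X => p.1 ^+ p.2.1 : mR).
Proof.
apply: (@measurableT_comp _ _ _ _ _ _ (fun q : nat * mR => q.2 ^+ q.1 : mR) _
  (fun p : mR * X => (p.2.1, p.1))).
  by apply: measurable_fun_natprod => k; exact: (@exprn_measurable R setT k).
apply: measurable_fun_pair; last exact: measurable_fst.
exact: measurableT_comp.
Qed.

Lemma measurable_time_expnP : measurable_fun setT (fun p : mR * X => p.1 ^+ p.2.1.-1 : mR).
Proof.
apply: (@measurableT_comp _ _ _ _ _ _ (fun q : nat * mR => q.2 ^+ q.1.-1 : mR) _
  (fun p : mR * X => (p.2.1, p.1))).
  by apply: measurable_fun_natprod => k; exact: (@exprn_measurable R setT k.-1).
apply: measurable_fun_pair; last exact: measurable_fst.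
exact: measurableT_comp.
Qed.

Lemma measurable_time_expR w c :
  measurable_fun setT (fun p : mR * X => expR (- ((w + p.1 * c) * p.2.2)) : mR).
Proof.
apply: measurableT_comp => //; apply: measurable_funN; apply: measurable_funM.
  by apply: measurable_funD => //; apply: measurable_funM.
exact: measurableT_comp.
Qed.

Variable b0 : tame (R := R).
Local Notation Pi := (pos_nat b0).

(* Integrate d/ds (s ^ k e^{-(w + s c) m}) over [0, t]. *)
Lemma duhamel (g : X -> R) (w c t : R) : 0 <= t -> 0 <= c ->
  measurable_fun setT g -> (forall x, 0 <= g x) ->
  (\int[Pi]_x (g x * (t ^+ x.1 * expR (- ((w + t * c) * x.2))))%:E +
   \int[leb]_(s in `[0%R, t])
     \int[Pi]_x (g x * (c * `|x.2| * s ^+ x.1 * expR (- ((w + s * c) * x.2))))%:E =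
   \int[Pi]_x (g x * (0 ^+ x.1 * expR (- (w * x.2))))%:E +
   \int[leb]_(s in `[0%R, t])
     \int[Pi]_x (g x * (x.1%:R * s ^+ x.1.-1 * expR (- ((w + s * c) * x.2))))%:E)%E.
Proof.
move=> t0 c0 mg g0.
have mgt : measurable_fun setT (fun p : mR * X => g p.2) by exact: measurableT_comp.
have mabs : measurable_fun setT (fun p : mR * X => `|p.2.2| : mR).
  by apply: measurableT_comp => //; exact: measurableT_comp.
have mk : measurable_fun setT (fun p : mR * X => p.2.1%:R : mR).
  exact: (measurableT_comp (measurable_nat_fst (fun k => k%:R)) measurable_snd).
have e0 (s x : R) : 0 <= expR (- ((w + s * c) * x)) by exact: expR_ge0.
pose A (x : X) := (g x * (t ^+ x.1 * expR (- ((w + t * c) * x.2))))%:E : \bar R.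
pose C (x : X) := (g x * (0 ^+ x.1 * expR (- (w * x.2))))%:E : \bar R.
pose FB (p : mR * X) := (g p.2 *
  (c * `|p.2.2| * p.1 ^+ p.2.1 * expR (- ((w + p.1 * c) * p.2.2))))%:E : \bar R.
pose FD (p : mR * X) := (g p.2 *
  (p.2.1%:R * p.1 ^+ p.2.1.-1 * expR (- ((w + p.1 * c) * p.2.2))))%:E : \bar R.
have mI : measurable (`[0, t]%classic : set mR) by exact: measurable_itv.
have mX (a z : R) : measurable_fun setT (fun x : X => a ^+ x.1 * expR (- (z * x.2))).
  exact: (measurable_nat_expRNM (fun k => a ^+ k)).
have mA : measurable_fun setT A by apply/measurable_EFinP; exact: measurable_funM.
have mC : measurable_fun setT C by apply/measurable_EFinP; exact: measurable_funM.
have mFB : measurable_fun setT FB.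
  apply/measurable_EFinP; apply: measurable_funM => //; apply: measurable_funM.
    by apply: measurable_funM; [exact: measurable_funM|exact: measurable_time_expn].
  exact: measurable_time_expR.
have mFD : measurable_fun setT FD.
  apply/measurable_EFinP; apply: measurable_funM => //; apply: measurable_funM.
    by apply: measurable_funM => //; exact: measurable_time_expnP.
  exact: measurable_time_expR.
have A0 x : (0 <= A x)%E by rewrite lee_fin mulr_ge0// mulr_ge0// ?exprn_ge0 ?expR_ge0.
have C0 x : (0 <= C x)%E by rewrite lee_fin mulr_ge0// mulr_ge0// ?exprn_ge0 ?expR_ge0.
have FB0 s x : `[0, t]%classic s -> (0 <= FB (s, x))%E.
  rewrite /= in_itv/= => /andP[s0 _].
  by rewrite lee_fin mulr_ge0// mulr_ge0// mulr_ge0 ?exprn_ge0// mulr_ge0.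
have FD0 s x : `[0, t]%classic s -> (0 <= FD (s, x))%E.
  rewrite /= in_itv/= => /andP[s0 _].
  by rewrite lee_fin mulr_ge0// mulr_ge0// mulr_ge0 ?exprn_ge0.
have IB0 x : (0 <= \int[leb]_(s in `[0%R, t]) FB (s, x))%E.
  by apply: integral_ge0 => s; exact: FB0.
have ID0 x : (0 <= \int[leb]_(s in `[0%R, t]) FD (s, x))%E.
  by apply: integral_ge0 => s; exact: FD0.
have mIB := measurable_time_integral mI mFB FB0.
have mID := measurable_time_integral mI mFD FD0.
rewrite (tonelli_time Pi mI mFB FB0) (tonelli_time Pi mI mFD FD0).
rewrite -(ge0_integralD Pi measurableT (fun x _ => A0 x) mA (fun x _ => IB0 x) mIB).
rewrite -(ge0_integralD Pi measurableT (fun x _ => C0 x) mC (fun x _ => ID0 x) mID).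
apply: eq_pos_integral; [exact: emeasurable_funD|exact: emeasurable_funD|].
move=> [k m] /= m0; have := duhamel_pointwise k w c m t0.
rewrite /A /C /FB /FD/= => e.
have m2 (n : nat) (a : R) : measurable_fun (`[0, t]%classic : set mR)
    (fun s : mR => (a * s ^+ n * expR (- ((w + s * c) * m)))%:E : \bar R).
  apply/measurable_EFinP; apply: measurable_funM; last first.
    apply: measurable_funTS; apply: continuous_measurable_fun.
    exact: continuous_expR_affine.
  by apply: measurable_funM => //; exact: exprn_measurable.
transitivity ((g (k, m))%:E * ((t ^+ k * expR (- ((w + t * c) * m)))%:E +
   \int[leb]_(s in `[0%R, t]) (c * m * s ^+ k * expR (- ((w + s * c) * m)))%:E))%E.
  rewrite ge0_muleDr ?lee_fin ?mulr_ge0 ?exprn_ge0 ?expR_ge0//; last first.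
    apply: integral_ge0 => s; rewrite /= in_itv/= => /andP[s0 _].
    by rewrite lee_fin mulr_ge0// mulr_ge0 ?exprn_ge0// mulr_ge0// ltW.
  congr (_ + _)%E; rewrite -ge0_integralZl ?lee_fin//; last first.
    move=> s; rewrite /= in_itv/= => /andP[s0 _].
    by rewrite lee_fin mulr_ge0// mulr_ge0 ?exprn_ge0// mulr_ge0// ltW.
  by apply: eq_integral => s _; rewrite ger0_norm ?ltW.
rewrite e ge0_muleDr ?lee_fin ?mulr_ge0 ?exprn_ge0 ?expR_ge0//; last first.
  apply: integral_ge0 => s; rewrite /= in_itv/= => /andP[s0 _].
  by rewrite lee_fin mulr_ge0// mulr_ge0 ?exprn_ge0.
congr (_ + _)%E; rewrite -ge0_integralZl ?lee_fin//.
move=> s; rewrite /= in_itv/= => /andP[s0 _].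
by rewrite lee_fin mulr_ge0// mulr_ge0 ?exprn_ge0.
Qed.

(** [j] is the identity for the series itself and [predn] for its time derivative. *)
Lemma measurable_time_series (j : nat -> nat) (a : X -> R) (w c t : R) (F : mR -> X -> R) :
  measurable_fun setT a -> (forall x, 0 <= a x) ->
  (forall s x, F s x = a x * (s ^+ j x.1 * expR (- ((w + s * c) * x.2)))) ->
  measurable_fun `[0, t]%classic (fun s : mR => \int[Pi]_x (F s x)%:E)%E.
Proof.
move=> ma a0 FE.
apply: (@measurable_time _ _ Pi `[0, t]%classic (fun p : mR * X => (F p.1 p.2)%:E)).
- exact: measurable_itv.
- apply/measurable_EFinP.
  rewrite (_ : (fun p : mR * X => F p.1 p.2) = (fun p : mR * X =>
    a p.2 * (p.1 ^+ j p.2.1 * expR (- ((w + p.1 * c) * p.2.2))))); last first.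
    by apply/funext => p; rewrite FE.
  apply: measurable_funM; first exact: measurableT_comp.
  apply: measurable_funM; last exact: measurable_time_expR.
  apply: (@measurableT_comp _ _ _ _ _ _ (fun q : nat * mR => q.2 ^+ j q.1 : mR) _
    (fun p : mR * X => (p.2.1, p.1))).
    by apply: measurable_fun_natprod => k; exact: (@exprn_measurable R setT (j k)).
  apply: measurable_fun_pair; last exact: measurable_fst.
  exact: measurableT_comp.
- move=> s x /=; rewrite in_itv/= => /andP[s0 _].
  by rewrite FE lee_fin mulr_ge0// mulr_ge0 ?expR_ge0 ?exprn_ge0.
Qed.

End duhamel.

(** * Laplace transforms along characteristics *)

Section gronwall.
Context {R : realType}.
Local Notation leb := (@lebesgue_measure R).

(** Iterating the integral step n times gives the bound a0 (K s)^n / n!, a term of a convergent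
    exponential series, which therefore tends to 0. The step is stated for monomial bounds so that
    [D] itself never has to be integrated. *)
Lemma gronwall_expn (D : R -> R) (T K a0 : R) : 0 <= K -> 0 <= a0 ->
  (forall s, 0 <= s <= T -> D s <= a0) ->
  (forall (n : nat) a, 0 <= a -> (forall s, 0 <= s <= T -> D s <= a * s ^+ n) ->
     forall t, 0 <= t <= T -> D t <= K * a / n.+1%:R * t ^+ n.+1) ->
  forall s, 0 <= s <= T -> D s <= 0.
Proof.
move=> K0 a00 Da step s sT.
have bound n : forall t, 0 <= t <= T -> D t <= a0 * K ^+ n / n`!%:R * t ^+ n.
  elim: n => [|n IH] t tT; first by rewrite expr0 fact0 !(mulr1, divr1) Da.
  have := step n _ _ IH t tT.
  rewrite !mulr_ge0 ?invr_ge0 ?exprn_ge0// => /(_ isT) /le_trans; apply.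
  rewrite le_eqVlt; apply/orP; left; apply/eqP; congr (_ * _).
  rewrite factS natrM invfM exprS; ring.
have : (fun n => a0 * (exp_coeff (K * s) n)) @ \oo --> a0 * 0.
  apply: cvgMl_tmp; apply: cvg_series_cvg_0.
  exact: is_cvg_series_exp_coeff.
rewrite mulr0 => cv; apply: (@ler_cvg_to _ _ _ _ (fun _ : nat => D s) _ _ _ _ cv).
  exact: cvg_cst.
apply: nearW => n; apply: le_trans (bound n s sT) _.
rewrite /exp_coeff/= exprMn le_eqVlt; apply/orP; left; apply/eqP; ring.
Qed.

Lemma integral_expn (a t : R) n : 0 <= t ->
  (\int[leb]_(s in `[0%R, t]) (a * s ^+ n)%:E = (a / n.+1%:R * t ^+ n.+1)%:E)%E.
Proof.
move=> t0.
pose F (s : R) := a / n.+1%:R * s ^+ n.+1.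
have dF x : is_derive x (1 : R) F (a * x ^+ n).
  have -> : F = (a / n.+1%:R) *: ((id : R -> R) ^+ n.+1).
    by apply/funext => y; rewrite /= scalrfctE exprfctE.
  by apply: is_derive_eq; rewrite /GRing.scale/= mulr1 mulrA divfK ?pnatr_eq0.
rewrite (everywhere_FTC2 t0 dF); last first.
  by move=> x; apply: cvgMl_tmp; exact: exprn_continuous.
by rewrite /F expr0n mulr0 subr0.
Qed.

Lemma integral_itv_cst (a t : R) : 0 <= t ->
  (\int[leb]_(s in `[0%R, t]) a%:E = (a * t)%:E)%E.
Proof.
move=> t0; have := integral_expn a 0 t0; rewrite expr1 divr1 => <-.
by apply: eq_integral => s _; rewrite mulr1.
Qed.

End gronwall.

Lemma cvg_monotone_integral d (T : measurableType d) (R : realType)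
    (mu : {measure set T -> \bar R}) (f_ : (T -> \bar R)^nat) (f : T -> \bar R) :
  (forall n, measurable_fun setT (f_ n)) -> (forall n x, 0 <= f_ n x)%E ->
  (forall x, nondecreasing_seq (f_^~ x)) ->
  (forall x, f_ n x @[n --> \oo] --> f x) ->
  (\int[mu]_x f_ n x)%E @[n --> \oo] --> (\int[mu]_x f x)%E.
Proof.
move=> mf f0 ndf ff.
rewrite (_ : f = fun x => limn (f_^~ x)).
  by apply: cvg_monotone_convergence => // x _; exact: ndf.
by apply/funext => x; apply/esym/cvg_lim.
Qed.

Section laplace.
Context {R : realType}.
Local Notation leb := (@lebesgue_measure R).
Local Notation mR := (measurableTypeR R).
Local Notation X := (nat * mR)%type.
Variable b0 : tame (R := R).
Hypothesis b0fin : (b0 setT < +oo)%E.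
Local Notation Pi := (pos_nat b0).

Definition lap0 (w : R) : R := fine (\int[b0]_m (expR (- (w * m)))%:E)%E.

Lemma lap0E w : 0 <= w -> (\int[b0]_m (expR (- (w * m)))%:E = (lap0 w)%:E)%E.
Proof.
move=> w0; rewrite fineK// ge0_fin_numE; last first.
  by apply: integral_ge0 => m _; rewrite lee_fin expR_ge0.
apply: le_lt_trans b0fin; rewrite -[leRHS]mul1e -(integral_cst b0 measurableT 1).
apply: (le_supp_integral (tame_supp b0)) => //.
- by apply/measurable_EFinP; exact: measurable_expRNM.
- by move=> m m0; rewrite lee_fin -[leRHS]expR0 ler_expR oppr_le0 mulr_ge0// ltW.
Qed.

Lemma lap0_0 : ((lap0 0)%:E = b0 setT)%E.
Proof.
rewrite -lap0E//; under eq_integral do rewrite mul0r oppr0 expR0.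
by rewrite integral_cst// mul1e.
Qed.

Lemma lap0_ge0 w : 0 <= lap0 w.
Proof. by apply: fine_ge0; apply: integral_ge0 => m _; rewrite lee_fin expR_ge0. Qed.

Lemma le_lap0 v w : 0 <= v -> v <= w -> lap0 w <= lap0 v.
Proof.
move=> v0 vw; rewrite -lee_fin -!lap0E ?(le_trans v0)//.
apply: (le_supp_integral (tame_supp b0)) => //.
- by apply/measurable_EFinP; exact: measurable_expRNM.
- by apply/measurable_EFinP; exact: measurable_expRNM.
- by move=> m m0; rewrite lee_fin ler_expR lerN2 ler_wpM2r// ltW.
Qed.

(** [lap] is the function L of the overview and [dlap] is minus its derivative in z; the suffix [N]
    marks the truncation of the series at order n. The absolute value keeps the integrands
    nonnegative off the support. *)
Definition lap (t z : R) : \bar R := (\int[Pi]_x (t ^+ x.1 * expR (- (z * x.2)))%:E)%E.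
Definition lapN n (t z : R) : \bar R :=
  (\int[Pi]_x ((x.1 < n)%N%:R * (t ^+ x.1 * expR (- (z * x.2))))%:E)%E.
Definition dlap (t z : R) : \bar R :=
  (\int[Pi]_x (`|x.2| * (t ^+ x.1 * expR (- (z * x.2))))%:E)%E.
Definition dlapN n (t z : R) : \bar R :=
  (\int[Pi]_x ((x.1 < n)%N%:R * (`|x.2| * (t ^+ x.1 * expR (- (z * x.2)))))%:E)%E.

Lemma measurable_abs_snd : measurable_fun setT (fun x : X => `|x.2| : mR).
Proof. by apply: measurableT_comp => //; exact: measurable_snd. Qed.

Lemma measurable_lap t z : measurable_fun setT (fun x : X => t ^+ x.1 * expR (- (z * x.2)) : mR).
Proof. exact: (measurable_nat_expRNM (fun k => t ^+ k)). Qed.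

Lemma measurable_lapN n t z : measurable_fun setT
  (fun x : X => (x.1 < n)%N%:R * (t ^+ x.1 * expR (- (z * x.2))) : mR).
Proof.
apply: measurable_funM; last exact: measurable_lap.
exact: (measurable_nat_fst (fun k => (k < n)%N%:R)).
Qed.

Lemma measurable_dlap t z : measurable_fun setT
  (fun x : X => `|x.2| * (t ^+ x.1 * expR (- (z * x.2))) : mR).
Proof. by apply: measurable_funM; [exact: measurable_abs_snd|exact: measurable_lap]. Qed.

Lemma measurable_dlapN n t z : measurable_fun setT
  (fun x : X => (x.1 < n)%N%:R * (`|x.2| * (t ^+ x.1 * expR (- (z * x.2)))) : mR).
Proof.
apply: measurable_funM; last exact: measurable_dlap.
exact: (measurable_nat_fst (fun k => (k < n)%N%:R)).
Qed.

Section nonneg.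
Variables (t z : R).
Hypothesis t0 : 0 <= t.

Lemma lap_pt_ge0 (x : X) : 0 <= t ^+ x.1 * expR (- (z * x.2)).
Proof. by rewrite mulr_ge0 ?exprn_ge0 ?expR_ge0. Qed.

Lemma dlap_pt_ge0 (x : X) : 0 <= `|x.2| * (t ^+ x.1 * expR (- (z * x.2))).
Proof. by rewrite mulr_ge0// lap_pt_ge0. Qed.

Lemma lap_ge0 : (0 <= lap t z)%E.
Proof. by apply: integral_ge0 => x _; rewrite lee_fin lap_pt_ge0. Qed.

Lemma dlap_ge0 : (0 <= dlap t z)%E.
Proof. by apply: integral_ge0 => x _; rewrite lee_fin dlap_pt_ge0. Qed.

Lemma lapN_ge0 n : (0 <= lapN n t z)%E.
Proof. by apply: integral_ge0 => x _; rewrite lee_fin mulr_ge0// lap_pt_ge0. Qed.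

Lemma dlapN_ge0 n : (0 <= dlapN n t z)%E.
Proof. by apply: integral_ge0 => x _; rewrite lee_fin mulr_ge0// dlap_pt_ge0. Qed.

End nonneg.

Lemma le_lap t y z : 0 <= t -> y <= z -> (lap t z <= lap t y)%E.
Proof.
move=> t0 yz; apply: le_pos_integral.
- by apply/measurable_EFinP; exact: measurable_lap.
- by apply/measurable_EFinP; exact: measurable_lap.
- by move=> x; rewrite lee_fin lap_pt_ge0.
- by move=> x; rewrite lee_fin lap_pt_ge0.
- move=> x x0; rewrite lee_fin ler_wpM2l ?exprn_ge0//.
  by rewrite ler_expR lerN2 ler_wpM2r// ltW.
Qed.

(* d m <= e ^ (d m) *)
Lemma dlap_le t z d : 0 <= t -> 0 < d -> (dlap t z <= (d^-1)%:E * lap t (z - d))%E.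
Proof.
move=> t0 d0; rewrite /lap -ge0_integralZl//; last 3 first.
- by apply/measurable_EFinP; exact: measurable_lap.
- by move=> x _; rewrite lee_fin lap_pt_ge0.
- by rewrite lee_fin invr_ge0 ltW.
apply: le_pos_integral.
- by apply/measurable_EFinP; exact: measurable_dlap.
- apply: emeasurable_funM => //; apply/measurable_EFinP; exact: measurable_lap.
- by move=> x; rewrite lee_fin dlap_pt_ge0.
- by move=> x; rewrite -EFinM lee_fin mulr_ge0 ?invr_ge0 ?(ltW d0)// lap_pt_ge0.
move=> x x0; rewrite -EFinM lee_fin gtr0_norm// mulrCA [leRHS]mulrCA.
rewrite ler_wpM2l ?exprn_ge0//.
rewrite mulrBl opprB expRD mulrA ler_wpM2r ?expR_ge0//.
rewrite ler_pdivlMl//; apply: le_trans (expR_ge1Dx _).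
by rewrite lerDr.
Qed.

Lemma lapM (f h : X -> R) : measurable_fun setT f -> measurable_fun setT h ->
  (forall x, 0 <= f x) -> (forall x, 0 <= h x) ->
  (\int[Pi]_x \int[Pi]_y (f x * h y)%:E = \int[Pi]_x (f x)%:E * \int[Pi]_y (h y)%:E)%E.
Proof.
move=> mf mh f0 h0; rewrite -ge0_integralZr//; last 3 first.
- exact/measurable_EFinP.
- by move=> x _; rewrite lee_fin.
- by apply: integral_ge0 => x _; rewrite lee_fin.
apply: eq_integral => x _; rewrite -ge0_integralZl ?lee_fin//.
  exact/measurable_EFinP.
by move=> y _; rewrite lee_fin.
Qed.

(** By symmetry the mean of the two masses may be replaced by the second one. This uses up the 1/2
    of the recursion: half the derivative of L^2 is L times its derivative. *)
Lemma lapM_sym (f : X -> R) : measurable_fun setT f -> (forall x, 0 <= f x) ->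
  (\int[Pi]_x \int[Pi]_y (f x * f y * ((`|x.2| + `|y.2|) / 2))%:E =
   \int[Pi]_x (f x)%:E * \int[Pi]_y (`|y.2| * f y)%:E)%E.
Proof.
move=> mf f0.
pose h (x : X) := `|x.2| * f x.
have mh : measurable_fun setT h.
  by apply: measurable_funM => //; exact: measurable_abs_snd.
have h0 x : 0 <= h x by rewrite mulr_ge0.
pose F (p : X * X) := (f p.1 * h p.2)%:E : \bar R.
have mF : measurable_fun setT F.
  by apply/measurable_EFinP; apply: measurable_funM; exact: measurableT_comp.
have F0 p : (0 <= F p)%E by rewrite lee_fin mulr_ge0.
pose F' (p : X * X) := (h p.1 * f p.2)%:E : \bar R.
have mF' : measurable_fun setT F'.
  by apply/measurable_EFinP; apply: measurable_funM; exact: measurableT_comp.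
have F'0 p : (0 <= F' p)%E by rewrite lee_fin mulr_ge0.
have i0 (g : X -> R) : (forall x, 0 <= g x) -> (0 <= \int[Pi]_x (g x)%:E)%E.
  by move=> g0; apply: integral_ge0 => x _; rewrite lee_fin.
transitivity (\int[Pi]_x ((2^-1)%:E * (\int[Pi]_y F (x, y) + \int[Pi]_y F' (x, y))))%E.
  apply: eq_integral => x _.
  rewrite -ge0_integralD//; last 2 first.
  - exact: (measurableT_comp mF (pair1_measurable _)).
  - exact: (measurableT_comp mF' (pair1_measurable _)).
  rewrite -ge0_integralZl//; last 2 first.
  - apply: emeasurable_funD.
    + exact: (measurableT_comp mF (pair1_measurable _)).
    + exact: (measurableT_comp mF' (pair1_measurable _)).
  - by move=> y _; rewrite adde_ge0.
  apply: eq_integral => y _; rewrite -EFinD -EFinM; congr EFin.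
  by rewrite /F /F' /h/=; ring.
rewrite ge0_integralZl//; last 2 first.
- apply: emeasurable_funD.
  + exact: (measurable_fun_fubini_tonelli_F F).
  + exact: (measurable_fun_fubini_tonelli_F F').
- by move=> x _; rewrite adde_ge0//; apply: integral_ge0.
rewrite ge0_integralD//; last 4 first.
- by move=> x _; apply: integral_ge0.
- exact: (measurable_fun_fubini_tonelli_F F).
- by move=> x _; apply: integral_ge0.
- exact: (measurable_fun_fubini_tonelli_F F').
rewrite (lapM mf mh)// (lapM mh mf)// [X in (_ + X)%E]muleC.
rewrite -mule2n -(mule_natl _ 2) muleA -EFinM mulVf ?mul1e//.
Qed.

Lemma cvg_lapN t z : 0 <= t -> lapN n t z @[n --> \oo] --> lap t z.
Proof.
move=> t0; apply: cvg_monotone_integral.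
- by move=> n; apply/measurable_EFinP; exact: measurable_lapN.
- by move=> n x; rewrite lee_fin mulr_ge0// lap_pt_ge0.
- move=> x m n mn; rewrite lee_fin ler_wpM2r ?lap_pt_ge0// ler_nat.
  by case: ltnP => // xm; rewrite (leq_trans xm).
- move=> x; apply: cvg_near_cst; exists x.1.+1 => // n /= xn.
  by rewrite xn mul1r.
Qed.

Lemma fin_num_dlapN n t z : 0 <= t -> 0 < z -> (dlapN n t z < +oo)%E.
Proof.
move=> t0 z0.
(* For k < n the power t^k is bounded by a^n; without the maximum this fails when t < 1. *)
pose a : R := Num.max 1 t.
have a1 : 1 <= a by rewrite le_max lexx.
have z20 : 0 < z / 2 by rewrite divr_gt0.
have := pos_nat_lap b0 n z20.
set I := (\int[_]_x _)%E => Ioo.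
have mI : measurable_fun setT (fun x : X => ((x.1 < n)%N%:R * expR (- (z / 2 * x.2)))%:E : \bar R).
  by apply/measurable_EFinP; exact: (measurable_nat_expRNM (fun k => (k < n)%N%:R)).
apply: (@le_lt_trans _ _ ((a ^+ n * (2 / z))%:E * I)%E); last first.
  by rewrite lte_mul_pinfty// lee_fin mulr_ge0 ?exprn_ge0 ?divr_ge0// ?ltW// (lt_le_trans _ a1).
have c0 : 0 <= a ^+ n * (2 / z).
  by rewrite mulr_ge0 ?exprn_ge0 ?divr_ge0// ?(ltW z0)// (le_trans _ a1).
rewrite -ge0_integralZl ?lee_fin//.
apply: le_pos_integral.
- by apply/measurable_EFinP; exact: measurable_dlapN.
- exact: emeasurable_funM.
- by move=> x; rewrite lee_fin mulr_ge0// dlap_pt_ge0.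
- by move=> x; rewrite -EFinM lee_fin mulr_ge0// mulr_ge0// expR_ge0.
move=> x x0; rewrite -EFinM lee_fin [leRHS]mulrCA.
have [xn|xn] := ltnP x.1 n; last by rewrite !mul0r.
rewrite ler_wpM2l// mulrCA -[leRHS]mulrA; apply: ler_pM.
- by rewrite exprn_ge0.
- by rewrite mulr_ge0// expR_ge0.
- apply: (@le_trans _ _ (a ^+ x.1)); last by rewrite ler_weXn2l// ltnW.
  have ta : t <= a by rewrite le_max lexx orbT.
  by rewrite lerXn2r// nnegrE (le_trans t0).
- by rewrite gtr0_norm// mulr_expRN_le.
Qed.

Lemma le_dlapN n s t y z : 0 <= s -> s <= t -> y <= z -> (dlapN n s z <= dlapN n t y)%E.
Proof.
move=> s0 st yz; have t0 := le_trans s0 st; apply: le_pos_integral.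
- by apply/measurable_EFinP; exact: measurable_dlapN.
- by apply/measurable_EFinP; exact: measurable_dlapN.
- by move=> x; rewrite lee_fin mulr_ge0// dlap_pt_ge0.
- by move=> x; rewrite lee_fin mulr_ge0// dlap_pt_ge0.
- move=> x x0; rewrite lee_fin ler_wpM2l// ler_wpM2l//; apply: ler_pM.
  + by rewrite exprn_ge0.
  + by rewrite expR_ge0.
  + by rewrite lerXn2r.
  + by rewrite ler_expR lerN2 ler_wpM2r// ltW.
Qed.

Lemma le_dlapNS n s z : 0 <= s -> (dlapN n s z <= dlapN n.+1 s z)%E.
Proof.
move=> s0; apply: le_pos_integral.
- by apply/measurable_EFinP; exact: measurable_dlapN.
- by apply/measurable_EFinP; exact: measurable_dlapN.
- by move=> x; rewrite lee_fin mulr_ge0// dlap_pt_ge0.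
- by move=> x; rewrite lee_fin mulr_ge0// dlap_pt_ge0.
- move=> x x0; rewrite lee_fin ler_wpM2r ?dlap_pt_ge0// ler_nat.
  by case: ltnP => // xn; rewrite (ltnW xn : (x.1 < n.+1)%N).
Qed.

(** Pairs with i + j + 1 <= n satisfy i < n and j < n, but not conversely. The truncated series thus
    satisfies the Burgers equation only as an inequality, in the direction that upper bounds
    require. *)
Lemma conv_lapN n s z : 0 <= s ->
  (\int[Pi]_x ((x.1 < n.+1)%N%:R * (x.1%:R * s ^+ x.1.-1 * expR (- (z * x.2))))%:E <=
   lapN n s z * dlapN n s z)%E.
Proof.
move=> s0.
pose h (x : X) : R := (x.1 < n.+1)%N%:R * (s ^+ x.1.-1 * expR (- (z * x.2))).
have mh : measurable_fun setT h.
  apply: measurable_funM.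
    exact: (measurable_nat_fst (fun k => (k < n.+1)%N%:R)).
  exact: (measurable_nat_expRNM (fun k => s ^+ k.-1)).
have h0 x : 0 <= h x by rewrite mulr_ge0// mulr_ge0 ?exprn_ge0 ?expR_ge0.
pose f (x : X) : R := (x.1 < n)%N%:R * (s ^+ x.1 * expR (- (z * x.2))).
have mf : measurable_fun setT f by exact: measurable_lapN.
have f0 x : 0 <= f x by rewrite mulr_ge0// lap_pt_ge0.
have -> : (lapN n s z * dlapN n s z = \int[Pi]_x \int[Pi]_y
   (f x * f y * ((`|x.2| + `|y.2|) / 2))%:E)%E.
  rewrite lapM_sym//; congr (_ * _)%E; apply: eq_integral => x _.
  by congr EFin; rewrite /f mulrCA.
under eq_integral do rewrite mulrA [X in (X * _)%:E]mulrCA -!mulrA EFinM.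
have -> : (\int[Pi]_x ((x.1)%:R%:E * ((x.1 < n.+1)%N%:R * (s ^+ x.1.-1 * expR (- (z * x.2))))%:E) =
  \int[Pi]_x (x.1%:R%:E * (h x)%:E))%E by [].
have mF' : measurable_fun setT (fun x : X => (h x)%:E : \bar R) by exact/measurable_EFinP.
rewrite (integral_pos_natM _ mF') => [|x]; last by rewrite lee_fin.
pose F (p : X * X) : \bar R := ((h ((p.1.1 + p.2.1).+1, p.1.2 + p.2.2)%R)%:E * (`|p.1.2 + p.2.2| / 2)%:E)%E.
have F0 p : (0 <= F p)%E by apply: mule_ge0; rewrite lee_fin ?h0 ?divr_ge0.
have mF : measurable_fun setT F by exact: (measurable_pos_natM mF').
pose G (p : X * X) : \bar R := (f p.1 * f p.2 * ((`|p.1.2| + `|p.2.2|) / 2))%:E.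
have G0 p : (0 <= G p)%E by rewrite lee_fin mulr_ge0 ?divr_ge0 ?addr_ge0// mulr_ge0.
have mG : measurable_fun setT G.
  apply/measurable_EFinP; apply: measurable_funM.
    by apply: measurable_funM; exact: measurableT_comp.
  apply: measurable_funM => //; apply: measurable_funD.
    exact: (measurableT_comp measurable_abs_snd measurable_fst).
  exact: (measurableT_comp measurable_abs_snd measurable_snd).
apply: ge0_le_integral => //.
- by move=> x _; apply: integral_ge0 => y _; exact: F0 (x, y).
- exact: (measurable_fun_fubini_tonelli_F F).
- exact: (measurable_fun_fubini_tonelli_F G).
move=> x _; apply: ge0_le_integral => //.
- by move=> y _; exact: F0 (x, y).
- exact: (measurableT_comp mF (pair1_measurable _)).
- exact: (measurableT_comp mG (pair1_measurable _)).
move=> y _; rewrite /h/= -EFinM lee_fin ltnS.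
have -> : ((x.1 + y.1).+1 <= n)%N%:R * (s ^+ (x.1 + y.1) * expR (- (z * (x.2 + y.2)))) * (`|x.2 + y.2| / 2) =
   ((x.1 + y.1).+1 <= n)%N%:R * ((s ^+ x.1 * expR (- (z * x.2))) * (s ^+ y.1 * expR (- (z * y.2)))) * (`|x.2 + y.2| / 2).
  by rewrite exprD mulrDr opprD expRD; ring.
rewrite /f; apply: ler_pM => //.
- by rewrite mulr_ge0// mulr_ge0// lap_pt_ge0.
- rewrite [leRHS]mulrACA; apply: ler_wpM2r; first by rewrite mulr_ge0 ?lap_pt_ge0.
  rewrite -natrM ler_nat.
  case: ltnP => // xyn; rewrite !(leq_ltn_trans _ xyn)// ?leq_addr ?leq_addl//.
- by rewrite ler_wpM2r ?invr_ge0// ler_normD.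
Qed.

(** The Burgers equation: the left-hand side is the time derivative of the series at fixed [z]. *)
Lemma conv_lap s z : 0 <= s ->
  (\int[Pi]_x (x.1%:R * s ^+ x.1.-1 * expR (- (z * x.2)))%:E = lap s z * dlap s z)%E.
Proof.
move=> s0.
pose h (x : X) : R := s ^+ x.1.-1 * expR (- (z * x.2)).
have mh : measurable_fun setT h.
  exact: (measurable_nat_expRNM (fun k => s ^+ k.-1)).
have h0 x : 0 <= h x by rewrite mulr_ge0 ?exprn_ge0 ?expR_ge0.
pose f (x : X) : R := s ^+ x.1 * expR (- (z * x.2)).
have mf : measurable_fun setT f by exact: measurable_lap.
have f0 x : 0 <= f x by rewrite lap_pt_ge0.
have mF' : measurable_fun setT (fun x : X => (h x)%:E : \bar R) by exact/measurable_EFinP.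
transitivity (\int[Pi]_x (x.1%:R%:E * (h x)%:E))%E.
  by apply: eq_integral => x _; rewrite -EFinM mulrA.
rewrite (integral_pos_natM _ mF') => [|x]; last by rewrite lee_fin.
transitivity (\int[Pi]_x \int[Pi]_y (f x * f y * ((`|x.2| + `|y.2|) / 2))%:E)%E; last exact: lapM_sym.
pose F (p : X * X) : \bar R := ((h ((p.1.1 + p.2.1).+1, p.1.2 + p.2.2)%R)%:E * (`|p.1.2 + p.2.2| / 2)%:E)%E.
have F0 p : (0 <= F p)%E by apply: mule_ge0; rewrite lee_fin ?h0 ?divr_ge0.
have mF : measurable_fun setT F by exact: (measurable_pos_natM mF').
pose G (p : X * X) : \bar R := (f p.1 * f p.2 * ((`|p.1.2| + `|p.2.2|) / 2))%:E.
have G0 p : (0 <= G p)%E by rewrite lee_fin mulr_ge0 ?divr_ge0 ?addr_ge0// mulr_ge0.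
have mG : measurable_fun setT G.
  apply/measurable_EFinP; apply: measurable_funM.
    by apply: measurable_funM; exact: measurableT_comp.
  apply: measurable_funM => //; apply: measurable_funD.
    exact: (measurableT_comp measurable_abs_snd measurable_fst).
  exact: (measurableT_comp measurable_abs_snd measurable_snd).
apply: eq_pos_integral.
- exact: (measurable_fun_fubini_tonelli_F F).
- exact: (measurable_fun_fubini_tonelli_F G).
move=> x x0; apply: eq_pos_integral.
- exact: (measurableT_comp mF (pair1_measurable _)).
- exact: (measurableT_comp mG (pair1_measurable _)).
move=> y y0; rewrite /h/= -EFinM; congr EFin.
rewrite !gtr0_norm ?addr_gt0// /f exprD mulrDr opprD expRD; ring.
Qed.

(* With c = lap0 w, induction on the truncation order: along the line
   s |-> w + s c, the derivative of the truncation at order n + 1 is at most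
   (lapN n - c) * dlapN (n + 1). *)
Lemma lapN_le n t w : 0 <= t -> 0 < w -> (lapN n t (w + t * lap0 w) <= (lap0 w)%:E)%E.
Proof.
elim: n t => [|n IH] t t0 w0.
  rewrite /lapN integral0_eq ?lee_fin ?lap0_ge0// => x _.
  by rewrite ltn0 mul0r.
move: (lap0_ge0 w) (lap0E (ltW w0)) IH; move: (lap0 w) => c c0 cE IH.
pose g (x : X) : R := (x.1 < n.+1)%N%:R.
have g0 x : 0 <= g x by rewrite ler0n.
have mg : measurable_fun setT g by exact: (measurable_nat_fst (fun k => (k < n.+1)%N%:R)).
have gint : (\int[Pi]_x (g x * (0 ^+ x.1 * expR (- (w * x.2))))%:E = c%:E)%E.
  rewrite integral_pos_nat0.
  - rewrite -cE; apply: eq_integral => m _.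
    by rewrite /g/= expr0 !mul1r.
  - by apply/measurable_EFinP; apply: measurable_funM; [exact: mg|exact: measurable_lap].
  - by move=> x; rewrite lee_fin mulr_ge0 ?g0 ?lap_pt_ge0.
  - by move=> k m; rewrite expr0n/= mul0r mulr0.
have dN0 s : 0 <= s -> (0 <= dlapN n.+1 s (w + s * c))%E by move=> s0; exact: dlapN_ge0.
have mdN : measurable_fun `[0, t]%classic (fun s : mR => dlapN n.+1 s (w + s * c))%E.
  have ma : measurable_fun setT (fun x : X => g x * `|x.2|).
    by apply: measurable_funM; [exact: mg|exact: measurable_abs_snd].
  have a0 (x : X) : 0 <= g x * `|x.2| by rewrite mulr_ge0 ?g0.
  apply: (measurable_time_series b0 (j := id) (w := w) (c := c) ma a0) => s x.
  by rewrite /g mulrA.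
have mIs : measurable_fun `[0, t]%classic (fun s : mR => c%:E * dlapN n.+1 s (w + s * c))%E.
  exact: emeasurable_funM.
pose J := (\int[leb]_(s in `[0%R, t]) (c%:E * dlapN n.+1 s (w + s * c)))%E.
(* This holds thanks to the truncation, and allows [J] to be cancelled from both sides of the
   Duhamel formula. *)
have Jfin : J \is a fin_num.
  have J0 : (0 <= J)%E.
    apply: integral_ge0 => s; rewrite /= in_itv/= => /andP[s0 _].
    by rewrite mule_ge0 ?dN0// lee_fin.
  rewrite ge0_fin_numE//.
  have dfin : dlapN n.+1 t w \is a fin_num.
    by rewrite ge0_fin_numE ?dlapN_ge0// fin_num_dlapN.
  apply: (@le_lt_trans _ _ (\int[leb]_(s in `[0%R, t]) (c * fine (dlapN n.+1 t w))%:E)%E).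
    apply: ge0_le_integral => //.
    - move=> s; rewrite /= in_itv/= => /andP[s0 _].
      by rewrite mule_ge0 ?dN0// lee_fin.
    move=> s; rewrite /= in_itv/= => /andP[s0 st].
    rewrite EFinM fineK//; apply: lee_wpmul2l; first by rewrite lee_fin.
    by apply: le_dlapN => //; rewrite lerDl mulr_ge0.
  by rewrite integral_itv_cst// ltry.
have := duhamel b0 w t0 c0 mg g0; rewrite gint.
have -> : (\int[leb]_(s in `[0%R, t])
   \int[Pi]_x (g x * (c * `|x.2| * s ^+ x.1 * expR (- ((w + s * c) * x.2))))%:E = J)%E.
  apply: eq_integral => s; rewrite inE/= in_itv/= => /andP[s0 _].
  rewrite /dlapN -ge0_integralZl.
  - by apply: eq_integral => x _; rewrite -EFinM; congr EFin; rewrite /g; ring.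
  - by [].
  - by apply/measurable_EFinP; exact: measurable_dlapN.
  - by move=> x _; rewrite lee_fin mulr_ge0 ?dlap_pt_ge0.
  - by rewrite lee_fin.
move=> duh; rewrite -(leeD2rE _ _ Jfin) [X in (X <= _)%E]duh leeD2lE//.
apply: ge0_le_integral => //.
- move=> s; rewrite /= in_itv/= => /andP[s0 _].
  apply: integral_ge0 => x _; rewrite lee_fin; apply: mulr_ge0; first exact: g0.
  by rewrite mulr_ge0 ?expR_ge0// mulr_ge0 ?exprn_ge0.
- have ma : measurable_fun setT (fun x : X => g x * x.1%:R).
    by apply: measurable_funM; [exact: mg|exact: (measurable_nat_fst (fun k => k%:R))].
  have a0 (x : X) : 0 <= g x * x.1%:R by rewrite mulr_ge0 ?g0.
  apply: (measurable_time_series b0 (j := predn) (w := w) (c := c) ma a0) => s x.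
  by rewrite !mulrA.
move=> s; rewrite /= in_itv/= => /andP[s0 st].
apply: le_trans (conv_lapN n (w + s * c) s0) _.
apply: lee_pmul; [exact: lapN_ge0|exact: dlapN_ge0|exact: IH|exact: le_dlapNS].
Qed.

Lemma lap_le t w : 0 <= t -> 0 < w -> (lap t (w + t * lap0 w) <= (lap0 w)%:E)%E.
Proof.
move=> t0 w0; apply: (cvge_to_le (cvg_lapN (z := w + t * lap0 w) t0)).
by apply: nearW => n; exact: lapN_le.
Qed.

(** With the absolute value the integrand is monotone in [z] at every point, and not only almost
    everywhere. *)
Lemma lap_absE t z : lap t z = (\int[Pi]_x (t ^+ x.1 * expR (- (z * `|x.2|)))%:E)%E.
Proof.
apply: eq_pos_integral.
- by apply/measurable_EFinP; exact: measurable_lap.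
- apply/measurable_EFinP; apply: measurable_funM.
    exact: (measurable_nat_fst (fun k => t ^+ k)).
  exact: (measurableT_comp (measurable_expRNM z) measurable_abs_snd).
- by move=> x x0; rewrite gtr0_norm.
Qed.

Lemma harmonic_noninc : nonincreasing_seq (@harmonic R).
Proof. by move=> m n mn; rewrite /harmonic lef_pV2 ?posrE// ler_nat. Qed.

Lemma harmonic_gt0 n : 0 < @harmonic R n.
Proof. by rewrite /harmonic invr_gt0. Qed.

Lemma cvg_lap t z (d : R^nat) : 0 <= t -> nonincreasing_seq d -> (forall n, 0 <= d n) ->
  d n @[n --> \oo] --> 0 -> lap t (z + d n) @[n --> \oo] --> lap t z.
Proof.
move=> t0 nid d0 dc; rewrite lap_absE; under eq_fun do rewrite lap_absE.
apply: cvg_monotone_integral.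
- move=> n; apply/measurable_EFinP; apply: measurable_funM.
    exact: (measurable_nat_fst (fun k => t ^+ k)).
  exact: (measurableT_comp (measurable_expRNM _) measurable_abs_snd).
- by move=> n x; rewrite lee_fin mulr_ge0 ?exprn_ge0 ?expR_ge0.
- move=> x m n mn; rewrite lee_fin ler_wpM2l ?exprn_ge0// ler_expR lerN2.
  by rewrite ler_wpM2r// lerD2l nid.
- move=> x; apply: cvg_EFin; first exact: nearW.
  apply: cvgMl_tmp; apply: (continuous_cvg _ (@continuous_expR R _)).
  apply: cvgN; apply: cvgMr_tmp; rewrite -[X in _ --> X]addr0.
  by apply: cvgD => //; exact: cvg_cst.
Qed.

(** A point z > t M_0 lies above the end w + t G w of the characteristic started at w = z - t M_0,
    because G w <= M_0. The boundary case follows by monotone convergence. *)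
Lemma lap_le_mass t z : 0 <= t -> t * lap0 0 <= z -> (lap t z <= (lap0 0)%:E)%E.
Proof.
move=> t0.
have h y : t * lap0 0 < y -> (lap t y <= (lap0 0)%:E)%E.
  move=> ty; have w0 : 0 < y - t * lap0 0 by rewrite subr_gt0.
  apply: le_trans (_ : (lap0 (y - t * lap0 0))%:E <= _)%E; last first.
    by rewrite lee_fin le_lap0// ltW.
  apply: le_trans (lap_le t0 w0); apply: le_lap => //.
  have : t * lap0 (y - t * lap0 0) <= t * lap0 0 by rewrite ler_wpM2l// le_lap0// ltW.
  by lra.
move=> tz; apply: (cvge_to_le (cvg_lap (z := z) t0 harmonic_noninc (fun n => ltW (harmonic_gt0 n)) cvg_harmonic)).
apply: nearW => n; apply: h; apply: le_lt_trans tz _.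
by rewrite ltrDl harmonic_gt0.
Qed.

(* Gronwall's lemma applied to lap0 w - lap s (w + s c) along the line. *)
Lemma lap_eq t w : 0 <= t -> 0 < w -> 0 < w - t * (lap0 0 - lap0 w) ->
  lap t (w + t * lap0 w) = (lap0 w)%:E.
Proof.
move=> t0 w0.
have cM : lap0 w <= lap0 0 by rewrite le_lap0// ltW.
have lap_lew s : 0 <= s -> (lap s (w + s * lap0 w) <= (lap0 w)%:E)%E.
  by move=> s0; exact: lap_le.
move: (lap0_ge0 w) (lap0E (ltW w0)) cM lap_lew.
move: (lap0 w) => c c0 cE cM lap_lew; set psi := w - _ => psi0.
(* For every s <= t the point w + s c exceeds s M_0 by at least psi. Hence the shift by d = psi in
   [dlap_le] stays in the range of [lap_le_mass], and [K] bounds [dlap] along the line. *)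
pose K := psi^-1 * lap0 0.
have K0 : 0 <= K by rewrite mulr_ge0 ?invr_ge0 ?lap0_ge0// ltW.
have lap_fin s : 0 <= s -> lap s (w + s * c) \is a fin_num.
  move=> s0; rewrite ge0_fin_numE ?lap_ge0//.
  by apply: le_lt_trans (lap_lew s s0) _; rewrite ltry.
have dlapK s : 0 <= s <= t -> (dlap s (w + s * c) <= K%:E)%E.
  move=> /andP[s0 st]; apply: le_trans (dlap_le _ s0 psi0) _.
  rewrite EFinM lee_wpmul2l ?lee_fin ?invr_ge0 ?(ltW psi0)//.
  apply: lap_le_mass => //; rewrite /psi opprB addrCA addrAC subrr add0r.
  have : s * (lap0 0 - c) <= t * (lap0 0 - c) by rewrite ler_wpM2r// subr_ge0.
  by rewrite /psi; lra.
have dlap_fin s : 0 <= s <= t -> dlap s (w + s * c) \is a fin_num.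
  move=> st; rewrite ge0_fin_numE ?dlap_ge0//; last by case/andP: st.
  by apply: le_lt_trans (dlapK s st) _; rewrite ltry.
suff : c - fine (lap t (w + t * c)) <= 0.
  rewrite subr_le0 -lee_fin (fineK (lap_fin _ t0)) => h.
  by apply/eqP; rewrite eq_le h lap_lew.
apply: (@gronwall_expn _ (fun s => c - fine (lap s (w + s * c))) t K c K0 c0) => //.
- by move=> s /andP[s0 _]; rewrite gerBl// fine_ge0// lap_ge0.
- move=> n a a0 Da t' /andP[t'0 t't].
  pose I := (\int[leb]_(s in `[0%R, t']) (c%:E * dlap s (w + s * c)))%E.
  pose T := (\int[leb]_(s in `[0%R, t']) (lap s (w + s * c) * dlap s (w + s * c)))%E.
  have mIs : measurable_fun `[0, t']%classic (fun s : mR => c%:E * dlap s (w + s * c))%E.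
    apply: emeasurable_funM => //.
    exact: (measurable_time_series b0 (j := id) (w := w) (c := c) measurable_abs_snd (fun=> normr_ge0 _)).
  have mTs : measurable_fun `[0, t']%classic (fun s : mR => lap s (w + s * c) * dlap s (w + s * c))%E.
    apply: emeasurable_funM.
      apply: (measurable_time_series b0 (j := id) (w := w) (c := c) (measurable_cst (1 : R)) (fun=> ler01)) => s x.
      by rewrite mul1r.
    exact: (measurable_time_series b0 (j := id) (w := w) (c := c) measurable_abs_snd (fun=> normr_ge0 _)).
  have T0 : (0 <= T)%E.
    apply: integral_ge0 => s; rewrite /= in_itv/= => /andP[s0 _].
    by rewrite mule_ge0 ?lap_ge0 ?dlap_ge0.
  have Tfin : T \is a fin_num.
    rewrite ge0_fin_numE//.
    apply: (@le_lt_trans _ _ (\int[leb]_(s in `[0%R, t']) (c * K)%:E)%E).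
      apply: ge0_le_integral => //.
      - move=> s; rewrite /= in_itv/= => /andP[s0 _].
        by rewrite mule_ge0 ?lap_ge0 ?dlap_ge0.
      - move=> s; rewrite /= in_itv/= => /andP[s0 st].
        rewrite EFinM; apply: lee_pmul; rewrite ?lap_ge0 ?dlap_ge0//.
          exact: lap_lew.
        by rewrite dlapK// s0 (le_trans st).
    by rewrite integral_itv_cst// ltry.
  have IT : (I <= T + (K * a / n.+1%:R * t' ^+ n.+1)%:E)%E.
    rewrite -integral_expn// -ge0_integralD//; last 3 first.
    - move=> s; rewrite /= in_itv/= => /andP[s0 _].
      by rewrite mule_ge0 ?lap_ge0 ?dlap_ge0.
    - move=> s; rewrite /= in_itv/= => /andP[s0 _].
      by rewrite lee_fin mulr_ge0 ?exprn_ge0// mulr_ge0.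
    - apply/measurable_EFinP; apply: measurable_funM => //; exact: exprn_measurable.
    apply: ge0_le_integral => //.
    - move=> s; rewrite /= in_itv/= => /andP[s0 _].
      by rewrite mule_ge0 ?dlap_ge0// lee_fin.
    - apply: emeasurable_funD => //.
      apply/measurable_EFinP; apply: measurable_funM => //; exact: exprn_measurable.
    move=> s; rewrite /= in_itv/= => /andP[s0 st].
    have stt : 0 <= s <= t by rewrite s0 (le_trans st).
    have := Da s stt; have := dlapK s stt; have := dlap_ge0 (w + s * c) s0.
    rewrite -(fineK (dlap_fin s stt)) -(fineK (lap_fin s s0)) !lee_fin/=.
    set x := fine _; set y := fine _ => x0 xK yD.
    rewrite -lerBlDl -mulrBl.
    have as0 : 0 <= a * s ^+ n by rewrite mulr_ge0 ?exprn_ge0.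
    apply: (@le_trans _ _ (a * s ^+ n * x)); first by rewrite ler_wpM2r.
    rewrite [leRHS](_ : _ = a * s ^+ n * K); last by ring.
    by rewrite ler_wpM2l.
  have := duhamel b0 w t'0 c0 (measurable_cst (1 : R)) (fun=> ler01).
  have -> : (\int[Pi]_x (cst 1 x * (t' ^+ x.1 * expR (- ((w + t' * c) * x.2))))%:E = lap t' (w + t' * c))%E.
    by apply: eq_integral => x _; rewrite mul1r.
  have -> : (\int[Pi]_x (cst 1 x * (0 ^+ x.1 * expR (- (w * x.2))))%:E = c%:E)%E.
    rewrite integral_pos_nat0.
    - rewrite -cE; apply: eq_integral => m _.
      by rewrite /= expr0 !mul1r.
    - by apply/measurable_EFinP; apply: measurable_funM => //; exact: measurable_lap.
    - by move=> x; rewrite lee_fin mul1r lap_pt_ge0.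
    - by move=> k m; rewrite expr0n/= mul0r mulr0.
  have -> : (\int[leb]_(s in `[0%R, t']) \int[Pi]_x
     (cst 1 x * (c * `|x.2| * s ^+ x.1 * expR (- ((w + s * c) * x.2))))%:E = I)%E.
    apply: eq_integral => s; rewrite inE/= in_itv/= => /andP[s0 _].
    rewrite /dlap -ge0_integralZl.
    - by apply: eq_integral => x _; rewrite -EFinM /=; congr EFin; ring.
    - by [].
    - by apply/measurable_EFinP; exact: measurable_dlap.
    - by move=> x _; rewrite lee_fin dlap_pt_ge0.
    - by rewrite lee_fin.
  have -> : (\int[leb]_(s in `[0%R, t']) \int[Pi]_x
     (cst 1 x * (x.1%:R * s ^+ x.1.-1 * expR (- ((w + s * c) * x.2))))%:E = T)%E.
    apply: eq_integral => s; rewrite inE/= in_itv/= => /andP[s0 _].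
    by rewrite -conv_lap//; apply: eq_integral => x _; rewrite mul1r.
  move=> duh.
  rewrite lerBlDr -lee_fin EFinD (fineK (lap_fin _ t'0)) -(leeD2rE _ _ Tfin) -duh.
  by rewrite [leRHS]addeAC [leRHS]addeC; apply: leeD2l; rewrite addeC.
- by rewrite t0 lexx.
Qed.

End laplace.

(** * Collision terms *)

Lemma funepos_EFin (T : Type) (R : realType) (f : T -> R) x :
  ((fun x => (f x)%:E)^\+ x = (f^\+ x)%:E)%E.
Proof. by rewrite -[LHS]/((EFin \o f)^\+ x)%E funerpos. Qed.

Lemma funeneg_EFin (T : Type) (R : realType) (f : T -> R) x :
  ((fun x => (f x)%:E)^\- x = (f^\- x)%:E)%E.
Proof. by rewrite -[LHS]/((EFin \o f)^\- x)%E funerneg. Qed.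

Section mass_measure.
Context {R : realType}.
Local Notation mR := (measurableTypeR R).
Implicit Types (nu : borel_measure R).

Lemma measurable_pos : measurable (`]0, +oo[%classic : set mR).
Proof. exact: measurable_itv. Qed.

Lemma measurable_inv : measurable_fun setT (fun m : mR => m^-1 : mR).
Proof.
rewrite -(setvU [set 0 : mR]); apply/measurable_funU => //.
  exact: measurableC.
split; last exact: measurable_fun_set1.
apply: subspace_continuous_measurable_fun; first exact: measurableC.
apply: continuous_in_subspaceT => x; rewrite inE/= => /eqP x0.
exact: inv_continuous.
Qed.

(** The measure m nu(dm), with weight |m| off the support. *)
Definition mass_measure nu : borel_measure R :=
  wimage nu (@measurable_id _ mR setT) (@measurable_id _ mR setT).

Section supp.
Variables (nu : borel_measure R) (nu0 : nu `]-oo, 0]%classic = 0%E).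

Lemma pairing_ge0 (f : R -> R) : (forall m, 0 < m -> 0 <= f m) -> (0 <= pairing nu f)%E.
Proof.
by move=> f0; apply: integral_ge0 => m; rewrite /= in_itv/= andbT lee_fin => /f0.
Qed.

Lemma pairingE (f : R -> R) : measurable_fun setT f ->
  (pairing nu f = \int[nu]_m (f m)%:E)%E.
Proof. by move=> mf; rewrite /pairing supp_integral//; exact/measurable_EFinP. Qed.

Lemma eq_pairing (f g : R -> R) : (forall m, 0 < m -> f m = g m) ->
  pairing nu f = pairing nu g.
Proof.
by move=> fg; apply: eq_integral => m; rewrite inE/= in_itv/= andbT => /fg ->.
Qed.

Lemma le_pairing (f g : R -> R) : measurable_fun setT f -> measurable_fun setT g ->
  (forall m, 0 < m -> 0 <= f m <= g m) -> (pairing nu f <= pairing nu g)%E.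
Proof.
move=> mf mg fg; apply: ge0_le_integral.
- exact: measurable_pos.
- by move=> m; rewrite /= in_itv/= andbT lee_fin => /fg/andP[].
- by apply/measurable_EFinP; exact: measurable_funTS.
- by apply/measurable_EFinP; exact: measurable_funTS.
- by move=> m; rewrite /= in_itv/= andbT lee_fin => /fg/andP[].
Qed.

Lemma integral_mass_measure (f : R -> R) : measurable_fun setT f ->
  (\int[mass_measure nu]_m (f m)%:E = pairing nu (fun m => m * f m)%R)%E.
Proof.
move=> mf.
have ge0case (g : R -> R) : measurable_fun setT g -> (forall m, 0 <= g m) ->
    (\int[mass_measure nu]_m (g m)%:E = pairing nu (fun m => m * g m)%R)%E.
  move=> mg g0; rewrite integral_wimage//; last exact/measurable_EFinP.
  rewrite pairingE; last by apply: measurable_funM.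
  apply: eq_supp_integral => //.
  - apply: emeasurable_funM; apply/measurable_EFinP => //; exact: measurableT_comp.
  - by apply/measurable_EFinP; exact: measurable_funM.
  - by move=> m m0; rewrite gtr0_norm// -EFinM mulrC.
rewrite integralE /pairing [RHS]integralE; congr (_ - _)%E.
- rewrite -/(pairing nu _).
  transitivity (\int[mass_measure nu]_m (f^\+ m)%:E)%E.
    by apply: eq_integral => m _; exact: funepos_EFin.
  rewrite ge0case//; last exact: measurable_funrpos.
  apply: eq_integral => m; rewrite inE/= in_itv/= andbT => m0.
  by rewrite funepos_EFin /funrpos/= maxr_pMr ?mulr0// ltW.
- transitivity (\int[mass_measure nu]_m (f^\- m)%:E)%E.
    by apply: eq_integral => m _; exact: funeneg_EFin.
  rewrite ge0case//; last exact: measurable_funrneg.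
  apply: eq_integral => m; rewrite inE/= in_itv/= andbT => m0.
  by rewrite funeneg_EFin /funrneg/= maxr_pMr ?mulr0 ?mulrN// ltW.
Qed.

Lemma mass_measureT : mass_measure nu setT = moment1 nu.
Proof.
rewrite -[LHS]mul1e -(integral_cst _ measurableT 1) integral_mass_measure//.
by apply: eq_pairing => m _; rewrite mulr1.
Qed.

Lemma mass_measure_supp : mass_measure nu `]-oo, 0]%classic = 0%E.
Proof.
transitivity (\int[mass_measure nu]_m (\1_(`]-oo, 0%R]%classic : set mR) m)%:E)%E.
  by rewrite integral_indic// setIT.
rewrite integral_mass_measure//.
transitivity (pairing nu (cst 0)); last by rewrite /pairing integral0.
apply: eq_pairing => m m0; rewrite indicE memNset ?mulr0//= in_itv/=.
by apply/negP; rewrite -ltNge.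
Qed.

End supp.
End mass_measure.

Section finite_measure_integrals.
Context {R : realType}.
Local Notation mR := (measurableTypeR R).
Variables (rho : {finite_measure set mR -> \bar R}).

Lemma finite_integrable d (T : measurableType d) (mu : {finite_measure set T -> \bar R})
    (f : T -> R) (C : R) : measurable_fun setT f ->
  (forall m, `|f m| <= C) -> mu.-integrable setT (fun x => (f x)%:E).
Proof.
move=> mf fC; apply: measurable_bounded_integrable => //.
  exact: fin_num_fun_lty.
by exists C; split; rewrite ?num_real// => D CD x _ /=; rewrite (le_trans (fC x))// ltW.
Qed.

Variables (phi : R -> R) (C : R).
Hypotheses (mphi : measurable_fun setT phi) (phiC : forall m, `|phi m| <= C).

Let C0 : 0 <= C. Proof. exact: le_trans (normr_ge0 _) (phiC 0). Qed.

Let iphi : rho.-integrable setT (EFin \o phi).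
Proof. exact: (finite_integrable rho mphi phiC). Qed.

Let iphiD x : rho.-integrable setT (fun y => (phi (x + y))%:E).
Proof.
apply: (finite_integrable rho (f := fun y => phi (x + y)) _ (fun y => phiC (x + y))).
by apply: (measurableT_comp mphi); exact: measurable_funD.
Qed.

Lemma finite_Rintegral_le (f : R -> R) (K : R) : measurable_fun setT f ->
  (forall m, `|f m| <= K) ->
  `|fine (\int[rho]_m (f m)%:E)%E| <= K * fine (rho setT).
Proof.
move=> mf fK.
have := @le_normr_Rintegral _ _ _ rho setT f measurableT (finite_integrable rho mf fK).
rewrite /Rintegral => /le_trans; apply.
have Kf : (K%:E * rho setT)%E \is a fin_num by rewrite fin_numM// fin_num_measure.
rewrite -[leRHS](fineM (_ : K%:E \is a fin_num))// ?fin_num_measure//.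
rewrite -(integral_cst rho measurableT K%:E); apply: fine_le.
- apply: integrable_fin_num => //.
  apply: (finite_integrable rho (f := fun m => `|f m|) (C := K)).
    exact: measurableT_comp.
  by move=> m; rewrite normr_id.
- by rewrite integral_cst.
- apply: ge0_le_integral => //.
  + by apply/measurable_EFinP; exact: measurableT_comp.
  + by move=> x _; rewrite lee_fin.
Qed.

Let mconv : measurable_fun setT (fun p : mR * mR => phi (p.1 + p.2)).
Proof. by apply: (measurableT_comp mphi); exact: measurable_funD. Qed.

Lemma measurable_conv_finite :
  measurable_fun setT (fun x : mR => fine (\int[rho]_y (phi (x + y))%:E)%E).
Proof.
have mp : measurable_fun setT (fun p : mR * mR => ((phi^\+) (p.1 + p.2))%:E : \bar R).
  apply/measurable_EFinP.
  by apply: (measurableT_comp (measurable_funrpos mphi)); exact: measurable_funD.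
have mn : measurable_fun setT (fun p : mR * mR => ((phi^\-) (p.1 + p.2))%:E : \bar R).
  apply/measurable_EFinP.
  by apply: (measurableT_comp (measurable_funrneg mphi)); exact: measurable_funD.
apply: measurableT_comp => //.
rewrite (_ : (fun x => _) = fun x : mR => (\int[rho]_y ((phi^\+) (x + y))%:E -
    \int[rho]_y ((phi^\-) (x + y))%:E)%E).
  apply: emeasurable_funB.
  - by apply: (measurable_fun_fubini_tonelli_F _ mp) => p; rewrite lee_fin funrpos_ge0.
  - by apply: (measurable_fun_fubini_tonelli_F _ mn) => p; rewrite lee_fin funrneg_ge0.
apply/funext => x; rewrite integralE; congr (_ - _)%E; apply: eq_integral => y _.
  exact: (funepos_EFin (fun y => phi (x + y))).
exact: (funeneg_EFin (fun y => phi (x + y))).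
Qed.

Lemma integral_Delta :
  (\int[rho]_x \int[rho]_y (Delta phi x y)%:E =
   (fine (\int[rho]_x \int[rho]_y (phi (x + y))%:E) -
     2 * fine (rho setT) * fine (\int[rho]_x (phi x)%:E))%:E)%E.
Proof.
pose Phi x := fine (\int[rho]_y (phi (x + y))%:E)%E.
have mPhi : measurable_fun setT Phi by exact: measurable_conv_finite.
pose a := fine (rho setT); pose r := fine (\int[rho]_x (phi x)%:E)%E.
have PhiE x : (\int[rho]_y (phi (x + y))%:E = (Phi x)%:E)%E.
  by rewrite fineK//; exact: integrable_fin_num.
have PhiC x : `|Phi x| <= C * a.
  rewrite /Phi; apply: finite_Rintegral_le => //.
  by apply: (measurableT_comp mphi); exact: measurable_funD.
have iPhi : rho.-integrable setT (EFin \o Phi) by exact: (finite_integrable rho mPhi PhiC).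
have rE : (\int[rho]_x (phi x)%:E = r%:E)%E by rewrite fineK//; exact: integrable_fin_num.
have intc (k : R) : (\int[rho]_x k%:E = (k * a)%:E)%E.
  by rewrite integral_cst// EFinM fineK// fin_num_measure.
have inner x : (\int[rho]_y (Delta phi x y)%:E = (Phi x - phi x * a - r)%:E)%E.
  rewrite /Delta.
  under eq_integral do rewrite EFinB EFinB.
  have ic : rho.-integrable setT (fun y => (phi x)%:E).
    exact: (finite_integrable rho (measurable_cst (phi x)) (fun=> phiC x)).
  rewrite integralB//; last exact: integrableB.
  rewrite integralB// PhiE rE intc.
  by rewrite -!EFinB.
under eq_integral do rewrite inner EFinB EFinB.
have ipa : rho.-integrable setT (fun x => (phi x * a)%:E).
  apply: (finite_integrable rho (f := fun x => phi x * a) (C := C * `|a|)).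
    exact: measurable_funM.
  by move=> x; rewrite normrM ler_wpM2r.
have ir : rho.-integrable setT (fun x => r%:E).
  exact: (finite_integrable rho (measurable_cst r) (fun=> lexx `|r|)).
rewrite integralB//; last exact: integrableB.
rewrite integralB// intc.
under [X in fine X]eq_integral do rewrite PhiE.
under [X in (_ - X - _)%E]eq_integral do rewrite EFinM.
rewrite integralZr// rE -!EFinM -[X in (X - _ - _)%E]fineK; last exact: integrable_fin_num.
by rewrite -!EFinB; congr EFin; rewrite /= -/a; ring.
Qed.

End finite_measure_integrals.

Section finite_pack.
Context d (T : measurableType d) (R : realType) (mu : {measure set T -> \bar R}).

Definition fin_pack (_ : (mu setT < +oo)%E) : set T -> \bar R := mu.

Variable h : (mu setT < +oo)%E.
HB.instance Definition _ := Measure.on (fin_pack h).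

Let fin : fin_num_fun (fin_pack h).
Proof.
apply: lty_fin_num_fun => /=; exact: h.
Qed.

HB.instance Definition _ := Measure_isFinite.Build _ _ _ (fin_pack h) fin.
End finite_pack.

Section flory_terms.
Context {R : realType}.
Local Notation mR := (measurableTypeR R).
Variables (nu : borel_measure R) (nu0 : nu `]-oo, 0]%classic = 0%E).
Hypothesis nu_mass : (moment1 nu < +oo)%E.

Lemma mass_measure_lty : (mass_measure nu setT < +oo)%E.
Proof. by rewrite mass_measureT. Qed.

Definition fmass : {finite_measure set mR -> \bar R} := fin_pack mass_measure_lty.

Lemma integral_fmass (f : R -> R) : measurable_fun setT f ->
  (\int[fmass]_m (f m)%:E = pairing nu (fun m => m * f m)%R)%E.
Proof. exact: integral_mass_measure. Qed.

Lemma fmassT : fmass setT = moment1 nu.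
Proof. exact: mass_measureT. Qed.

Lemma eq_coag_term (phi psi : R -> R) : (forall m, 0 < m -> phi m = psi m) ->
  coag_term nu phi = coag_term nu psi.
Proof.
move=> e; apply: eq_integral => x; rewrite inE/= in_itv/= andbT => x0.
apply: eq_integral => y; rewrite inE/= in_itv/= andbT => y0.
by rewrite /Delta !e ?addr_gt0.
Qed.

Lemma eq_gel_term mu0 (phi psi : R -> R) : (forall m, 0 < m -> phi m = psi m) ->
  gel_term mu0 nu phi = gel_term mu0 nu psi.
Proof.
by move=> e; congr (_ * _)%E; apply: eq_pairing => m m0; rewrite e.
Qed.

Variables (phi : R -> R) (C : R).
Hypotheses (mphi : measurable_fun setT phi) (phiC : forall m, `|phi m| <= C).

Lemma pairing_mass_fin : pairing nu (fun m => m * phi m) \is a fin_num.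
Proof.
rewrite -integral_fmass//; apply: integrable_fin_num => //.
exact: (finite_integrable fmass mphi phiC).
Qed.

(** The factors m and m' are moved into the finite measure m nu(dm), against which the bounded
    function [Delta phi] can be split: phi (x + y) is the gain, while phi x and phi y contribute the
    same loss. *)
Lemma coag_termE : coag_term nu phi =
  (fine (\int[fmass]_x \int[fmass]_y (phi (x + y))%:E)%E -
   2 * fine (moment1 nu) * fine (pairing nu (fun m => m * phi m)))%:E.
Proof.
rewrite -fmassT -integral_fmass// -(integral_Delta fmass mphi phiC).
pose Psi x := fine (\int[fmass]_y (Delta phi x y)%:E)%E.
have mD : measurable_fun setT (fun p : mR * mR => Delta phi p.1 p.2).
  apply: measurable_funB; first apply: measurable_funB.
  - by apply: (measurableT_comp mphi); exact: measurable_funD.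
  - exact: measurableT_comp.
  - exact: measurableT_comp.
have mDx x : measurable_fun setT (fun y : mR => Delta phi x y).
  exact: (measurableT_comp mD (pair1_measurable _)).
have DC x y : `|Delta phi x y| <= C + C + C.
  rewrite /Delta (le_trans (ler_normB _ _))// lerD// (le_trans (ler_normB _ _))// lerD//.
have iD x : fmass.-integrable setT (fun y => (Delta phi x y)%:E).
  exact: (finite_integrable fmass (mDx x) (DC x)).
have PsiE x : (\int[fmass]_y (Delta phi x y)%:E = (Psi x)%:E)%E.
  by rewrite fineK//; exact: integrable_fin_num.
have mPsi : measurable_fun setT Psi.
  pose a := fine (fmass setT).
  have -> : Psi = fun x => fine (\int[fmass]_y (phi (x + y))%:E)%E - phi x * a
      - fine (\int[fmass]_y (phi y)%:E)%E.
    apply/funext => x; apply: EFin_inj; rewrite -PsiE /Delta.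
    under eq_integral do rewrite EFinB EFinB.
    have i1 : fmass.-integrable setT (fun y => (phi (x + y))%:E).
      apply: (finite_integrable fmass (f := fun y => phi (x + y)) _ (fun y => phiC (x + y))).
      by apply: (measurableT_comp mphi); exact: measurable_funD.
    have i2 : fmass.-integrable setT (fun y => (phi x)%:E).
      exact: (finite_integrable fmass (measurable_cst (phi x)) (fun=> phiC x)).
    have i3 := finite_integrable fmass mphi phiC.
    rewrite integralB//; last exact: integrableB.
    rewrite integralB// !EFinB !fineK ?integrable_fin_num//.
    by rewrite integral_cst// EFinM fineK// fin_num_measure.
  apply: measurable_funB => //; apply: measurable_funB.
    exact: (measurable_conv_finite fmass mphi).
  exact: measurable_funM.
under [RHS]eq_integral do rewrite PsiE.
rewrite integral_fmass//; apply: eq_integral => x; rewrite inE/= in_itv/= andbT => x0.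
transitivity (pairing nu (fun y => y * (x * Delta phi x y))).
  by apply: eq_integral => y _; congr EFin; rewrite mulrA [y * x]mulrC.
rewrite -(integral_fmass (f := fun y => x * Delta phi x y)); last first.
  by apply: measurable_funM => //; exact: mDx.
under eq_integral do rewrite EFinM.
by rewrite integralZl// PsiE.
Qed.

Lemma gel_termE mu0 : (moment1 mu0 < +oo)%E -> gel_term mu0 nu phi =
  (fine (pairing nu (fun m => m * phi m)) * (fine (moment1 mu0) - fine (moment1 nu)))%:E.
Proof.
move=> mu0_mass; rewrite EFinM EFinB !fineK ?pairing_mass_fin// ge0_fin_numE//;
  by apply: pairing_ge0 => m /ltW.
Qed.

End flory_terms.

(** * The solution *)

Section solution.
Context {R : realType}.
Local Notation leb := (@lebesgue_measure R).
Local Notation mR := (measurableTypeR R).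
Local Notation X := (nat * mR)%type.
Variable mu0 : borel_measure R.
Hypothesis mu0_radon : radon_pos mu0.
Hypothesis mu0_mass : (moment1 mu0 < +oo)%E.

Let mu0_supp : mu0 `]-oo, 0]%classic = 0%E := mu0_radon.1.

Lemma mass_measure_lap z : 0 < z ->
  (\int[mass_measure mu0]_m (expR (- (z * m)))%:E < +oo)%E.
Proof.
move=> z0; rewrite integral_mass_measure//; last exact: measurable_expRNM.
apply: le_lt_trans mu0_mass; apply: le_pairing => //.
- by apply: measurable_funM => //; exact: measurable_expRNM.
- move=> m m0; rewrite mulr_ge0 ?expR_ge0 ?(ltW m0)//=.
  rewrite -[leRHS]mulr1 ler_wpM2l ?(ltW m0)// -[leRHS]expR0 ler_expR.
  by rewrite oppr_le0 mulr_ge0 ?ltW.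
Qed.

Definition mass0 : tame := mk_tame (mass_measure_supp mu0_supp) mass_measure_lap.

Lemma integral_mass0 (f : R -> R) : measurable_fun setT f ->
  (\int[mass0]_m (f m)%:E = pairing mu0 (fun m => m * f m)%R)%E.
Proof. exact: integral_mass_measure. Qed.

Lemma mass0T : mass0 setT = moment1 mu0.
Proof. exact: mass_measureT. Qed.

Lemma mass0_fin : (mass0 setT < +oo)%E.
Proof. by rewrite mass0T. Qed.

Local Notation Pi := (pos_nat mass0).
Local Notation M0 := (lap0 mass0 0).

Lemma M0E : (M0%:E = moment1 mu0)%E.
Proof. by rewrite (lap0_0 mass0_fin) mass0T. Qed.

Definition flow_weight (t : R) (x : X) : R := t ^+ x.1 * expR (- (t * M0 * x.2)) / x.2.

Lemma measurable_flow_weight t : measurable_fun setT (flow_weight t).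
Proof.
apply: measurable_funM; first exact: (measurable_lap t (t * M0)).
exact: (measurableT_comp measurable_inv measurable_snd).
Qed.

Definition flow (t : R) : borel_measure R :=
  wimage Pi (measurable_flow_weight t) (@measurable_snd _ _ nat mR).

Lemma flow_supp t : flow t `]-oo, 0]%classic = 0%E.
Proof.
have mI : measurable (`]-oo, 0]%classic : set mR) by exact: measurable_itv.
transitivity (\int[flow t]_m (\1_(`]-oo, 0%R]%classic : set mR) m)%:E)%E.
  by rewrite integral_indic// setIT.
rewrite integral_wimage//; last by apply/measurable_EFinP; exact: measurable_indic.
rewrite -[RHS](integral0 Pi setT); apply: eq_pos_integral => //.
  apply: emeasurable_funM; apply/measurable_EFinP.
    exact: (measurableT_comp (measurable_indic mI) measurable_snd).
  by apply: measurableT_comp => //; exact: measurable_flow_weight.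
move=> x x0; rewrite indicE memNset ?mul0e//= in_itv/=.
by apply/negP; rewrite -ltNge.
Qed.

Section nonneg_time.
Variables (t : R) (t0 : 0 <= t).

Lemma pairing_flow_ge0 (f : R -> R) : measurable_fun setT f -> (forall m, 0 <= f m) ->
  (pairing (flow t) f = \int[Pi]_x (f x.2 / `|x.2| * (t ^+ x.1 * expR (- (t * M0 * x.2))))%:E)%E.
Proof.
move=> mf f0; rewrite pairingE//; last exact: flow_supp.
rewrite integral_wimage//; last exact/measurable_EFinP.
apply: eq_integral => x _; rewrite -EFinM; congr EFin.
rewrite normrM normfV ger0_norm ?mulr_ge0 ?exprn_ge0 ?expR_ge0//; ring.
Qed.

Lemma pairing_mass_flow (f : R -> R) : measurable_fun setT f -> (forall m, 0 <= f m) ->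
  (pairing (flow t) (fun m => m * f m)%R =
   \int[Pi]_x (f x.2 * (t ^+ x.1 * expR (- (t * M0 * x.2))))%:E)%E.
Proof.
move=> mf f0.
have mf2 : measurable_fun setT (fun x : X => f x.2) by exact: measurableT_comp.
rewrite (@eq_pairing _ (flow t) _ (fun m => `|m| * f m)); last first.
  by move=> m m0; rewrite gtr0_norm.
rewrite pairing_flow_ge0; last 2 first.
- by apply: measurable_funM => //; exact: measurableT_comp.
- by move=> m; rewrite mulr_ge0.
apply: eq_pos_integral.
- apply/measurable_EFinP; apply: measurable_funM; last exact: measurable_lap.
  apply: measurable_funM.
    by apply: measurable_funM => //; exact: measurable_abs_snd.
  by apply: (measurableT_comp measurable_inv); exact: measurable_abs_snd.
- by apply/measurable_EFinP; apply: measurable_funM => //; exact: measurable_lap.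
- move=> x x0; rewrite gtr0_norm// [x.2 * _]mulrC mulfK// gt_eqF//.
Qed.

Lemma moment1_flow : moment1 (flow t) = lap mass0 t (t * M0).
Proof.
rewrite /moment1 (@eq_pairing _ (flow t) _ (fun m => m * (cst 1 m))); last first.
  by move=> m m0; rewrite mulr1.
rewrite pairing_mass_flow//; apply: eq_integral => x _; by rewrite mul1r.
Qed.

Lemma moment2_flow : moment2 (flow t) = dlap mass0 t (t * M0).
Proof.
rewrite /moment2 (@eq_pairing _ (flow t) _ (fun m => m * `|m|)); last first.
  by move=> m m0; rewrite gtr0_norm.
by rewrite pairing_mass_flow//; exact: measurableT_comp.
Qed.

(** The factor e^{- t M_0 m} of the solution shifts the Laplace variable, so the mass, the second
    moment and the generating function are all read off L(t, .) and its derivative at or above t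
    M_0. *)
Lemma genfun_flow u : genfun (flow t) (expR (- u)) = lap mass0 t (t * M0 + u).
Proof.
rewrite /genfun (@eq_pairing _ (flow t) _ (fun m => m * expR (- (u * m)))); last first.
  move=> m m0; rewrite /powR expR_eq0 expRK; congr (_ * expR _); ring.
rewrite pairing_mass_flow; last 2 first.
- exact: measurable_expRNM.
- by move=> m; exact: expR_ge0.
apply: eq_integral => x _; congr EFin; rewrite mulrCA -expRD; congr (_ * expR _); ring.
Qed.

Lemma moment1_flow_le : (moment1 (flow t) <= M0%:E)%E.
Proof. by rewrite moment1_flow; apply: lap_le_mass => //; exact: mass0_fin. Qed.

Lemma moment1_flow_fin : moment1 (flow t) \is a fin_num.
Proof.
rewrite ge0_fin_numE; first by apply: le_lt_trans moment1_flow_le _; rewrite ltry.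
by apply: pairing_ge0 => m /ltW.
Qed.

End nonneg_time.

Lemma genfun0 (nu : borel_measure R) : genfun nu 0 = 0%E.
Proof.
apply: integral0_eq => m; rewrite /= in_itv/= andbT => m0.
by rewrite powR0 ?mulr0// gt_eqF.
Qed.

Lemma genfun1 (nu : borel_measure R) : genfun nu 1 = moment1 nu.
Proof. by apply: eq_pairing => m m0; rewrite powR1 mulr1. Qed.

Lemma genfun_mu0 u : 0 <= u -> genfun mu0 (expR (- u)) = (lap0 mass0 u)%:E.
Proof.
move=> u0; rewrite -(lap0E mass0_fin u0) integral_mass0; last exact: measurable_expRNM.
apply: eq_pairing => m m0; rewrite /powR expR_eq0 expRK; congr (_ * expR _); ring.
Qed.

(** Only the index k = 0 survives at time 0, since 0^0 = 1. *)
Lemma flow0 A : measurable A -> flow 0 A = mu0 A.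
Proof.
move=> mA.
have mAi : measurable_fun setT (fun m : mR => \1_A m : R) by exact: measurable_indic.
have pE (nu : borel_measure R) : nu `]-oo, 0]%classic = 0%E -> nu A = pairing nu (\1_A).
  by move=> nu0; rewrite pairingE// integral_indic// setIT.
rewrite !pE//; last exact: flow_supp.
rewrite pairing_flow_ge0//.
rewrite integral_pos_nat0.
- under eq_integral do rewrite expr0 mul1r mul0r mul0r oppr0 expR0 mulr1.
  rewrite (integral_mass0 (f := fun m => \1_A m / `|m|)).
    apply: eq_pairing => m m0; rewrite gtr0_norm//= mulrCA divff ?mulr1// gt_eqF//.
  apply: measurable_funM => //; apply: (measurableT_comp measurable_inv).
  exact: normr_measurable.
- apply/measurable_EFinP; apply: measurable_funM; last exact: measurable_lap.
  apply: measurable_funM; first exact: (measurableT_comp mAi measurable_snd).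
  by apply: (measurableT_comp measurable_inv); exact: measurable_abs_snd.
- by move=> x; rewrite lee_fin mulr_ge0 ?divr_ge0// mulr_ge0 ?expR_ge0 ?exprn_ge0.
- by move=> k m; rewrite /= expr0n/= mul0r mulr0.
Qed.

End solution.

(** * Balance of gain and loss for nonnegative test functions *)

Section flory_equation.
Context {R : realType}.
Local Notation leb := (@lebesgue_measure R).
Local Notation mR := (measurableTypeR R).
Local Notation X := (nat * mR)%type.
Variable mu0 : borel_measure R.
Hypothesis mu0_radon : radon_pos mu0.
Hypothesis mu0_mass : (moment1 mu0 < +oo)%E.

Let mu0_supp : mu0 `]-oo, 0]%classic = 0%E := mu0_radon.1.
Local Notation m0 := (mass0 mu0_radon mu0_mass).
Local Notation Pi := (pos_nat m0).
Local Notation M0 := (lap0 m0 0).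
Local Notation flow := (flow mu0_radon mu0_mass).

Let M00 : 0 <= M0. Proof. exact: lap0_ge0. Qed.

Lemma flow_mass_lty s : 0 <= s -> (moment1 (flow s) < +oo)%E.
Proof. by move=> s0; apply: le_lt_trans (moment1_flow_le _ _ s0) _; rewrite ltry. Qed.

Definition flow_mass s (s0 : 0 <= s) : {finite_measure set mR -> \bar R} :=
  fmass (flow_supp mu0_radon mu0_mass s) (flow_mass_lty s0).

Lemma integral_flow_mass s (s0 : 0 <= s) (f : R -> \bar R) :
  measurable_fun setT f -> (forall x, 0 <= f x)%E ->
  (\int[flow_mass s0]_x f x =
   \int[Pi]_x (f x.2 * (s ^+ x.1 * expR (- (s * M0 * x.2)))%:E))%E.
Proof.
move=> mf f0; rewrite -[LHS]/(\int[mass_measure (flow s)]_x f x)%E integral_wimage//.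
rewrite integral_wimage//; last 2 first.
- by apply: emeasurable_funM => //; apply/measurable_EFinP; exact: normr_measurable.
- by move=> x; rewrite mule_ge0// lee_fin.
apply: eq_pos_integral.
- apply: emeasurable_funM; first apply: emeasurable_funM.
  + exact: (measurableT_comp mf measurable_snd).
  + by apply/measurable_EFinP; exact: measurable_abs_snd.
  + by apply/measurable_EFinP; apply: measurableT_comp => //; exact: measurable_flow_weight.
- apply: emeasurable_funM; first exact: (measurableT_comp mf measurable_snd).
  by apply/measurable_EFinP; exact: measurable_lap.
move=> x x0; rewrite -muleA -EFinM; congr (_ * EFin _)%E.
rewrite /flow_weight normrM normfV -/(_ / _) mulrCA divff ?mulr1.
  by rewrite ger0_norm// lap_pt_ge0.
by rewrite normr_eq0 gt_eqF.
Qed.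

Section nonneg_test.
Variables (phi : R -> R) (C : R).
Hypotheses (mphi : measurable_fun setT phi) (phi0 : forall m, 0 <= phi m).
Hypotheses (phiC : forall m, phi m <= C) (phiCm : forall m, phi m <= C * `|m|).

Let C0 : 0 <= C. Proof. exact: le_trans (phi0 0) (phiC 0). Qed.

Definition loss_rate (s : R) : \bar R := pairing (flow s) (fun m => m * phi m).

(** What the derivative of the power s^k contributes to the evolution of [phi]. The summand 0 is the
    starting point [w] in [duhamel]. *)
Definition gain_rate (s : R) : \bar R := (\int[Pi]_x (phi x.2 / `|x.2| *
  (x.1%:R * s ^+ x.1.-1 * expR (- ((0 + s * M0) * x.2))))%:E)%E.

Let mg : measurable_fun setT (fun x : X => phi x.2 / `|x.2|).
Proof.
apply: measurable_funM; first exact: (measurableT_comp mphi measurable_snd).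
by apply: (measurableT_comp measurable_inv); exact: measurable_abs_snd.
Qed.

Let g0 (x : X) : 0 <= phi x.2 / `|x.2|. Proof. by rewrite divr_ge0. Qed.

Lemma loss_rateE s : 0 <= s ->
  loss_rate s = (\int[Pi]_x (phi x.2 * (s ^+ x.1 * expR (- (s * M0 * x.2))))%:E)%E.
Proof. by move=> s0; exact: pairing_mass_flow. Qed.

Lemma loss_rate_ge0 s : (0 <= loss_rate s)%E.
Proof. by apply: pairing_ge0 => m m0; rewrite mulr_ge0// ltW. Qed.

Lemma loss_rate_le s : 0 <= s -> (loss_rate s <= (C * M0)%:E)%E.
Proof.
move=> s0; rewrite EFinM.
apply: (@le_trans _ _ (C%:E * moment1 (flow s)))%E; last first.
  by apply: lee_wpmul2l; [rewrite lee_fin|exact: moment1_flow_le].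
rewrite moment1_flow// /lap -ge0_integralZl ?lee_fin//; last 2 first.
- by apply/measurable_EFinP; exact: measurable_lap.
- by move=> x _; rewrite lee_fin lap_pt_ge0.
rewrite loss_rateE//; apply: ge0_le_integral => //.
- by move=> x _; rewrite lee_fin mulr_ge0// lap_pt_ge0.
- apply/measurable_EFinP; apply: measurable_funM; last exact: measurable_lap.
  exact: (measurableT_comp mphi measurable_snd).
- by apply: emeasurable_funM => //; apply/measurable_EFinP; exact: measurable_lap.
- by move=> x _; rewrite -EFinM lee_fin ler_wpM2r// lap_pt_ge0.
Qed.

Lemma measurable_loss_rate (t : R) : measurable_fun `[0, t]%classic (loss_rate : mR -> \bar R).
Proof.
have mp : measurable_fun setT (fun x : X => phi x.2).
  exact: (measurableT_comp mphi measurable_snd).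
apply: (eq_measurable_fun (fun s : mR => \int[Pi]_x (phi x.2 * (s ^+ x.1 * expR (- (s * M0 * x.2))))%:E)%E).
  by move=> s; rewrite inE/= in_itv/= => /andP[s0 _]; rewrite loss_rateE.
apply: (measurable_time_series m0 (j := id) (w := 0) (c := M0) mp) => [x|s x] //=.
by rewrite add0r.
Qed.

Lemma gain_rate_ge0 s : 0 <= s -> (0 <= gain_rate s)%E.
Proof.
move=> s0; apply: integral_ge0 => x _; rewrite lee_fin mulr_ge0 ?g0//.
by rewrite mulr_ge0 ?expR_ge0// mulr_ge0 ?exprn_ge0.
Qed.

Lemma measurable_gain_rate (t : R) : measurable_fun `[0, t]%classic (gain_rate : mR -> \bar R).
Proof.
have mk : measurable_fun setT (fun x : X => phi x.2 / `|x.2| * x.1%:R).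
  by apply: measurable_funM => //; exact: (measurable_nat_fst (fun k => k%:R)).
have k0 (x : X) : 0 <= phi x.2 / `|x.2| * x.1%:R by rewrite mulr_ge0.
apply: (measurable_time_series m0 (j := predn) (w := 0) (c := M0) mk k0) => s x.
by rewrite !mulrA.
Qed.

(** [integral_pos_natM] applied to phi / m: the weight |x + y| / 2 cancels the division by the mass
    of the merged particle and leaves the collision gain against m mu_s(dm). *)
Lemma gain_rateE s (s0 : 0 <= s) : (gain_rate s = 2^-1%:E *
  \int[flow_mass s0]_x \int[flow_mass s0]_y (phi (x + y)%R)%:E)%E.
Proof.
pose W (x : X) : R := s ^+ x.1 * expR (- (s * M0 * x.2)).
have W0 x : 0 <= W x by exact: lap_pt_ge0.
have mW : measurable_fun setT W by exact: measurable_lap.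
have mphiD : measurable_fun setT (fun p : mR * mR => (phi (p.1 + p.2))%:E : \bar R).
  by apply/measurable_EFinP; apply: (measurableT_comp mphi); exact: measurable_funD.
rewrite integral_flow_mass; last 2 first.
- by apply: (measurable_fun_fubini_tonelli_F _ mphiD) => p; rewrite lee_fin.
- by move=> x; apply: integral_ge0 => y _; rewrite lee_fin.
pose H (x : X) : \bar R := (phi x.2 / `|x.2| * (s ^+ x.1.-1 * expR (- (s * M0 * x.2))))%:E.
have mH : measurable_fun setT H.
  apply/measurable_EFinP; apply: measurable_funM => //.
  exact: (measurable_nat_expRNM (fun k => s ^+ k.-1)).
have H0 x : (0 <= H x)%E.
  by rewrite lee_fin mulr_ge0 ?g0// mulr_ge0 ?exprn_ge0 ?expR_ge0.
transitivity (\int[Pi]_x (x.1%:R%:E * H x))%E.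
  apply: eq_integral => x _; rewrite -EFinM; congr EFin; rewrite add0r; ring.
rewrite integral_pos_natM//.
pose G (p : X * X) : \bar R := (phi (p.1.2 + p.2.2) * W p.2 * W p.1 / 2)%:E.
have mG : measurable_fun setT G.
  apply/measurable_EFinP; apply: measurable_funM => //.
  apply: measurable_funM; last exact: (measurableT_comp mW measurable_fst).
  apply: measurable_funM; last exact: (measurableT_comp mW measurable_snd).
  apply: (measurableT_comp mphi); apply: measurable_funD.
    exact: (measurableT_comp measurable_snd measurable_fst).
  exact: (measurableT_comp measurable_snd measurable_snd).
have G0 p : (0 <= G p)%E by rewrite lee_fin divr_ge0// mulr_ge0// mulr_ge0.
have mF := measurable_pos_natM mH.
transitivity (\int[Pi]_x \int[Pi]_y G (x, y))%E.
  apply: eq_pos_integral.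
  - apply: (measurable_fun_fubini_tonelli_F _ mF) => p.
    by rewrite mule_ge0// lee_fin divr_ge0.
  - exact: (measurable_fun_fubini_tonelli_F G).
  move=> x x0; apply: eq_pos_integral.
  - exact: (measurableT_comp mF (pair1_measurable _)).
  - exact: (measurableT_comp mG (pair1_measurable _)).
  move=> y y0; rewrite /H/G/= -EFinM; congr EFin.
  have xy0 : x.2 + y.2 != 0 by rewrite gt_eqF// addr_gt0.
  rewrite (gtr0_norm (addr_gt0 x0 y0)) /W exprD mulrDr opprD expRD.
  by field.
have mWE : measurable_fun setT (fun x : X => (W x)%:E : \bar R) by exact/measurable_EFinP.
rewrite -ge0_integralZl; [|by []| | |by rewrite lee_fin]; last 2 first.
- apply: emeasurable_funM => //.
  have mx := @measurable_fun_fubini_tonelli_F _ _ mR mR R (flow_mass s0) _ mphiD.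
  by apply: (measurableT_comp (mx _) measurable_snd) => p; rewrite lee_fin.
- move=> x _; apply: mule_ge0; last by rewrite lee_fin; exact: W0.
  by apply: integral_ge0 => y _; rewrite lee_fin.
apply: eq_integral => x _.
rewrite integral_flow_mass; last 2 first.
- exact: (measurableT_comp mphiD (pair1_measurable _)).
- by move=> y; rewrite lee_fin.
have mphix : measurable_fun setT (fun y : X => phi (x.2 + y.2)).
  apply: (measurableT_comp mphi); apply: measurable_funD => //.
rewrite -ge0_integralZr; [|by []| | |by rewrite lee_fin; exact: W0]; last 2 first.
- by apply: emeasurable_funM => //; exact/measurable_EFinP.
- by move=> y _; apply: mule_ge0; rewrite lee_fin; [exact: phi0|exact: W0].
rewrite -ge0_integralZl; [|by []| | |by rewrite lee_fin]; last 2 first.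
- by apply: emeasurable_funM => //; apply: emeasurable_funM => //; exact/measurable_EFinP.
- by move=> y _; apply: mule_ge0; [apply: mule_ge0|]; rewrite lee_fin ?phi0 ?W0.
by apply: eq_integral => y _; rewrite -!EFinM; congr EFin; rewrite mulrC.
Qed.

Lemma flow_duhamel t : 0 <= t ->
  (pairing (flow t) phi + \int[leb]_(s in `[0%R, t]) (M0%:E * loss_rate s) =
   pairing mu0 phi + \int[leb]_(s in `[0%R, t]) gain_rate s)%E.
Proof.
move=> t0; have := duhamel m0 0 t0 M00 mg g0.
have -> : (\int[Pi]_x (phi x.2 / `|x.2| * (t ^+ x.1 * expR (- ((0 + t * M0) * x.2))))%:E
    = pairing (flow t) phi)%E.
  rewrite (pairing_flow_ge0 mu0_radon mu0_mass t0 mphi phi0).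
  by apply: eq_integral => x _; rewrite add0r.
have -> : (\int[Pi]_x (phi x.2 / `|x.2| * (0 ^+ x.1 * expR (- (0 * x.2))))%:E
    = pairing mu0 phi)%E.
  transitivity (pairing (flow 0) phi).
    rewrite (pairing_flow_ge0 mu0_radon mu0_mass (lexx 0) mphi phi0).
    by apply: eq_integral => x _; rewrite mul0r [in RHS]mul0r mul0r.
  by apply: eq_measure_integral => A mA _; rewrite flow0.
move=> duh; rewrite -[X in (_ = _ + X)%E]/(\int[leb]_(s in `[0%R, t]) gain_rate s)%E -{}duh.
congr (_ + _)%E; apply: eq_integral => s; rewrite inE/= in_itv/= => /andP[s0 _].
have mp : measurable_fun setT (fun x : X => phi x.2).
  exact: (measurableT_comp mphi measurable_snd).
rewrite loss_rateE// -ge0_integralZl ?lee_fin//; last 2 first.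
- by apply/measurable_EFinP; apply: measurable_funM => //; exact: measurable_lap.
- by move=> x _; rewrite lee_fin mulr_ge0// lap_pt_ge0.
apply: eq_pos_integral.
- apply: emeasurable_funM; first exact: measurable_cst.
  by apply/measurable_EFinP; apply: measurable_funM; [exact: mp|exact: measurable_lap].
- apply/measurable_EFinP; apply: measurable_funM; first exact: mg.
  apply: measurable_funM; last exact: (measurableT_comp (measurable_expRNM _) measurable_snd).
  apply: measurable_funM; last exact: (measurable_nat_fst (fun k => s ^+ k)).
  by apply: measurable_funM => //; exact: measurable_abs_snd.
move=> x x0; rewrite -EFinM add0r; congr EFin; rewrite gtr0_norm//.
by field; rewrite gt_eqF.
Qed.

Lemma gain_rate_le s : 0 <= s -> (gain_rate s <= (C * M0 ^+ 2)%:E)%E.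
Proof.
move=> s0; rewrite gain_rateE.
have mphiD : measurable_fun setT (fun p : mR * mR => (phi (p.1 + p.2))%:E : \bar R).
  by apply/measurable_EFinP; apply: (measurableT_comp mphi); exact: measurable_funD.
have rM : (flow_mass s0 setT <= M0%:E)%E.
  by rewrite fmassT; exact: moment1_flow_le.
have inner x : (\int[flow_mass s0]_y (phi (x + y)%R)%:E <= (C * M0)%:E)%E.
  apply: (@le_trans _ _ (\int[flow_mass s0]_y C%:E)%E).
    apply: ge0_le_integral => //.
    - by move=> y _; rewrite lee_fin.
    - exact: (measurableT_comp mphiD (pair1_measurable _)).
    - by move=> y _; rewrite lee_fin.
  by rewrite integral_cst// EFinM lee_wpmul2l.
have outer : (\int[flow_mass s0]_x \int[flow_mass s0]_y (phi (x + y)%R)%:E <=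
    (C * M0 * M0)%:E)%E.
  apply: (@le_trans _ _ (\int[flow_mass s0]_x (C * M0)%:E)%E).
    apply: ge0_le_integral => //.
    - by move=> x _; apply: integral_ge0 => y _; rewrite lee_fin.
    - by apply: (measurable_fun_fubini_tonelli_F _ mphiD) => p; rewrite lee_fin.
  by rewrite integral_cst// [leRHS]EFinM; apply: lee_wpmul2l => //; rewrite lee_fin mulr_ge0.
rewrite -[leRHS]mul1e; apply: lee_pmul; rewrite ?lee_fin//.
- by apply: integral_ge0 => x _; apply: integral_ge0 => y _; rewrite lee_fin.
- by rewrite invf_le1// ler1n.
- by rewrite expr2 mulrA.
Qed.

(** Only the first moment is controlled, so the bound rests on phi being at most a multiple of m,
    near 0 as well. *)
Lemma pairing_flow_le t : 0 <= t -> (pairing (flow t) phi <= (C * M0)%:E)%E.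
Proof.
move=> t0; apply: (@le_trans _ _ (\int[flow_mass t0]_x C%:E)%E).
  rewrite integral_fmass//; apply: le_pairing => //.
    exact: measurable_funM.
  by move=> m mp; rewrite phi0/= (le_trans (phiCm m))// gtr0_norm// mulrC.
have rM : (flow_mass t0 setT <= M0%:E)%E.
  by rewrite fmassT; exact: moment1_flow_le.
by rewrite integral_cst// EFinM lee_wpmul2l.
Qed.

End nonneg_test.
End flory_equation.

(** * Compactly supported test functions *)

Section test_functions.
Context {R : realType}.
Local Notation mR := (measurableTypeR R).
Local Notation leb := (@lebesgue_measure R).

Lemma compact_pos_bounds (C : set R) : compact C -> C `<=` `]0, +oo[ ->
  exists a b : R, [/\ 0 < a, a <= b & C `<=` `[a, b]].
Proof.
move=> cC C0.
have oC : open (~` C) by apply: closed_openC; exact: compact_closed.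
have nC0 : (~` C) 0 by move=> /C0/=; rewrite in_itv/= ltxx.
have /nbhs_ballP[a /= a0 aC] : nbhs (0 : R) (~` C) by exact: open_nbhs_nbhs.
have [B [_ /(_ (B + 1))]] := compact_bounded cC.
rewrite ltrDl ltr01 => /(_ isT) BC.
exists a, (Num.max a (B + 1)); split => //; first by rewrite le_max lexx.
move=> m Cm; rewrite /= in_itv/= le_max; apply/andP; split.
  rewrite leNgt; apply/negP => ma; apply: (aC m) => //.
  have := C0 _ Cm; rewrite /= in_itv/= andbT => m0.
  by rewrite /ball/= sub0r normrN gtr0_norm.
by rewrite (le_trans (ler_norm _) (BC _ Cm)) orbT.
Qed.

(** The values of a test function outside (0, +oo) are arbitrary; setting them to 0 yields a bounded
    continuous function on the whole line. *)
Definition cut (phi : R -> R) (m : R) : R := if 0 < m then phi m else 0.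

Lemma cutE phi m : 0 < m -> cut phi m = phi m.
Proof. by rewrite /cut => ->. Qed.

Lemma Cc_cut phi : Cc_pos phi ->
  exists a b B : R, [/\ 0 < a, a <= b, 0 <= B, continuous (cut phi) &
    [/\ forall m, m < a -> cut phi m = 0, forall m, b < m -> cut phi m = 0,
        forall m, `|cut phi m| <= B & forall m, `|cut phi m| <= B * `|m| ]].
Proof.
move=> [cphi [C [cC C0 phiC]]].
have [a [b [a0 ab Cab]]] := compact_pos_bounds cC C0.
have lo m : m < a -> cut phi m = 0.
  move=> ma; rewrite /cut; case: ifPn => // m0; apply: phiC => // /Cab.
  by rewrite /= in_itv/= leNgt ma.
have hi m : b < m -> cut phi m = 0.
  move=> bm; rewrite /cut; case: ifPn => // m0; apply: phiC => // /Cab.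
  by rewrite /= in_itv/= [m <= b]leNgt bm andbF.
have cc : continuous (cut phi).
  move=> m; have [ma|am] := ltP m a.
    rewrite /continuous_at lo//; apply: cvg_near_cst.
    by near=> x; rewrite lo//; near: x; exact: lt_nbhsl.
  have m0 : 0 < m by exact: lt_le_trans am.
  rewrite /continuous_at cutE//; apply: cvg_trans (cphi m m0); apply: near_eq_cvg.
  by near=> x; rewrite cutE//; near: x; exact: lt_nbhsr.
have cK : compact (cut phi @` `[a, b]).
  by apply: continuous_compact; [exact: continuous_subspaceT|exact: segment_compact].
have [B [_ /(_ (B + 1))]] := compact_bounded cK.
rewrite ltrDl ltr01 => /(_ isT) BC.
pose D := Num.max (B + 1) 0.
have D0 : 0 <= D by rewrite le_max lexx orbT.
have cD m : `|cut phi m| <= D.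
  have [/lo ->|am] := ltP m a; first by rewrite normr0.
  have [/hi ->|mb] := ltP b m; first by rewrite normr0.
  by rewrite le_max BC//; exists m => //; rewrite /= in_itv/= am.
(* The support stays above a, so D is at most (D / a) m there; this gives the linear bound. *)
exists a, b, (Num.max D (D / a)); split => //; first by rewrite le_max D0.
split => // m.
  by rewrite le_max cD.
have [/lo ->|am] := ltP m a; first by rewrite normr0 mulr_ge0// le_max D0.
apply: (le_trans (cD m)).
apply: (@le_trans _ _ (D / a * `|m|)); last by rewrite ler_wpM2r// le_max lexx orbT.
rewrite -mulrA ler_peMr// mulrC ler_pdivlMr// mul1r (le_trans am)// ler_norm//.
Unshelve. all: end_near. Qed.

Lemma bounded_integrable_itv (t : R) (f : R -> R) (B : R) :
  measurable_fun `[0, t] (f : mR -> R) -> (forall s, 0 <= s <= t -> `|f s| <= B) ->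
  leb.-integrable `[0, t] (EFin \o f).
Proof.
move=> mf fB; apply: measurable_bounded_integrable => //.
- exact: compact_finite_measure (@segment_compact R 0 t).
- exists B; split; rewrite ?num_real// => D BD s /=; rewrite in_itv/= => /fB st.
  by rewrite (le_trans st)// ltW.
Qed.

Lemma EFin_Rintegral (t : R) (f : R -> R) :
  leb.-integrable `[0, t] (EFin \o f) ->
  (\int[leb]_(s in `[0%R, t]) (f s)%:E = (\int[leb]_(s in `[0%R, t]) f s)%:E)%E.
Proof. by move=> fi; rewrite /Rintegral fineK//; exact: integrable_fin_num. Qed.

Lemma integral_posneg d (T : measurableType d) (mu : {measure set T -> \bar R}) (f : T -> R) :
  (\int[mu]_x (f x)%:E = \int[mu]_x (f^\+ x)%:E - \int[mu]_x (f^\- x)%:E)%E.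
Proof.
rewrite integralE; congr (_ - _)%E; apply: eq_integral => x _.
  exact: funepos_EFin.
exact: funeneg_EFin.
Qed.

Lemma integral_conv_posneg (rho : {finite_measure set mR -> \bar R}) (f : R -> R) (B : R) :
  measurable_fun setT f -> (forall m, `|f m| <= B) ->
  fine (\int[rho]_x \int[rho]_y (f (x + y))%:E)%E =
  fine (\int[rho]_x \int[rho]_y (f^\+ (x + y))%:E)%E -
  fine (\int[rho]_x \int[rho]_y (f^\- (x + y))%:E)%E.
Proof.
move=> mf fB.
have mp := measurable_funrpos mf; have mn := measurable_funrneg mf.
have pB m : `|f^\+ m| <= B.
  by rewrite ger0_norm ?funrpos_ge0// (le_trans _ (fB m))// /funrpos/= ge_max ler_norm/=.
have nB m : `|f^\- m| <= B.
  by rewrite ger0_norm ?funrneg_ge0// (le_trans _ (fB m))// /funrneg/= ge_max -normrN ler_norm/=.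
have inner (g : R -> R) x : measurable_fun setT g -> (forall m, `|g m| <= B) ->
    rho.-integrable setT (fun y => (g (x + y))%:E).
  move=> mg gB; apply: (finite_integrable rho (f := fun y => g (x + y)) _ (fun y => gB (x + y))).
  by apply: (measurableT_comp mg); exact: measurable_funD.
have outer (g : R -> R) : measurable_fun setT g -> (forall m, `|g m| <= B) ->
    rho.-integrable setT (fun x => \int[rho]_y (g (x + y))%:E)%E.
  move=> mg gB.
  rewrite (_ : (fun x => _) = EFin \o (fun x => fine (\int[rho]_y (g (x + y))%:E)%E)); last first.
    by apply/funext => x /=; rewrite fineK//; apply: integrable_fin_num => //; exact: inner.
  apply: (finite_integrable rho (C := B * fine (rho setT))).
    exact: (measurable_conv_finite rho mg).
  move=> x; apply: finite_Rintegral_le => //.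
  by apply: (measurableT_comp mg); exact: measurable_funD.
rewrite -fineB; last 2 first.
- by apply: integrable_fin_num => //; exact: outer.
- by apply: integrable_fin_num => //; exact: outer.
rewrite -integralB//; [|exact: outer|exact: outer].
by congr fine; apply: eq_integral => x _; exact: (integral_posneg rho (fun y => f (x + y))).
Qed.

End test_functions.

(** * The power series satisfies the weak equation *)

Section flow_solution.
Context {R : realType}.
Local Notation leb := (@lebesgue_measure R).
Local Notation mR := (measurableTypeR R).
Variable mu0 : borel_measure R.
Hypothesis mu0_radon : radon_pos mu0.
Hypothesis mu0_mass : (moment1 mu0 < +oo)%E.
Local Notation M0 := (lap0 (mass0 mu0_radon mu0_mass) 0).
Local Notation flow := (flow mu0_radon mu0_mass).

Let M00 : 0 <= M0. Proof. exact: lap0_ge0. Qed.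

Lemma radon_flow t : 0 <= t -> radon_pos (flow t).
Proof.
move=> t0; split; first exact: flow_supp.
move=> C cC C0; have mC : measurable (C : set mR) by exact: compact_measurable.
have [a [b [a0 ab Cab]]] := compact_pos_bounds cC C0.
have -> : flow t C = pairing (flow t) (\1_C : R -> R).
  rewrite pairingE; [|exact: flow_supp|exact: measurable_indic].
  by rewrite integral_indic// setIT.
(* On [C] one has m >= a, so the indicator is at most m / a; the maximum with 1 lets the same
   constant serve as a uniform bound in [h1]. *)
have h m : (\1_C m : R) <= (Num.max 1 a^-1) * `|m|.
  rewrite indicE; have [|nC] := boolP (m \in C); last by rewrite mulr_ge0// le_max ler01.
  rewrite inE => /Cab/=; rewrite in_itv/= => /andP[am _].
  have m0 := lt_le_trans a0 am; rewrite gtr0_norm//.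
  apply: (@le_trans _ _ (a^-1 * m)); first by rewrite mulrC ler_pdivlMr ?mul1r.
  by rewrite ler_wpM2r ?(ltW m0)// le_max lexx orbT.
have h1 m : (\1_C m : R) <= Num.max 1 a^-1.
  by rewrite le_max indicE; case: (m \in C); rewrite /= ?lexx ?ler01.
apply: le_lt_trans (pairing_flow_le mu0_radon mu0_mass _ _ h1 h t0) _.
- exact: measurable_indic.
- by move=> m; rewrite indicE.
- by rewrite ltry.
Qed.

Lemma moment1_loss_rate s : moment1 (flow s) = loss_rate mu0_radon mu0_mass (cst 1) s.
Proof. by apply: eq_pairing => m _; rewrite mulr1. Qed.

Lemma measurable_moment1_flow (t : R) :
  measurable_fun `[0, t]%classic (fun s : mR => moment1 (flow s)).
Proof.
apply: (eq_measurable_fun (loss_rate mu0_radon mu0_mass (cst 1) : mR -> \bar R)).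
  by move=> s _; rewrite moment1_loss_rate.
exact: measurable_loss_rate.
Qed.

Lemma flow_mass_sqr_lty (t : R) : 0 < t ->
  (\int[leb]_(s in `[0%R, t]) (moment1 (flow s) ^+ 2) < +oo)%E.
Proof.
move=> t0; apply: (@le_lt_trans _ _ (\int[leb]_(s in `[0%R, t]) (M0 ^+ 2)%:E)%E).
  apply: ge0_le_integral => //.
  - by move=> s _; rewrite sqre_ge0.
  - by apply: emeasurable_funM; exact: measurable_moment1_flow.
  - move=> s /=; rewrite in_itv/= => /andP[s0 _].
    rewrite expr2 EFinM; apply: lee_pmul; rewrite ?moment1_flow_le//;
      by apply: pairing_ge0 => m /ltW.
by rewrite integral_itv_cst ?ltry// ltW.
Qed.

Lemma fine_half (x : \bar R) : fine ((2^-1)%:E * x)%E = 2^-1 * fine x.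
Proof.
by case: x => [r||] //=; rewrite ?gt0_muley ?gt0_muleNy ?lte_fin ?invr_gt0//= mulr0.
Qed.

(** [x] is the time integral of M_s times the loss. It occurs in the coagulation term and in the gel
    term with opposite effects and cancels, leaving the loss at rate [K], the total mass. *)
Lemma balance_algebra (A B G1 G2 L1 L2 x K : R) :
  A + G1 - K * L1 - (B + G2 - K * L2) =
  A - B + 2^-1 * (2 * (G1 - G2) - 2 * x) - (K * (L1 - L2) - x).
Proof. by field. Qed.

(** The balance in [0, +oo] is available for nonnegative functions only. The positive and negative
    parts of [phi] have bounded gain and loss over [0, t], so the two balances become real
    identities that can be subtracted. *)
Lemma flow_equation phi (t : R) : Cc_pos phi -> 0 < t ->
  [/\ leb.-integrable `[0, t] (fun s => coag_term (flow s) phi),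
      leb.-integrable `[0, t] (fun s => gel_term mu0 (flow s) phi) &
      (pairing (flow t) phi = pairing mu0 phi
         + (2^-1)%:E * \int[leb]_(s in `[0%R, t]) coag_term (flow s) phi
         - \int[leb]_(s in `[0%R, t]) gel_term mu0 (flow s) phi)%E].
Proof.
move=> /Cc_cut[a [b [B [a0 ab B0 cc [lo hi cB cBm]]]]] t0.
pose psi := cut phi.
have mpsi : measurable_fun setT psi by exact: continuous_measurable_fun.
have mp := measurable_funrpos mpsi; have mn := measurable_funrneg mpsi.
have p0 m : 0 <= psi^\+ m by exact: funrpos_ge0.
have n0 m : 0 <= psi^\- m by exact: funrneg_ge0.
have pl m : psi^\+ m <= `|psi m| by rewrite /funrpos/= ge_max ler_norm/=.
have nl m : psi^\- m <= `|psi m| by rewrite /funrneg/= ge_max -normrN ler_norm/=.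
have pB m : psi^\+ m <= B := le_trans (pl m) (cB m).
have nB m : psi^\- m <= B := le_trans (nl m) (cB m).
have pBm m : psi^\+ m <= B * `|m| := le_trans (pl m) (cBm m).
have nBm m : psi^\- m <= B * `|m| := le_trans (nl m) (cBm m).
pose gain f s := fine (gain_rate mu0_radon mu0_mass f s).
pose loss f s := fine (loss_rate mu0_radon mu0_mass f s).
pose M s := fine (moment1 (flow s)).
have [cE gE] : (forall s, 0 <= s -> coag_term (flow s) phi =
      (2 * (gain psi^\+ s - gain psi^\- s)
        - 2 * M s * (loss psi^\+ s - loss psi^\- s))%:E) /\
    (forall s, 0 <= s -> gel_term mu0 (flow s) phi =
      ((loss psi^\+ s - loss psi^\- s) * (M0 - M s))%:E).
  have phipsi m : 0 < m -> phi m = psi m by move=> m0; rewrite /psi cutE.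
  have lossE s : 0 <= s ->
      fine (pairing (flow s) (fun m => m * psi m)) = loss psi^\+ s - loss psi^\- s.
    move=> s0; have nu0 := flow_supp mu0_radon mu0_mass s.
    have fin := flow_mass_lty mu0_radon mu0_mass s0.
    have pB' m : `|psi^\+ m| <= B by rewrite ger0_norm.
    have nB' m : `|psi^\- m| <= B by rewrite ger0_norm.
    rewrite -fineB; [|exact: (pairing_mass_fin nu0 fin mp pB')
                     |exact: (pairing_mass_fin nu0 fin mn nB')].
    by rewrite /loss_rate -!(integral_fmass nu0 fin)// integral_posneg.
  have M0E' : fine (moment1 mu0) = M0 by rewrite -(M0E mu0_radon mu0_mass).
  split=> s s0.
    rewrite (eq_coag_term _ phipsi).
    rewrite (coag_termE (flow_supp mu0_radon mu0_mass s) (flow_mass_lty _ _ s0) mpsi cB).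
    rewrite (integral_conv_posneg _ mpsi cB) lossE//; congr (EFin (_ - _)).
    have gE (f : R -> R) (mf : measurable_fun setT f) (f0 : forall m, 0 <= f m) : gain f s = 2^-1 *
        fine (\int[flow_mass mu0_radon mu0_mass s0]_x
          \int[flow_mass mu0_radon mu0_mass s0]_y (f (x + y))%:E)%E.
      by rewrite -fine_half /gain gain_rateE.
    by rewrite (gE _ mp p0) (gE _ mn n0) -mulrBr mulrA divff ?mul1r.
  rewrite (eq_gel_term _ _ phipsi).
  rewrite (gel_termE (flow_supp mu0_radon mu0_mass s) (flow_mass_lty _ _ s0) mpsi cB)//.
  by rewrite lossE// M0E'.
have gainI (f : R -> R) : measurable_fun setT f -> (forall m, 0 <= f m) -> (forall m, f m <= B) ->
    measurable_fun `[0, t]%classic (gain f : mR -> R) /\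
    forall s, 0 <= s <= t -> `|gain f s| <= B * M0 ^+ 2.
  move=> mf f0 fB; split; first by apply: measurableT_comp => //; exact: measurable_gain_rate.
  move=> s /andP[s0 _]; have g0 := gain_rate_ge0 mu0_radon mu0_mass f0 s0.
  have gB := gain_rate_le mu0_radon mu0_mass mf f0 fB s0.
  by rewrite ger0_norm ?fine_ge0// -lee_fin fineK// ge0_fin_numE// (le_lt_trans gB)// ltry.
have lossI (f : R -> R) : measurable_fun setT f -> (forall m, 0 <= f m) -> (forall m, f m <= B) ->
    measurable_fun `[0, t]%classic (loss f : mR -> R) /\
    forall s, 0 <= s <= t -> `|loss f s| <= B * M0.
  move=> mf f0 fB; split; first by apply: measurableT_comp => //; exact: measurable_loss_rate.
  move=> s /andP[s0 _]; have g0 := loss_rate_ge0 mu0_radon mu0_mass f0 s.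
  have gB := loss_rate_le mu0_radon mu0_mass mf f0 fB s0.
  by rewrite ger0_norm ?fine_ge0// -lee_fin fineK// ge0_fin_numE// (le_lt_trans gB)// ltry.
have mM : measurable_fun `[0, t]%classic (M : mR -> R).
  by apply: measurableT_comp => //; exact: measurable_moment1_flow.
have MB s : 0 <= s <= t -> `|M s| <= M0.
  move=> /andP[s0 _]; have MM := moment1_flow_le mu0_radon mu0_mass s0.
  rewrite ger0_norm; last by apply: fine_ge0; apply: pairing_ge0 => m /ltW.
  by rewrite -lee_fin fineK//; exact: moment1_flow_fin.
have [mgp gpB] := gainI _ mp p0 pB; have [mgn gnB] := gainI _ mn n0 nB.
have [mlp lpB] := lossI _ mp p0 pB; have [mln lnB] := lossI _ mn n0 nB.
pose G s := gain psi^\+ s - gain psi^\- s; pose L s := loss psi^\+ s - loss psi^\- s.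
have igp := bounded_integrable_itv mgp gpB; have ign := bounded_integrable_itv mgn gnB.
have ilp := bounded_integrable_itv mlp lpB; have iln := bounded_integrable_itv mln lnB.
have mI : measurable (`[0, t]%classic : set mR) by exact: measurable_itv.
have iG : leb.-integrable `[0, t] (EFin \o G).
  apply: (bounded_integrable_itv (B := B * M0 ^+ 2 + B * M0 ^+ 2)).
    exact: measurable_funB.
  by move=> s st; rewrite (le_trans (ler_normB _ _))// lerD ?gpB ?gnB.
have LB s : 0 <= s <= t -> `|L s| <= B * M0 + B * M0.
  by move=> st; rewrite (le_trans (ler_normB _ _))// lerD ?lpB ?lnB.
have mL : measurable_fun `[0, t]%classic (L : mR -> R) by exact: measurable_funB.
have iL := bounded_integrable_itv mL LB.
have iML : leb.-integrable `[0, t] (EFin \o (fun s => M s * L s)).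
  apply: (bounded_integrable_itv (B := M0 * (B * M0 + B * M0))).
    exact: measurable_funM.
  by move=> s st; rewrite normrM ler_pM ?MB ?LB.
have iZ (k : R) f : leb.-integrable `[0, t] (EFin \o f) ->
    leb.-integrable `[0, t] (EFin \o (fun s => k * f s)).
  by move=> fi; exact: (integrableZl mI k fi).
have iB f g : leb.-integrable `[0, t] (EFin \o f) -> leb.-integrable `[0, t] (EFin \o g) ->
    leb.-integrable `[0, t] (EFin \o (fun s => f s - g s)).
  by move=> fi gi; exact: (integrableB mI fi gi).
pose cR s := 2 * G s - 2 * (M s * L s); pose gR s := M0 * L s - M s * L s.
have icR : leb.-integrable `[0, t] (EFin \o cR) by apply: iB; exact: iZ.
have igR : leb.-integrable `[0, t] (EFin \o gR) by apply: iB => //; exact: iZ.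
have cE' s : `[0, t]%classic s -> coag_term (flow s) phi = (cR s)%:E.
  by rewrite /= in_itv/= => /andP[s0 _]; rewrite cE// /cR/G/L !mulrA.
have gE' s : `[0, t]%classic s -> gel_term mu0 (flow s) phi = (gR s)%:E.
  by rewrite /= in_itv/= => /andP[s0 _]; rewrite gE// /gR/L; congr EFin; ring.
split.
- by apply: eq_integrable icR => // s; rewrite inE => /cE' ->.
- by apply: eq_integrable igR => // s; rewrite inE => /gE' ->.
have -> : (\int[leb]_(s in `[0%R, t]) coag_term (flow s) phi =
    (2 * \int[leb]_(s in `[0%R, t]) G s
      - 2 * \int[leb]_(s in `[0%R, t]) (M s * L s))%:E)%E.
  rewrite -!RintegralZl// -RintegralB//; [|exact: iZ|exact: iZ].
  by rewrite -EFin_Rintegral//; apply: eq_integral => s; rewrite inE => /cE' ->.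
have -> : (\int[leb]_(s in `[0%R, t]) gel_term mu0 (flow s) phi =
    (M0 * \int[leb]_(s in `[0%R, t]) L s
      - \int[leb]_(s in `[0%R, t]) (M s * L s))%:E)%E.
  rewrite -!RintegralZl// -RintegralB//; [|exact: iZ].
  by rewrite -EFin_Rintegral//; apply: eq_integral => s; rewrite inE => /gE' ->.
have duh (f : R -> R) : measurable_fun setT f -> (forall m, 0 <= f m) -> (forall m, f m <= B) ->
    (forall m, f m <= B * `|m|) ->
    [/\ pairing (flow t) f \is a fin_num, pairing mu0 f \is a fin_num &
     fine (pairing (flow t) f) = fine (pairing mu0 f) + \int[leb]_(s in `[0%R, t]) gain f s
       - M0 * \int[leb]_(s in `[0%R, t]) loss f s].
  move=> mf f0 fB fBm.
  have finlty (x : \bar R) (K : R) : (0 <= x)%E -> (x <= K%:E)%E -> x \is a fin_num.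
    by move=> x0 xK; rewrite ge0_fin_numE// (le_lt_trans xK)// ltry.
  have f1 : pairing (flow t) f \is a fin_num.
    apply: finlty; first exact: pairing_ge0.
    exact: (pairing_flow_le mu0_radon mu0_mass mf f0 fB fBm (ltW t0)).
  have f2 : pairing mu0 f \is a fin_num.
    rewrite -(_ : pairing (flow 0) f = pairing mu0 f); last first.
      by apply: eq_measure_integral => A mA _; rewrite flow0.
    apply: finlty; first exact: pairing_ge0.
    exact: (pairing_flow_le mu0_radon mu0_mass mf f0 fB fBm (lexx 0)).
  split => //; have := flow_duhamel mu0_radon mu0_mass mf f0 (ltW t0).
  have [mg gB] := gainI _ mf f0 fB; have [ml lB] := lossI _ mf f0 fB.
  have ig := bounded_integrable_itv mg gB; have il := bounded_integrable_itv ml lB.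
  have -> : (\int[leb]_(s in `[0%R, t]) (M0%:E * loss_rate mu0_radon mu0_mass f s) =
      (M0 * \int[leb]_(s in `[0%R, t]) loss f s)%:E)%E.
    rewrite -RintegralZl// -EFin_Rintegral; last exact: iZ.
    apply: eq_integral => s; rewrite inE/= in_itv/= => /andP[s0 _].
    suff lf : loss_rate mu0_radon mu0_mass f s \is a fin_num by rewrite -(fineK lf).
    apply: finlty; first exact: loss_rate_ge0.
    exact: (loss_rate_le mu0_radon mu0_mass mf f0 fB s0).
  have -> : (\int[leb]_(s in `[0%R, t]) gain_rate mu0_radon mu0_mass f s =
      (\int[leb]_(s in `[0%R, t]) gain f s)%:E)%E.
    rewrite -EFin_Rintegral//.
    apply: eq_integral => s; rewrite inE/= in_itv/= => /andP[s0 _].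
    rewrite fineK//; apply: finlty; first exact: gain_rate_ge0.
    exact: (gain_rate_le mu0_radon mu0_mass mf f0 fB s0).
  rewrite -(fineK f1) -(fineK f2) -!EFinD => -[e] /=.
  by move: e; lra.
have pairE (nu : borel_measure R) : pairing nu (psi^\+) \is a fin_num ->
    pairing nu (psi^\-) \is a fin_num ->
    pairing nu phi = (fine (pairing nu (psi^\+)) - fine (pairing nu (psi^\-)))%:E.
  move=> h1 h2; rewrite EFinB !fineK//.
  rewrite (@eq_pairing _ nu phi psi); last by move=> m m0; rewrite /psi cutE.
  rewrite /pairing integralE; congr (_ - _)%E; apply: eq_integral => x _.
    exact: funepos_EFin.
  exact: funeneg_EFin.
have [p1 p2 ep] := duh _ mp p0 pB pBm; have [n1 n2 en] := duh _ mn n0 nB nBm.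
rewrite !pairE// ep en -!EFinM -!EFinD; congr EFin.
have -> : \int[leb]_(s in `[0%R, t]) G s = \int[leb]_(s in `[0%R, t]) gain psi^\+ s -
    \int[leb]_(s in `[0%R, t]) gain psi^\- s by exact: RintegralB.
have -> : \int[leb]_(s in `[0%R, t]) L s = \int[leb]_(s in `[0%R, t]) loss psi^\+ s -
    \int[leb]_(s in `[0%R, t]) loss psi^\- s by exact: RintegralB.
exact: balance_algebra.
Qed.

End flow_solution.

(** * Gelation *)

#[local] Opaque lap0.

(** If the integrals agreed, the gap g - f, positive on (0, +oo), would have zero integral and the
    measure would be null. The maximum with 0 keeps the gap nonnegative off the support. *)
Lemma lt_supp_integral (R : realType) (mu : borel_measure R) (f g : measurableTypeR R -> R) :
  mu `]-oo, 0]%classic = 0%E -> mu setT <> 0%E ->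
  measurable_fun setT f -> measurable_fun setT g ->
  (forall m, 0 <= f m) -> (forall m, 0 < m -> f m < g m) ->
  (\int[mu]_m (f m)%:E < +oo)%E ->
  (\int[mu]_m (f m)%:E < \int[mu]_m (g m)%:E)%E.
Proof.
move=> mu0 muT mf mg f0 fg ffin.
pose h m := Num.max (g m - f m) 0.
have h0 m : 0 <= h m by rewrite le_max lexx orbT.
have mh : measurable_fun setT h by apply: measurable_maxr => //; exact: measurable_funB.
have ifin : (\int[mu]_m (f m)%:E)%E \is a fin_num.
  by rewrite ge0_fin_numE//; apply: integral_ge0 => m _; rewrite lee_fin.
have -> : (\int[mu]_m (g m)%:E = \int[mu]_m (f m)%:E + \int[mu]_m (h m)%:E)%E.
  rewrite -ge0_integralD//; last 4 first.
  - by move=> m _; rewrite lee_fin.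
  - exact/measurable_EFinP.
  - by move=> m _; rewrite lee_fin.
  - exact/measurable_EFinP.
  apply: eq_supp_integral => //; first exact/measurable_EFinP.
    by apply: emeasurable_funD; exact/measurable_EFinP.
  move=> m m0; rewrite -EFinD /h max_l ?subr_ge0 ?ltW ?fg//.
  by congr EFin; rewrite subrKC.
rewrite lteDl// lt0e; apply/andP; split; last by apply: integral_ge0 => m _; rewrite lee_fin.
apply/eqP => h0E; apply: muT.
have mhE : measurable_fun setT (fun m => (h m)%:E : \bar R) by exact/measurable_EFinP.
have [|N [mN N0 hN]] := (ae_eq_integral_abs mu measurableT mhE).1.
  by rewrite -[RHS]h0E; apply: eq_integral => m _; rewrite gee0_abs// lee_fin.
have mI : measurable (`]-oo, 0]%classic : set (measurableTypeR R)) by exact: measurable_itv.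
have : (mu (setU `]-oo, 0%R]%classic N) <= 0)%E.
  apply: le_trans (measureU2 _ mI mN) _; rewrite -[leRHS]adde0.
  by apply: leeD; [rewrite -[leRHS]mu0|rewrite -[leRHS]N0].
have -> : setU `]-oo, 0%R]%classic N = setT.
  rewrite -subTset => m _; have [m0|m0] := leP m 0.
    by left; rewrite /= in_itv.
  right; apply: hN => /= /(_ I) [] e; have := fg _ m0.
  by move: e; rewrite /h => /eqP; rewrite eq_le ge_max lexx andbT => /andP[]; lra.
by move=> h1; apply/eqP; rewrite eq_le h1 measure_ge0.
Qed.

(** * Convexity and one-sided derivatives of Laplace transforms *)

Section laplace_strict.
Context {R : realType}.
Local Notation mR := (measurableTypeR R).
Local Notation X := (nat * mR)%type.
Variable b0 : tame (R := R).
Hypothesis b0fin : (b0 setT < +oo)%E.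
Local Notation Pi := (pos_nat b0).
Local Notation G := (lap0 b0).

Lemma expR_gt_tangent (c a : R) : a != c -> expR c * (1 + (a - c)) < expR a.
Proof.
move=> ac; have -> : a = c + (a - c) by rewrite subrKC.
rewrite expRD ltr_pM2l ?expR_gt0//; have -> : c + (a - c) - c = a - c by lra.
by apply: expR_gt1Dx; rewrite subr_eq0.
Qed.

(** Strict convexity of w |-> e^{- w m}: the tangent inequalities at c = - v m, evaluated at 0 and
    at - w m, are added with weights w - v and v, for which the slopes cancel. *)
Lemma expR_chord (v w m : R) : 0 < v -> v < w -> 0 < m ->
  w * expR (- (v * m)) < (w - v) + v * expR (- (w * m)).
Proof.
move=> v0 vw m0; set c := - (v * m).
have vm : 0 < v * m by rewrite mulr_gt0.
have wvm : 0 < (w - v) * m by rewrite mulr_gt0// subr_gt0.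
have h1 : expR c * (1 + (0 - c)) < expR 0.
  by apply: expR_gt_tangent; rewrite /c eq_sym oppr_eq0 gt_eqF.
have h2 : expR c * (1 + (- (w * m) - c)) < expR (- (w * m)).
  by apply: expR_gt_tangent; rewrite /c lt_eqF//; lra.
rewrite expR0 in h1.
have k1 : (w - v) * (expR c * (1 + (0 - c))) < (w - v) * 1 by rewrite ltr_pM2l// subr_gt0.
have k2 : v * (expR c * (1 + (- (w * m) - c))) < v * expR (- (w * m)) by rewrite ltr_pM2l.
have e : w * expR c = (w - v) * (expR c * (1 + (0 - c)))
    + v * (expR c * (1 + (- (w * m) - c))) by rewrite /c; ring.
lra.
Qed.

Lemma lap_t0 w : 0 <= w -> lap b0 0 w = (G w)%:E.
Proof.
move=> w0; rewrite -(lap0E b0fin w0) /lap integral_pos_nat0.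
- by under eq_integral do rewrite /= expr0 mul1r.
- by apply/measurable_EFinP; exact: measurable_lap.
- by move=> x; rewrite lee_fin lap_pt_ge0.
- by move=> k m; rewrite /= expr0n/= mul0r.
Qed.

Lemma dlap_t0 w : dlap b0 0 w = (\int[b0]_m (`|m| * expR (- (w * m)))%:E)%E.
Proof.
rewrite /dlap integral_pos_nat0.
- by under eq_integral do rewrite /= expr0 mul1r.
- by apply/measurable_EFinP; exact: measurable_dlap.
- by move=> x; rewrite lee_fin dlap_pt_ge0.
- by move=> k m; rewrite /= expr0n/= mul0r mulr0.
Qed.

Lemma lap_sub_le t z d : 0 <= t -> 0 <= d ->
  (lap b0 t z <= lap b0 t (z + d) + d%:E * dlap b0 t z)%E.
Proof.
move=> t0 d0.
have mL y : measurable_fun setT (fun x : X => (t ^+ x.1 * expR (- (y * x.2)))%:E : \bar R).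
  by apply/measurable_EFinP; exact: measurable_lap.
have mD : measurable_fun setT
    (fun x : X => (`|x.2| * (t ^+ x.1 * expR (- (z * x.2))))%:E : \bar R).
  by apply/measurable_EFinP; exact: measurable_dlap.
rewrite -ge0_integralZl//; last first.
- by move=> x _; rewrite lee_fin dlap_pt_ge0.
rewrite /lap -ge0_integralD//; last 3 first.
- by move=> x _; rewrite lee_fin lap_pt_ge0.
- by move=> x _; rewrite mule_ge0// lee_fin dlap_pt_ge0.
- exact: emeasurable_funM.
apply: le_pos_integral.
- exact: mL.
- by apply: emeasurable_funD; [exact: mL|exact: emeasurable_funM].
- by move=> x; rewrite lee_fin lap_pt_ge0.
- by move=> x; rewrite adde_ge0// ?mule_ge0// lee_fin ?dlap_pt_ge0// lap_pt_ge0.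
move=> x x0; rewrite -EFinM -EFinD lee_fin gtr0_norm//.
have -> : - ((z + d) * x.2) = - (z * x.2) - d * x.2 by ring.
rewrite expRD.
have h : 1 - d * x.2 <= expR (- (d * x.2)) by exact: expR_ge1Dx.
have p : 0 <= t ^+ x.1 * expR (- (z * x.2)) by exact: lap_pt_ge0.
have := ler_wpM2l p h; lra.
Qed.

(** A bound on difference quotients along steps tending to 0 bounds the derivative, even when [dlap]
    might be infinite: (1 - e^{- d m}) / d is at least m / (1 + d m), which increases to m as d
    decreases to 0, so monotone convergence applies. *)
Lemma dlap_le_bound t z (C : R) : 0 <= t -> (lap b0 t z < +oo)%E ->
  (forall n, lap b0 t z <= lap b0 t (z + harmonic n) + (harmonic n * C)%:E)%E ->
  (dlap b0 t z <= C%:E)%E.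
Proof.
move=> t0 lfin hC.
pose g (d : R) (x : X) := t ^+ x.1 * expR (- (z * x.2)) * (`|x.2| / (1 + d * `|x.2|)).
have den d (x : X) : 0 <= d -> 0 < 1 + d * `|x.2| by move=> d0; rewrite ltr_wpDr// mulr_ge0.
have g0 d x : 0 <= d -> 0 <= g d x.
  by move=> d0; rewrite mulr_ge0 ?lap_pt_ge0// divr_ge0// ltW// den.
have mg d : measurable_fun setT (g d).
  apply: measurable_funM; first exact: measurable_lap.
  apply: measurable_funM; first exact: measurable_abs_snd.
  apply: (measurableT_comp measurable_inv); apply: measurable_funD => //.
  by apply: measurable_funM => //; exact: measurable_abs_snd.
have H0 n : 0 <= @harmonic R n := ltW (harmonic_gt0 n).
have gC n : (\int[Pi]_x (g (harmonic n) x)%:E <= C%:E)%E.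
  have d0 := harmonic_gt0 (R := R) n; move: (@harmonic R n) d0 (hC n) => d d0 hCd.
  have lfin2 : lap b0 t (z + d) \is a fin_num.
    rewrite ge0_fin_numE; last exact: lap_ge0.
    apply: le_lt_trans lfin; apply: le_lap; first by [].
    by rewrite lerDl ltW.
  rewrite -(@lee_pmul2l _ d%:E) ?lte_fin// -EFinM -(leeD2lE _ _ lfin2).
  apply: le_trans hCd.
  rewrite -ge0_integralZl//; last 3 first.
  - exact/measurable_EFinP.
  - by move=> x _; rewrite lee_fin g0// ltW.
  - by rewrite lee_fin ltW.
  rewrite /lap -ge0_integralD//; last 4 first.
  - by move=> x _; rewrite lee_fin lap_pt_ge0.
  - by apply/measurable_EFinP; exact: measurable_lap.
  - by move=> x _; rewrite mule_ge0 ?lee_fin ?g0// ltW.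
  - by apply: emeasurable_funM => //; exact/measurable_EFinP.
  apply: le_pos_integral.
  - apply: emeasurable_funD; first by apply/measurable_EFinP; exact: measurable_lap.
    by apply: emeasurable_funM => //; exact/measurable_EFinP.
  - by apply/measurable_EFinP; exact: measurable_lap.
  - by move=> x; rewrite adde_ge0 ?mule_ge0 ?lee_fin ?lap_pt_ge0 ?g0// ltW.
  - by move=> x; rewrite lee_fin lap_pt_ge0.
  move=> x x0; rewrite -EFinM -EFinD lee_fin /g gtr0_norm//.
  have -> : - ((z + d) * x.2) = - (z * x.2) - d * x.2 by ring.
  rewrite expRD.
  have p : 0 <= t ^+ x.1 * expR (- (z * x.2)) by exact: lap_pt_ge0.
  have dx : 0 < 1 + d * x.2 by rewrite ltr_wpDr// mulr_ge0// ltW.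
  have h : expR (- (d * x.2)) <= (1 + d * x.2)^-1.
    by rewrite expRN lef_pV2 ?posrE ?expR_gt0//; exact: expR_ge1Dx.
  have e : d * (x.2 / (1 + d * x.2)) = 1 - (1 + d * x.2)^-1.
    by field; rewrite gt_eqF.
  have : t ^+ x.1 * expR (- (z * x.2)) * (expR (- (d * x.2)) + d * (x.2 / (1 + d * x.2))) <=
      t ^+ x.1 * expR (- (z * x.2)) * 1 by rewrite ler_wpM2l// e; lra.
  lra.
suff cv : (\int[Pi]_x (g (harmonic n) x)%:E)%E @[n --> \oo] --> dlap b0 t z.
  by apply: (cvge_to_le cv); exact: nearW.
apply: cvg_monotone_integral.
- by move=> n; exact/measurable_EFinP.
- by move=> n x; rewrite lee_fin g0.
- move=> x m n mn; rewrite lee_fin /g ler_wpM2l ?lap_pt_ge0// ler_wpM2l//.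
  rewrite lef_pV2 ?posrE ?den// lerD2l ler_wpM2r//.
  exact: harmonic_noninc.
move=> x; apply: cvg_EFin; first exact: nearW.
rewrite mulrC; apply: cvgMl_tmp; rewrite -[X in _ --> X]mulr1; apply: cvgMl_tmp.
rewrite -[X in _ --> X]invr1; apply: cvgV; first by rewrite oner_eq0.
rewrite -[X in _ --> X]addr0; apply: cvgD; first exact: cvg_cst.
by rewrite -(mul0r `|x.2|); apply: cvgMr_tmp; exact: cvg_harmonic.
Qed.

Lemma lap0_sub_le v w : 0 <= v -> v <= w ->
  ((G v)%:E <= (G w)%:E + (w - v)%:E * dlap b0 0 v)%E.
Proof.
move=> v0 vw; rewrite -!lap_t0 ?(le_trans v0)//.
by have := @lap_sub_le 0 v (w - v) (lexx 0); rewrite subr_ge0 vw subrKC; exact.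
Qed.

(** From v m e^{- v m} <= 1. The constant blows up as v tends to 0, where the slope of G may be
    infinite; continuity of G at 0 is obtained from monotone convergence instead. *)
Lemma lap0_lip v w : 0 < v -> v <= w -> G v <= G w + (w - v) / v * G 0.
Proof.
move=> v0 vw; have w0 := lt_le_trans v0 vw.
have k0 : 0 <= (w - v) / v by rewrite divr_ge0 ?subr_ge0// ltW.
rewrite -lee_fin EFinD EFinM -!lap0E ?(ltW v0) ?(ltW w0)//.
have mE y : measurable_fun setT (fun m : mR => (expR (- (y * m)))%:E : \bar R).
  by apply/measurable_EFinP; exact: measurable_expRNM.
rewrite -ge0_integralZl// -ge0_integralD//; last 2 first.
- by move=> m _; rewrite mule_ge0.
- exact: emeasurable_funM.
apply: (le_supp_integral (tame_supp b0)) => //.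
- by apply: emeasurable_funD => //; exact: emeasurable_funM.
- by move=> m; rewrite adde_ge0// mule_ge0.
move=> m m0; rewrite mul0r oppr0 expR0 -EFinM -EFinD lee_fin mulr1.
have h : v * m * expR (- (v * m)) <= 1.
  rewrite expRN ler_pdivrMr ?expR_gt0// mul1r.
  by rewrite (le_trans _ (expR_ge1Dx _))// lerDr.
have -> : - (w * m) = - (v * m) + - ((w - v) * m) by ring.
rewrite expRD.
have h2 : 1 - (w - v) * m <= expR (- ((w - v) * m)) by exact: expR_ge1Dx.
have h3 := ler_wpM2l (expR_ge0 (- (v * m))) h2.
have h4 := ler_wpM2l k0 h.
have e : (w - v) / v * (v * m * expR (- (v * m))) = expR (- (v * m)) * ((w - v) * m).
  by field; rewrite gt_eqF.
lra.
Qed.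

Lemma lap0_cont w e : 0 <= w -> 0 < e ->
  exists2 d : R, 0 < d & forall v, 0 <= v -> `|v - w| < d -> `|G v - G w| < e.
Proof.
rewrite le_eqVlt => /predU1P[<-|w0] e0.
  have := cvg_lap (b0 := b0) (z := 0) (lexx 0) harmonic_noninc
    (fun n => ltW (harmonic_gt0 n)) cvg_harmonic.
  rewrite lap_t0//; under eq_fun do rewrite add0r lap_t0 ?(ltW (harmonic_gt0 _))//.
  move=> /fine_cvgP[_] /= /cvgrPdist_lt/(_ _ e0)[N _ /(_ N (leqnn N))] /= hN.
  exists (harmonic N); first exact: harmonic_gt0.
  move=> v v0; rewrite subr0 ger0_norm// => vN.
  apply: le_lt_trans hN; rewrite distrC.
  by rewrite !ger0_norm ?subr_ge0 ?le_lap0 ?(ltW (harmonic_gt0 N))// lerB// le_lap0// ltW.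
pose k := 2 / w * (G 0 + 1).
have k0 : 0 < k by rewrite mulr_gt0 ?divr_gt0// ltr_wpDl// lap0_ge0.
have lip v v' : w / 2 < v -> v <= v' -> G v - G v' <= k * (v' - v).
  move=> wv vv'; have v0 : 0 < v by rewrite (lt_trans _ wv)// divr_gt0.
  have := lap0_lip v0 vv'; suff : (v' - v) / v * G 0 <= k * (v' - v) by lra.
  rewrite mulrC mulrCA /k [leRHS]mulrC ler_wpM2l ?subr_ge0//.
  rewrite mulrC ler_pM ?invr_ge0 ?lap0_ge0 ?(ltW v0)// ?lerDl//.
  have -> : 2 / w = (w / 2)^-1 by field; rewrite gt_eqF.
  by rewrite lef_pV2 ?posrE ?divr_gt0// ltW.
exists (Num.min (w / 2) (e / k)); first by rewrite lt_min !divr_gt0.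
move=> v v0; rewrite lt_min => /andP[vw1 vw2].
have wv : w / 2 < v by move: vw1; rewrite ltr_norml => /andP[]; lra.
have ww : w / 2 < w by lra.
have kd : k * `|v - w| < e by rewrite mulrC -ltr_pdivlMr.
apply: le_lt_trans kd.
have [vw|/ltW wv'] := leP v w.
  rewrite ger0_norm ?subr_ge0 ?le_lap0// ler0_norm ?subr_le0// opprB; exact: lip.
by rewrite distrC ger0_norm ?subr_ge0 ?le_lap0 ?(ltW w0)// ger0_norm ?subr_ge0//; exact: lip.
Qed.

Hypothesis b0pos : b0 setT <> 0%E.

Lemma lap0_lt v w : 0 <= v -> v < w -> G w < G v.
Proof.
move=> v0 vw; have w0 := le_lt_trans v0 vw.
rewrite -lte_fin -!lap0E ?(ltW w0)//.
apply: (lt_supp_integral (tame_supp b0)) => //; try exact: measurable_expRNM.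
- by move=> m m0; rewrite ltr_expR ltrN2 ltr_pM2r.
- by rewrite (lap0E b0fin (ltW w0)) ltry.
Qed.

(** Strict convexity of G in the form used below: the slope (G 0 - G w) / w of the chord from 0
    strictly decreases in w. *)
Lemma lap0_chord v w : 0 < v -> v < w -> v * (G 0 - G w) < w * (G 0 - G v).
Proof.
move=> v0 vw; have w0 := lt_trans v0 vw.
suff : w * G v < (w - v) * G 0 + v * G w by lra.
have mE y : measurable_fun setT (fun m : mR => (expR (- (y * m)))%:E : \bar R).
  by apply/measurable_EFinP; exact: measurable_expRNM.
have wv0 : 0 <= w - v by rewrite subr_ge0 ltW.
rewrite -lte_fin EFinD !EFinM -!lap0E ?(ltW v0) ?(ltW w0)//.
rewrite -ge0_integralZl ?lee_fin ?(ltW w0)//.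
rewrite -ge0_integralZl ?lee_fin ?wv0//.
rewrite -ge0_integralZl ?lee_fin ?(ltW v0)//.
rewrite -ge0_integralD//; last 4 first.
- by move=> m _; rewrite mule_ge0.
- exact: emeasurable_funM.
- by move=> m _; rewrite mule_ge0// lee_fin ltW.
- exact: emeasurable_funM.
apply: (lt_supp_integral (f := fun m => w * expR (- (v * m)))
  (g := fun m => (w - v) * expR (- (0 * m)) + v * expR (- (w * m))) (tame_supp b0)) => //.
- by apply: measurable_funM => //; exact: measurable_expRNM.
- by apply: measurable_funD; apply: measurable_funM => //; exact: measurable_expRNM.
- by move=> m; rewrite mulr_ge0 ?expR_ge0// ltW.
- by move=> m m0; rewrite mul0r oppr0 expR0 mulr1; exact: expR_chord.
- under eq_integral do rewrite EFinM.
  by rewrite ge0_integralZl ?lee_fin ?(ltW w0)// lap0E ?(ltW v0)// -EFinM ltry.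
Qed.

(** The inequality (1 + v m) e^{- v m} < 1, integrated: the tangent of G at v is strictly less steep
    than the chord from 0. At v = u_t that chord has slope 1 / t, which gives t p < 1 in
    [dlap_post_gel]. *)
Lemma dlap0_lt v : 0 < v -> exists2 p : R, dlap b0 0 v = p%:E & v * p < G 0 - G v.
Proof.
move=> v0.
have mE y : measurable_fun setT (fun m : mR => expR (- (y * m))) by exact: measurable_expRNM.
have md : measurable_fun setT (fun m : mR => `|m| * expR (- (v * m))).
  by apply: measurable_funM => //; exact: measurableT_comp.
have d0 : (0 <= dlap b0 0 v)%E by exact: dlap_ge0.
have fin : (dlap b0 0 v < +oo)%E.
  apply: le_lt_trans (dlap_le b0 v (lexx 0) v0) _.
  by rewrite subrr lap_t0// -EFinM ltry.
have dE : dlap b0 0 v = (fine (dlap b0 0 v))%:E by rewrite fineK// ge0_fin_numE.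
exists (fine (dlap b0 0 v)) => //.
rewrite ltrBrDr -lte_fin EFinD EFinM -dE dlap_t0 -!lap0E ?(ltW v0)//.
rewrite -ge0_integralZl ?lee_fin ?(ltW v0)//; last first.
- by apply/measurable_EFinP; exact: md.
rewrite -ge0_integralD//; last 3 first.
- by move=> m _; rewrite -EFinM lee_fin !mulr_ge0 ?expR_ge0// ltW.
- by apply: emeasurable_funM => //; exact/measurable_EFinP.
- by apply/measurable_EFinP; exact: mE.
apply: (lt_supp_integral (f := fun m => v * (`|m| * expR (- (v * m))) + expR (- (v * m)))
  (tame_supp b0)) => //.
- by apply: measurable_funD => //; apply: measurable_funM.
- by move=> m; rewrite addr_ge0 ?mulr_ge0 ?expR_ge0// ltW.
- move=> m m0; rewrite mul0r oppr0 expR0 gtr0_norm//.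
  have -> : v * (m * expR (- (v * m))) + expR (- (v * m)) = (1 + v * m) * expR (- (v * m)) by ring.
  by rewrite expRN ltr_pdivrMr ?expR_gt0// mul1r expR_gt1Dx// gt_eqF// mulr_gt0.
have e : (\int[b0]_m (v * (`|m| * expR (- (v * m))) + expR (- (v * m)))%:E =
    v%:E * dlap b0 0 v + (G v)%:E)%E.
  rewrite dlap_t0 -lap0E ?ltW// -ge0_integralZl ?lee_fin ?(ltW v0)//; last first.
  - by apply/measurable_EFinP; exact: md.
  rewrite -ge0_integralD//.
  - by move=> m _; rewrite -EFinM lee_fin !mulr_ge0 ?expR_ge0// ltW.
  - by apply: emeasurable_funM => //; exact/measurable_EFinP.
  - by apply/measurable_EFinP; exact: mE.
by rewrite e dE -EFinM -EFinD ltry.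
Qed.

End laplace_strict.

(** * The largest root of the characteristic equation *)

Section gelation_exponent.
Context {R : realType}.
Variable G : R -> R.
Hypothesis G_ge0 : forall w, 0 <= G w.
Hypothesis G_lt : forall v w, 0 <= v -> v < w -> G w < G v.
Hypothesis G_chord : forall v w, 0 < v -> v < w -> v * (G 0 - G w) < w * (G 0 - G v).
Hypothesis G_cont : forall w e, 0 <= w -> 0 < e ->
  exists2 d : R, 0 < d & forall v, 0 <= v -> `|v - w| < d -> `|G v - G w| < e.

(** The end at time t of the characteristic started at w, measured from t M_0: w + t G w = t M_0 +
    [charf t w]. *)
Definition charf (t w : R) : R := w - t * (G 0 - G w).

Let G0w w : 0 < w -> 0 < G 0 - G w.
Proof. by move=> w0; rewrite subr_gt0 G_lt. Qed.

Let G_noninc v w : 0 <= v -> v <= w -> G w <= G v.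
Proof. by move=> v0; rewrite le_eqVlt => /predU1P[->//|/(G_lt v0)/ltW]. Qed.

Lemma charf0 t : charf t 0 = 0.
Proof. by rewrite /charf !subrr mulr0 subrr. Qed.

(** The sign of [charf t w] compares the chord slope (G 0 - G w) / w with 1 / t. The slope is
    strictly decreasing and equals 1 / t at u, so there is exactly one change of sign. *)
Lemma charf_root t u w : 0 < u -> charf t u = 0 -> 0 < w ->
  (u < w -> 0 < charf t w) /\ (w < u -> charf t w < 0).
Proof.
rewrite /charf => u0 ru w0; have gu := G0w u0.
have tu : t * (G 0 - G u) = u by move: ru; lra.
have t0 : 0 < t by rewrite -(pmulr_lgt0 _ gu) tu.
split=> uw.
  have := G_chord u0 uw; rewrite -(ltr_pM2l t0) => h.
  rewrite subr_gt0 -(ltr_pM2l u0).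
  move: h tu; move: (G 0 - G w) (G 0 - G u) => a b h tu.
  have -> : u * (t * a) = t * (u * a) by ring.
  by rewrite (lt_le_trans h)// mulrCA tu mulrC.
have := G_chord w0 uw; rewrite -(ltr_pM2l t0) => h.
rewrite subr_lt0 -(ltr_pM2l u0).
move: h tu; move: (G 0 - G w) (G 0 - G u) => a b h tu.
have -> : u * (t * a) = t * (u * a) by ring.
by rewrite (le_lt_trans _ h)// mulrCA tu mulrC.
Qed.

Lemma charf_continuous t a b : 0 < a -> {within `[a, b], continuous (charf t)}.
Proof.
move=> a0; apply: continuous_in_subspaceT => w; rewrite inE/= in_itv/= => /andP[aw _].
have w0 := lt_le_trans a0 aw.
have cG : G v @[v --> w] --> G w.
  apply/cvgrPdist_lt => e e0; have [d d0 hd] := G_cont (ltW w0) e0.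
  near=> v; rewrite distrC; apply: hd.
    by apply: ltW; near: v; exact: lt_nbhsr.
  rewrite distrC; near: v; by apply/nbhs_ballP; exists d.
have cd : G 0 - G v @[v --> w] --> G 0 - G w by apply: cvgB => //; exact: cvg_cst.
have ce : t * (G 0 - G v) @[v --> w] --> t * (G 0 - G w).
  by apply: cvgM => //; exact: cvg_cst.
by apply: cvgB => //; exact: cvg_id.
Unshelve. all: end_near. Qed.

(** Either [charf t] is positive on (0, +oo) and the root is 0, or a positive root comes from the
    intermediate value theorem. All real t are allowed, with root 0 for t < 0, which makes
    continuity at t = 0 two-sided. *)
Lemma gel_exp_spec t : exists u : R, [/\ 0 <= u, charf t u = 0,
  forall w, u < w -> 0 < charf t w & forall w, 0 < w -> w < u -> charf t w < 0].
Proof.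
have [[w [w0 cw]]|h] := pselect (exists w, 0 < w /\ charf t w <= 0); last first.
  exists 0; split => //; first exact: charf0.
    by move=> w w0; rewrite ltNge; apply/negP => cw; apply: h; exists w.
  by move=> w w0 /(lt_trans w0); rewrite ltxx.
(* For t >= 0, t (G 0 - G b) <= t G 0 < b; for t < 0 any positive point would do. *)
pose b := Num.max w (t * G 0 + w).
have cb : 0 < charf t b.
  have b0' : 0 < b by rewrite lt_max w0.
  have [t0|t0] := leP 0 t.
    rewrite /charf; have : t * (G 0 - G b) <= t * G 0.
      by rewrite ler_wpM2l// gerBl G_ge0.
    have : t * G 0 + w <= b by rewrite /b le_max lexx orbT.
    lra.
  by rewrite /charf subr_gt0 (lt_trans _ b0')// nmulr_rlt0// G0w.
have wb : w <= b by rewrite le_max lexx.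
have rng : Num.min (charf t w) (charf t b) <= 0 <= Num.max (charf t w) (charf t b).
  by rewrite ge_min le_max cw (ltW cb) orbT.
have [c] := IVT wb (charf_continuous (t := t) (b := b) w0) rng.
rewrite in_itv/= => /andP[wc _] c0; have cp := lt_le_trans w0 wc.
exists c; split => //; first exact: ltW.
  by move=> v cv; exact: (charf_root cp c0 (lt_trans cp cv)).1.
by move=> v v0 vc; exact: (charf_root cp c0 v0).2.
Qed.

Definition gel_exp t : R := sval (cid (gel_exp_spec t)).
Local Notation u := gel_exp.

Lemma gel_exp_ge0 t : 0 <= u t.
Proof. by rewrite /gel_exp; case: (cid _) => ? []. Qed.

Lemma charf_gel_exp t : charf t (u t) = 0.
Proof. by rewrite /gel_exp; case: (cid _) => ? []. Qed.

Lemma gel_expE t : u t = t * (G 0 - G (u t)).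
Proof. by have := charf_gel_exp t; rewrite /charf => /eqP; rewrite subr_eq0 => /eqP. Qed.

Lemma charf_gt0 t w : u t < w -> 0 < charf t w.
Proof. by rewrite /gel_exp; case: (cid _) => ? [? ? h ?]; exact: h. Qed.

Lemma charf_lt0 t w : 0 < w -> w < u t -> charf t w < 0.
Proof. by rewrite /gel_exp; case: (cid _) => ? [? ? ? h]; exact: h. Qed.

Lemma gel_exp_lt t w : 0 < w -> (u t < w) = (0 < charf t w).
Proof.
move=> w0; have [/charf_gt0 -> //|wu] := ltP (u t) w.
move: wu; rewrite le_eqVlt => /predU1P[->|/(charf_lt0 w0) h].
  by rewrite charf_gel_exp ltxx.
by apply/esym/negbTE; rewrite -leNgt ltW.
Qed.

Lemma gel_exp_gt t w : 0 < w -> (w < u t) = (charf t w < 0).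
Proof.
move=> w0; have [/(charf_lt0 w0) -> //|uw] := ltP w (u t).
move: uw; rewrite le_eqVlt => /predU1P[<-|/charf_gt0 h].
  by rewrite charf_gel_exp ltxx.
by apply/esym/negbTE; rewrite -leNgt ltW.
Qed.

Lemma gel_exp_unique t w : 0 < w -> charf t w = 0 -> u t = w.
Proof.
move=> w0 c0; have := gel_exp_lt t w0; have := gel_exp_gt t w0.
rewrite c0 ltxx => /negbT; rewrite -leNgt => h1 /negbT; rewrite -leNgt => h2.
by apply/eqP; rewrite eq_le h1 h2.
Qed.

Lemma gel_exp_strict s t : s < t -> 0 < u t -> u s < u t.
Proof.
move=> st ut; rewrite gel_exp_lt// -(charf_gel_exp t) /charf ltrD2l ltrN2.
by rewrite ltr_pM2r// G0w.
Qed.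

(** [charf] is affine in t, so its strict signs on either side of u_t persist at nearby times, and
    these signs locate the root. When u_t = 0 the lower side is given by [gel_exp_ge0]. *)
Lemma gel_exp_cont t e : 0 < e ->
  exists2 d : R, 0 < d & forall s, `|s - t| < d -> `|u s - u t| < e.
Proof.
move=> e0.
have lip s w : charf s w = charf t w - (s - t) * (G 0 - G w) by rewrite /charf; ring.
have up w : 0 < w -> 0 < charf t w ->
    exists2 d : R, 0 < d & forall s, `|s - t| < d -> 0 < charf s w.
  move=> w0 cw; exists (charf t w / (G 0 - G w)); first by rewrite divr_gt0// G0w.
  move=> s; rewrite ltr_pdivlMr ?G0w// => h.
  rewrite lip subr_gt0 (le_lt_trans _ h)// ler_wpM2r ?ler_norm// ltW// G0w//.
have dn w : 0 < w -> charf t w < 0 ->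
    exists2 d : R, 0 < d & forall s, `|s - t| < d -> charf s w < 0.
  move=> w0 cw; exists (- charf t w / (G 0 - G w)); first by rewrite divr_gt0 ?oppr_gt0// G0w.
  move=> s; rewrite ltr_pdivlMr ?G0w// => h.
  rewrite lip subr_lt0; move: h; have : - `|s - t| * (G 0 - G w) <= (s - t) * (G 0 - G w).
    by rewrite ler_wpM2r ?(ltW (G0w _))// lerNl -normrN ler_norm.
  lra.
have ut := gel_exp_ge0 t; have w0 : 0 < u t + e by rewrite ltr_wpDl.
have [|d d0 hd] := up _ w0; first by rewrite -gel_exp_lt// ltrDl.
have [u0|u0] := ltP 0 (u t); last first.
  exists d => // s /hd; rewrite -gel_exp_lt// => h1; have := gel_exp_ge0 s => h2.
  by rewrite ltr_norml; apply/andP; split; lra.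
pose r := Num.min e (u t) / 2.
have [r0 re ru] : [/\ 0 < r, r < e & r < u t].
  have m0 : 0 < Num.min e (u t) by rewrite lt_min e0.
  have [m1 m2] : Num.min e (u t) <= e /\ Num.min e (u t) <= u t.
    by rewrite !ge_min !lexx orbT.
  by rewrite /r; split; lra.
have w1 : 0 < u t - r by lra.
have [|d' d'0 hd'] := dn _ w1; first by rewrite -gel_exp_gt// ltrBlDr ltrDl.
exists (Num.min d d'); first by rewrite lt_min d0.
move=> s; rewrite lt_min => /andP[/hd h1 /hd' h2].
move: h1 h2; rewrite -gel_exp_lt// -gel_exp_gt// => h1 h2.
by rewrite ltr_norml; apply/andP; split; lra.
Qed.

Lemma gel_mass_continuous : continuous (fun t => G (u t)).
Proof.
move=> t; apply/cvgrPdist_lt => e e0.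
have [d d0 hd] := G_cont (gel_exp_ge0 t) e0.
have [d' d'0 hd'] := gel_exp_cont t d0.
near=> s; rewrite distrC; apply: hd; first exact: gel_exp_ge0.
apply: hd'; rewrite distrC; near: s.
by apply/nbhs_ballP; exists d'.
Unshelve. all: end_near. Qed.

Lemma charf_le t w : 0 <= t -> u t <= w -> charf t w <= w - u t.
Proof.
move=> t0 uw; rewrite /charf; have := gel_expE t.
have : t * G w <= t * G (u t) by rewrite ler_wpM2l// G_noninc// gel_exp_ge0.
lra.
Qed.

(** Every point above t M_0 is reached at time t by a characteristic started beyond u_t. *)
Lemma charf_surj t v : 0 <= t -> 0 < v -> exists2 w, u t < w & charf t w = v.
Proof.
move=> t0 v0; have ut := gel_exp_ge0 t.
have a0 : 0 < u t + v by rewrite ltr_wpDl.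
have tG : 0 <= t * G 0 by rewrite mulr_ge0// G_ge0.
set b := u t + v + t * G 0.
have ab : u t + v <= b by rewrite lerDl.
have rng : Num.min (charf t (u t + v)) (charf t b) <= v <=
    Num.max (charf t (u t + v)) (charf t b).
  rewrite ge_min le_max; apply/andP; split; apply/orP; [left|right].
    by have := @charf_le t (u t + v) t0; rewrite lerDl (ltW v0) => /(_ isT); lra.
  rewrite /charf.
  have : t * (G 0 - G b) <= t * G 0 by rewrite ler_wpM2l// gerBl G_ge0.
  by rewrite /b; lra.
have [c] := IVT ab (charf_continuous (t := t) (b := b) a0) rng.
rewrite in_itv/= => /andP[ac _] cv; exists c => //.
by rewrite (lt_le_trans _ ac)// ltrDl.
Qed.

End gelation_exponent.

(** * Mass and second moment at the end of the characteristics *)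

Section gelation.
Context {R : realType}.
Variable b0 : tame (R := R).
Hypothesis b0fin : (b0 setT < +oo)%E.
Hypothesis b0pos : b0 setT <> 0%E.
Local Notation G := (lap0 b0).

Definition gexp : R -> R := gel_exp (lap0_ge0 b0) (lap0_lt b0fin b0pos)
  (lap0_chord b0fin b0pos) (lap0_cont b0fin).
Local Notation u := gexp.
Local Notation charf := (charf G).

Lemma gexp_ge0 t : 0 <= u t. Proof. exact: gel_exp_ge0. Qed.
Lemma gexpE t : u t = t * (G 0 - G (u t)). Proof. exact: gel_expE. Qed.
Lemma gexp_gt t w : 0 < w -> (w < u t) = (charf t w < 0). Proof. exact: gel_exp_gt. Qed.
Lemma gexp_charf_gt0 t w : u t < w -> 0 < charf t w. Proof. exact: charf_gt0. Qed.
Lemma gexp_unique t w : 0 < w -> charf t w = 0 -> u t = w. Proof. exact: gel_exp_unique. Qed.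
Lemma gexp_strict s t : s < t -> 0 < u t -> u s < u t. Proof. exact: gel_exp_strict. Qed.
Lemma gexp_mass_continuous : continuous (fun t => G (u t)).
Proof. exact: gel_mass_continuous. Qed.
Lemma gexp_surj t v : 0 <= t -> 0 < v -> exists2 w, u t < w & charf t w = v.
Proof. exact: charf_surj. Qed.

Lemma lap0_gap w : 0 < w -> 0 < G 0 - G w.
Proof. by move=> w0; rewrite subr_gt0 (lap0_lt b0fin b0pos). Qed.

Lemma lap_charf t w : 0 <= t -> u t < w -> lap b0 t (t * G 0 + charf t w) = (G w)%:E.
Proof.
move=> t0 uw; have w0 := le_lt_trans (gexp_ge0 t) uw.
have -> : t * G 0 + charf t w = w + t * G w by rewrite /charf; ring.
apply: lap_eq => //; exact: (gexp_charf_gt0 uw).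
Qed.

(** [lap_eq] asks for a positive gap, which is zero at u_t, so the value is squeezed: from above by
    monotone convergence along points decreasing to t M_0, from below by monotonicity in z and
    continuity of G. *)
Lemma lap_gel_exp t : 0 <= t -> lap b0 t (t * G 0) = (G (u t))%:E.
Proof.
move=> t0; have ut := gexp_ge0 t; apply/eqP; rewrite eq_le; apply/andP; split.
  have cv := cvg_lap (b0 := b0) (z := t * G 0) t0 harmonic_noninc
    (fun n => ltW (harmonic_gt0 n)) cvg_harmonic.
  apply: (cvge_to_le cv); apply: nearW => n.
  have [w uw <-] := gexp_surj t0 (harmonic_gt0 (R := R) n).
  by rewrite lap_charf// lee_fin le_lap0// ltW.
apply/lee_addgt0Pr => e e0; have [d d0 hd] := lap0_cont b0fin ut e0.
have uw : u t < u t + d / 2 by rewrite ltrDl divr_gt0.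
have w0 := le_lt_trans ut uw.
have hw : `|G (u t + d / 2) - G (u t)| < e.
  apply: hd; first exact: ltW.
  have -> : u t + d / 2 - u t = d / 2 by ring.
  by rewrite gtr0_norm ?divr_gt0//; lra.
apply: (@le_trans _ _ ((G (u t + d / 2))%:E + e%:E)%E).
  by rewrite -EFinD lee_fin; move: hw; rewrite ltr_norml => /andP[]; lra.
rewrite leeD2r// -(lap_charf t0 uw); apply: le_lap => //.
by rewrite lerDl ltW// (gexp_charf_gt0 uw).
Qed.

(** Differentiating L(t, w + t G w) = G w in w gives - L_z = p / (1 - t p), where p = - G' w.
    Difference quotients at u_t replace the derivatives. *)
Lemma dlap_gexp_le t p : 0 <= t -> dlap b0 0 (u t) = p%:E -> t * p < 1 ->
  (dlap b0 t (t * G 0) <= (p / (1 - t * p))%:E)%E.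
Proof.
move=> t0 pE tp; have ut := gexp_ge0 t.
have p0 : 0 <= p by rewrite -lee_fin -pE dlap_ge0.
apply: dlap_le_bound => //; first by rewrite lap_gel_exp// ltry.
move=> n; have [w uw] := gexp_surj t0 (harmonic_gt0 (R := R) n).
move: (harmonic n) => h hE; rewrite -hE lap_charf// lap_gel_exp// -EFinD lee_fin.
have := lap0_sub_le b0fin ut (ltW uw); rewrite pE -EFinM -EFinD lee_fin => k.
have hw : (w - u t) * (1 - t * p) <= charf t w.
  rewrite /charf; have := gexpE t.
  have := ler_wpM2l t0 k; lra.
have : (w - u t) * p <= charf t w * (p / (1 - t * p)); last lra.
rewrite mulrA ler_pdivlMr ?subr_gt0//.
have -> : (w - u t) * p * (1 - t * p) = (w - u t) * (1 - t * p) * p by ring.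
by rewrite ler_wpM2r.
Qed.

Lemma dlap_post_gel t : 0 <= t -> 0 < u t -> (dlap b0 t (t * G 0) < +oo)%E.
Proof.
move=> t0 ut; have [p pE up] := dlap0_lt b0fin b0pos ut.
apply: le_lt_trans (dlap_gexp_le t0 pE _) _; last by rewrite ltry.
rewrite -(ltr_pM2l ut) mulr1 {2}gexpE mulrCA ltr_pM2l//.
by rewrite lt0r t0 andbT; apply: contraTneq ut => ->; rewrite gexpE mul0r ltxx.
Qed.

(** If u_t were positive, its chord slope would be 1 / t, whereas strict convexity puts it strictly
    below the slope k at 0. *)
Lemma gexp_eq0 t k : 0 <= t -> dlap b0 0 0 = k%:E -> t * k <= 1 -> u t = 0.
Proof.
move=> t0 kE tk; apply/eqP; rewrite eq_le gexp_ge0 andbT leNgt; apply/negP => ut.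
have gu := lap0_gap ut.
have tp : 0 < t by move: ut; rewrite {1}gexpE pmulr_lgt0.
(* The midpoint supplies strictness: the chord slope at u_t is less than the one at u_t / 2, itself
   at most k. *)
have u2 : 0 < u t / 2 by rewrite divr_gt0.
have uu : u t / 2 < u t by lra.
have := lap0_sub_le b0fin (lexx 0) (ltW u2); rewrite kE -EFinM -EFinD lee_fin subr0 => h1.
have h2 := lap0_chord b0fin b0pos u2 uu.
have h3 : G 0 - G (u t) < u t * k.
  rewrite -(ltr_pM2l u2) (lt_le_trans h2)//.
  have -> : u t / 2 * (u t * k) = u t * (u t / 2 * k) by ring.
  by apply: ler_wpM2l; [exact: ltW|lra].
have : t * (G 0 - G (u t)) < t * (u t * k) by rewrite ltr_pM2l.
rewrite -gexpE mulrCA; have := ler_wpM2l (ltW ut) tk; lra.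
Qed.

(** When u_t = 0, [charf t] is positive on (0, +oo), which says that all difference quotients of G
    at 0 are below 1 / t. *)
Lemma dlap0_le_inv t : 0 < t -> u t = 0 -> (dlap b0 0 0 <= (t^-1)%:E)%E.
Proof.
move=> t0 ut; apply: dlap_le_bound => //; first by rewrite (lap_t0 b0fin)// ltry.
move=> n; have h0 := harmonic_gt0 (R := R) n; move: (harmonic n) h0 => h h0.
rewrite add0r !(lap_t0 b0fin) ?(ltW h0)// -EFinD lee_fin.
have : 0 < charf t h by apply: gexp_charf_gt0; rewrite ut.
rewrite /charf subr_gt0 mulrC -ltr_pdivlMr//; lra.
Qed.

(** A finite value C could be transported back along the characteristics by the inverse of p |-> p /
    (1 - t p), which would bound the slope of G at 0 by C / (1 + t C), less than 1 / t. *)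
Lemma dlap_gel_time t : 0 < t -> dlap b0 0 0 = (t^-1)%:E -> dlap b0 t (t * G 0) = +oo%E.
Proof.
move=> t0 kE.
have ut : u t = 0 by apply: (gexp_eq0 (ltW t0) kE); rewrite divff// gt_eqF.
have := @dlap_ge0 _ b0 t (t * G 0) (ltW t0).
case E : (dlap b0 t (t * G 0)) => [C| |]//; rewrite lee_fin => C0.
have tC : 0 < 1 + t * C by rewrite ltr_wpDr// mulr_ge0// ltW.
suff : (dlap b0 0 0 <= (C / (1 + t * C))%:E)%E.
  rewrite kE lee_fin ler_pdivlMr// mulrDr mulr1 mulKf ?gt_eqF//.
  have ti : 0 < t^-1 by rewrite invr_gt0.
  by move=> h; exfalso; lra.
apply: dlap_le_bound => //; first by rewrite (lap_t0 b0fin)// ltry.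
move=> n; have h0 := harmonic_gt0 (R := R) n; move: (harmonic n) h0 => h h0.
rewrite add0r !(lap_t0 b0fin) ?(ltW h0)// -EFinD lee_fin.
have uh : u t < h by rewrite ut.
have := lap_sub_le b0 (t * G 0) (ltW t0) (ltW (gexp_charf_gt0 uh)).
rewrite lap_charf ?(ltW t0)// E lap_gel_exp ?(ltW t0)// ut -EFinM -EFinD lee_fin => k.
have : G 0 - G h <= h * (C / (1 + t * C)); last lra.
rewrite mulrA ler_pdivlMr//; move: k; rewrite /charf; lra.
Qed.

End gelation.

(** * Mass, generating function and moments of the solution *)

Section flow_properties.
Context {R : realType}.
Local Notation mR := (measurableTypeR R).
Variable mu0 : borel_measure R.
Hypothesis mu0_radon : radon_pos mu0.
Hypothesis mu0_neq0 : mu0 `]0, +oo[%classic <> 0%E.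
Hypothesis mu0_mass : (moment1 mu0 < +oo)%E.
Local Notation b0 := (mass0 mu0_radon mu0_mass).
Local Notation G := (lap0 b0).
Local Notation flow := (flow mu0_radon mu0_mass).

Lemma pairing_mu0_gt0 (f : R -> R) : measurable_fun setT f -> (forall m, 0 < m -> 0 < f m) ->
  (0 < pairing mu0 f)%E.
Proof.
move=> mf f0; rewrite pairingE//; last exact: mu0_radon.1.
rewrite -(integral0 mu0 setT).
have := @lt_supp_integral R mu0 (cst 0) f mu0_radon.1; apply => //.
- move=> mu0T; apply: mu0_neq0; apply/eqP; rewrite eq_le measure_ge0 andbT.
  by rewrite -[leRHS]mu0T le_measure// inE//; exact: measurable_itv.
- by rewrite integral0 ltry.
Qed.

Lemma moment1_gt0 : (0 < moment1 mu0)%E.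
Proof. exact: pairing_mu0_gt0. Qed.

Lemma moment2_gt0 : (0 < moment2 mu0)%E.
Proof. by apply: pairing_mu0_gt0 => // m m0; rewrite exprn_gt0. Qed.

Lemma mass0_neq0 : b0 setT <> 0%E.
Proof. by rewrite mass0T => e; have := moment1_gt0; rewrite e ltxx. Qed.

Local Notation u := (gexp (mass0_fin mu0_radon mu0_mass) mass0_neq0).
Local Notation charf := (charf G).
Local Notation Tgel := (gel_time mu0).

Lemma moment2_dlap : moment2 mu0 = dlap b0 0 0.
Proof.
rewrite dlap_t0; under eq_integral do rewrite mul0r oppr0 expR0 mulr1.
rewrite (integral_mass0 mu0_radon mu0_mass (f := fun m => `|m|)); last exact: normr_measurable.
by apply: eq_pairing => m m0; rewrite gtr0_norm.
Qed.

Lemma fine_mass : fine (moment1 mu0) = G 0.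
Proof. by rewrite -(M0E mu0_radon mu0_mass). Qed.

Lemma gel_time_cases :
  (moment2 mu0 = +oo%E /\ Tgel = 0) \/
  (exists2 k : R, 0 < k & moment2 mu0 = k%:E /\ Tgel = k^-1).
Proof.
have := moment2_gt0; rewrite /gel_time; case: (moment2 mu0) => [k| |]//; last first.
  by left; split => //; rewrite invey.
rewrite lte_fin => k0; right; exists k => //; split => //.
by rewrite inver gt_eqF.
Qed.

Lemma gel_time_ge0 : 0 <= Tgel.
Proof. by have [[_ ->]|[k k0 [_ ->]]] := gel_time_cases; rewrite ?invr_ge0// ltW. Qed.

Lemma pre_gel_exp t : 0 <= t -> t <= Tgel -> u t = 0.
Proof.
move=> t0; have [[_ ->]|[k k0 [kE ->]]] := gel_time_cases => tT.
  have -> : t = 0 by apply/eqP; rewrite eq_le tT.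
  by rewrite gexpE mul0r.
apply: (gexp_eq0 _ _ t0 (k := k)); first by rewrite -moment2_dlap.
by rewrite -ler_pdivlMr// div1r.
Qed.

Lemma post_gel_exp t : Tgel < t -> 0 < u t.
Proof.
move=> Tt; have t0 : 0 < t by exact: le_lt_trans gel_time_ge0 Tt.
rewrite lt0r gexp_ge0 andbT; apply/eqP => u0.
have := dlap0_le_inv t0 u0; rewrite -moment2_dlap.
have [[-> _]|[k k0 [-> kE]]] := gel_time_cases => //.
rewrite lee_fin => kt; move: Tt; rewrite kE ltNge => /negP; apply.
by rewrite -[leLHS]invrK lef_pV2 ?posrE// invr_gt0.
Qed.

Lemma moment1_flowE t : 0 <= t -> moment1 (flow t) = (G (u t))%:E.
Proof. by move=> t0; rewrite moment1_flow//; exact: lap_gel_exp. Qed.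

Lemma fine_genfun_mu0 w : 0 <= w -> fine (genfun mu0 (expR (- w))) = G w.
Proof. by move=> w0; rewrite (genfun_mu0 mu0_radon mu0_mass w0). Qed.

Lemma moment2_pre_gel t k : 0 <= t -> moment2 mu0 = k%:E -> t * k < 1 ->
  (moment2 (flow t) <= (k / (1 - t * k))%:E)%E.
Proof.
move=> t0 kE tk; rewrite moment2_flow//.
have ut : u t = 0.
  by apply: (gexp_eq0 _ _ t0 (k := k)); [rewrite -moment2_dlap|exact: ltW].
have pE : dlap b0 0 (u t) = k%:E by rewrite ut -moment2_dlap.
exact: (dlap_gexp_le t0 pE tk).
Qed.

Lemma moment2_flow_lty t : 0 <= t -> t <> Tgel -> (moment2 (flow t) < +oo)%E.
Proof.
move=> t0 /eqP; rewrite neq_lt => /orP[tT|Tt]; last first.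
  rewrite moment2_flow//; exact: (dlap_post_gel t0 (post_gel_exp Tt)).
have [[_ Te]|[k k0 [kE Te]]] := gel_time_cases.
  by move: tT; rewrite Te ltNge t0.
apply: le_lt_trans (moment2_pre_gel t0 kE _) _; last by rewrite ltry.
by rewrite -ltr_pdivlMr// div1r -Te.
Qed.

Lemma moment2_flow_gel : moment2 (flow Tgel) = +oo%E.
Proof.
rewrite moment2_flow ?gel_time_ge0//.
have [[Ke ->]|[k k0 [kE ->]]] := gel_time_cases.
  by rewrite mul0r -moment2_dlap.
apply: (dlap_gel_time (mass0_fin mu0_radon mu0_mass) mass0_neq0).
  by rewrite invr_gt0.
by rewrite -moment2_dlap invrK.
Qed.

Lemma flow_solution : flory_solution mu0 flow.
Proof.
split.
- by move=> t t0; exact: radon_flow.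
- by move=> A mA; exact: flow0.
- by move=> t t0; split; [exact: measurable_moment1_flow|exact: flow_mass_sqr_lty].
- by move=> phi t; exact: flow_equation.
have [[-> _]|[k k0 [kE _]]] := gel_time_cases => // _.
(* Up to half the gelation time 1 / k, the bound k / (1 - t k) is at most 2 k. *)
exists ((2 * k)^-1), (2 * k); split; first by rewrite invr_gt0 mulr_gt0.
move=> t /andP[t0]; rewrite -[_^-1]mul1r ler_pdivlMr ?mulr_gt0// => tk.
have tk2 : t * k <= 2^-1 by lra.
apply: le_trans (moment2_pre_gel t0 kE _) _; first lra.
rewrite lee_fin ler_pdivrMr; last lra.
have := ler_wpM2l (ltW k0) tk2; lra.
Qed.

Definition gel_l t : R := expR (- u t).
Local Notation l := gel_l.
Local Notation M0 := (fine (moment1 mu0)).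
Local Notation g0 := (fun x => fine (genfun mu0 x)).

Lemma gel_l_pre t : 0 <= t <= Tgel -> l t = 1.
Proof. by move=> /andP[t0 tT]; rewrite /gel_l pre_gel_exp// oppr0 expR0. Qed.

Lemma gel_l_post t : Tgel < t ->
  [/\ 0 <= l t < 1, l t = expR (- (t * (M0 - g0 (l t)))) &
      forall y, 0 <= y < 1 -> y = expR (- (t * (M0 - g0 y))) -> y = l t].
Proof.
move=> Tt; have ut := post_gel_exp Tt; split.
- by rewrite /gel_l expR_ge0/= -[ltRHS]expR0 ltr_expR oppr_lt0.
- by rewrite /gel_l fine_genfun_mu0 ?(ltW ut)// fine_mass -gexpE.
move=> y /andP[_ y1] yE.
have y0 : 0 < y by rewrite yE expR_gt0.
pose w := - ln y; have w0 : 0 < w by rewrite oppr_gt0 ln_lt0// y0.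
have yw : y = expR (- w) by rewrite opprK lnK.
rewrite yw /gel_l; congr (expR (- _)); apply/esym/gexp_unique => //.
move: yE; rewrite yw fine_genfun_mu0 ?(ltW w0)// fine_mass => /expR_inj/oppr_inj e.
by rewrite /charf {1}e subrr.
Qed.

Lemma moment1_flow_l t : 0 <= t -> moment1 (flow t) = (g0 (l t))%:E.
Proof. by move=> t0; rewrite moment1_flowE// fine_genfun_mu0// gexp_ge0. Qed.

Lemma fine_moment1_flow t : 0 <= t -> fine (moment1 (flow t)) = G (u t).
Proof. by move=> t0; rewrite moment1_flowE. Qed.

Lemma mass_continuous : {within `[0, +oo[, continuous (fun t => fine (moment1 (flow t)))}.
Proof.
apply: (@subspace_eq_continuous _ _ _ (fun t => G (u t))).
  by move=> t; rewrite inE/= in_itv/= andbT => t0; rewrite /= -fine_moment1_flow.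
by apply: continuous_subspaceT; exact: gexp_mass_continuous.
Qed.

Lemma mass_pre_gel t : 0 <= t <= Tgel -> fine (moment1 (flow t)) = M0.
Proof. by move=> /andP[t0 tT]; rewrite fine_moment1_flow// pre_gel_exp// fine_mass. Qed.

Lemma mass_post_gel s t : Tgel <= s -> s < t ->
  fine (moment1 (flow t)) < fine (moment1 (flow s)).
Proof.
move=> Ts st; have s0 := le_trans gel_time_ge0 Ts.
have t0 := ltW (le_lt_trans s0 st).
have Gts : G (u t) < G (u s).
  apply: (lap0_lt (mass0_fin mu0_radon mu0_mass) mass0_neq0); first exact: gexp_ge0.
  by apply: gexp_strict => //; exact: post_gel_exp (le_lt_trans Ts st).
apply: (@le_lt_trans _ _ (G (u t))); first by rewrite (fine_moment1_flow t0).
by rewrite (fine_moment1_flow s0).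
Qed.

(** For 0 < x < 1, h_t(x) = e^{- w} where the characteristic started at w > u_t ends at t M_0 - ln
    x. The ends are separate: x = 0 has no logarithm, and x = 1 corresponds to u_t itself, which
    [gexp_surj] leaves out. *)
Lemma genfun_right_inverse : exists h : R -> R -> R, forall t x, 0 <= t -> 0 <= x <= 1 ->
  [/\ 0 <= h t x <= l t, h t x * expR (t * (M0 - g0 (h t x))) = x &
      genfun (flow t) x = (g0 (h t x))%:E].
Proof.
(* The hypotheses are moved under the existential so that [choice] applies to all pairs; the value 0
   is a default outside the domain. *)
suff H (p : R * R) : exists y, 0 <= p.1 -> 0 <= p.2 <= 1 ->
    [/\ 0 <= y <= l p.1, y * expR (p.1 * (M0 - g0 y)) = p.2 &
        genfun (flow p.1) p.2 = (g0 y)%:E].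
  by have [h hP] := choice H; exists (fun t x => h (t, x)) => t x; exact: hP (t, x).
case: p => t x /=; have [t0|] := leP 0 t; last by exists 0.
have [x0|] := leP 0 x; last by exists 0.
have [x1|] := leP x 1; last by exists 0.
have [->|xn0] := eqVneq x 0.
  by exists 0 => _ _; split; rewrite ?lexx ?expR_ge0 ?mul0r// !genfun0.
have xp : 0 < x by rewrite lt0r xn0.
have [->|xn1] := eqVneq x 1.
  exists (l t) => _ _; split; first by rewrite expR_ge0/=.
    by rewrite fine_genfun_mu0 ?gexp_ge0// fine_mass -gexpE -expRD addNr expR0.
  by rewrite genfun1 moment1_flow_l.
have v0 : 0 < - ln x by rewrite oppr_gt0 ln_lt0// xp lt_neqAle xn1.
have [w uw wE] := gexp_surj (mass0_fin mu0_radon mu0_mass) mass0_neq0 t0 v0.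
have w0 : 0 < w := le_lt_trans (gexp_ge0 _ _ _) uw.
exists (expR (- w)) => _ _; rewrite fine_genfun_mu0 ?(ltW w0)// fine_mass; split.
- by rewrite expR_ge0/= ler_expR lerN2 ltW.
- rewrite -expRD -[RHS](lnK xp) -[ln x]opprK -wE; congr expR; rewrite /charf; ring.
- rewrite -[in LHS](lnK xp) -[ln x]opprK genfun_flow// -wE.
  exact: (lap_charf t0 uw).
Qed.

End flow_properties.

(** * Large times *)

Section real_asymptotics.
Context {R : realType}.
Variables (G u : R -> R) (m0 L : R).
Local Notation M0 := (G 0).
Hypothesis m0_ge0 : 0 <= m0.
Hypothesis G_ge0 : forall w, 0 <= G w.
Hypothesis G_noninc : forall v w, 0 <= v -> v <= w -> G w <= G v.
Hypothesis G1 : G 1 < M0.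
Hypothesis u_ge0 : forall t, 0 <= u t.
Hypothesis uE : forall t, u t = t * (M0 - G (u t)).
Hypothesis u_oo : forall w, exists T, forall t, T <= t -> w < u t.

Let c := M0 - G 1.
Let c0 : 0 < c. Proof. by rewrite subr_gt0. Qed.

(** Once u_t exceeds 1, u_t = t (M_0 - G u_t) is at least t (M_0 - G 1). *)
Lemma exponent_linear : exists2 T, 0 <= T & forall t, T <= t -> t * c <= u t.
Proof.
have [T hT] := u_oo 1; exists (Num.max T 0); first by rewrite le_max lexx orbT.
move=> t; rewrite ge_max => /andP[/hT u1 t0].
by rewrite uE ler_wpM2l// lerB// G_noninc// ltW.
Qed.

(** As u_t = t M_0 - t G u_t, passing from e^{m0 u_t} to e^{m0 M_0 t} costs the factor e^{m0 t G
    u_t}. It tends to 1: for m0 > 0, G u_t decays exponentially because u_t grows linearly, and for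
    m0 = 0 the factor is 1. *)
Lemma mass_exp_cvg : (forall w, 0 <= w -> G w <= M0 * expR (- (m0 * w))) ->
  G w * expR (m0 * w) @[w --> +oo] --> L ->
  G (u t) * expR (m0 * M0 * t) @[t --> +oo] --> L.
Proof.
move=> Gm GL.
have uc : u t @[t --> +oo] --> +oo.
  apply/cvgryPge => A; have [T hT] := u_oo A.
  near=> t; apply: ltW; apply: hT; near: t; exact: nbhs_pinfty_ge (num_real _).
have GuL : G (u t) * expR (m0 * u t) @[t --> +oo] --> L by exact: cvg_comp uc GL.
have e t : G (u t) * expR (m0 * M0 * t) =
    G (u t) * expR (m0 * u t) * expR (m0 * (t * G (u t))).
  rewrite -[RHS]mulrA -expRD -mulrDr -mulrA; congr (_ * expR (_ * _)); have := uE t; lra.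
rewrite (funext e : (fun t => G (u t) * expR (m0 * M0 * t)) = _).
rewrite -[X in _ --> X]mulr1 -expR0; apply: cvgM => //.
apply: (continuous_cvg _ (@continuous_expR R _)).
have [->|m0n] := eqVneq m0 0.
  by under eq_fun do rewrite mul0r; exact: cvg_cst.
have m0p : 0 < m0 by rewrite lt0r m0n.
rewrite -[X in _ --> X](mulr0 m0); apply: cvgM; first exact: cvg_cst.
pose z := m0 * c; have z0 : 0 < z by rewrite mulr_gt0.
have M00 := G_ge0 0.
have bnd : \forall t \near +oo, 0 <= t * G (u t) <= M0 * (2 / z) * expR (- (z / 2 * t)).
  have [T T0 hT] := exponent_linear.
  near=> t; have Tt : T <= t by near: t; exact: nbhs_pinfty_ge (num_real _).
  have t0 := le_trans T0 Tt.
  rewrite mulr_ge0//=.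
  have h1 : G (u t) <= M0 * expR (- (z * t)).
    apply: le_trans (Gm _ (u_ge0 t)) _; rewrite ler_wpM2l// ler_expR lerN2 /z -mulrA.
    by rewrite ler_wpM2l// mulrC hT.
  have h2 := mulr_expRN_le t z0.
  have := ler_wpM2l t0 h1; have := ler_wpM2l M00 h2; lra.
apply: (squeeze_cvgr bnd); first exact: cvg_cst.
rewrite -[X in _ --> X](mulr0 (M0 * (2 / z))); apply: cvgM; first exact: cvg_cst.
have k0 : 0 < z / 2 by rewrite divr_gt0.
have kc : z / 2 * t @[t --> +oo] --> +oo.
  apply/cvgryPge => A; exists (A / (z / 2)); split; rewrite ?num_real// => t At /=.
  by rewrite mulrC -ler_pdivrMr// ltW.
exact: cvg_comp kc (@cvgr_expR R).
Unshelve. all: end_near. Qed.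

(** Half of eps is given up to the lower bound on G; the other half leaves the factor e^{eps u_t /
    2}, and u_t grows at least linearly. *)
Lemma mass_exp_dvg (eps b : R) : 0 < eps -> 0 < b ->
  (forall w, 0 <= w -> b * expR (- ((m0 + eps / 2) * w)) <= G w) ->
  G (u t) * expR ((m0 + eps) * M0 * t) @[t --> +oo] --> +oo.
Proof.
move=> e0 b0 Gb.
have [T T0 hT] := exponent_linear.
apply/cvgryPge => A; near=> t.
have Tt : T <= t by near: t; exact: nbhs_pinfty_ge (num_real _).
have t0 := le_trans T0 Tt.
have Mu : u t <= M0 * t.
  by rewrite mulrC uE ler_wpM2l// gerBl.
have k0 : 0 < b * (eps / 2 * c) by rewrite !mulr_gt0// ?divr_gt0.
have At : A <= b * (eps / 2 * c) * t.
  rewrite mulrC -ler_pdivrMr//; near: t; exact: nbhs_pinfty_ge (num_real _).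
apply: (le_trans At).
apply: (@le_trans _ _ (G (u t) * expR ((m0 + eps) * u t))); last first.
  rewrite ler_wpM2l// ler_expR -mulrA ler_wpM2l// addr_ge0// ltW//.
apply: (@le_trans _ _ (b * expR (- ((m0 + eps / 2) * u t)) * expR ((m0 + eps) * u t))); last first.
  by rewrite ler_wpM2r ?expR_ge0// Gb.
rewrite -!mulrA -expRD ler_wpM2l ?(ltW b0)//.
have -> : - ((m0 + eps / 2) * u t) + (m0 + eps) * u t = eps / 2 * u t by field.
have h := hT t Tt; have e2 : 0 <= eps / 2 by rewrite divr_ge0// ltW.
have h2 : eps / 2 * (t * c) <= eps / 2 * u t by rewrite ler_wpM2l.
apply: le_trans (expR_ge1Dx _); lra.
Unshelve. all: end_near. Qed.

End real_asymptotics.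

(** * The bottom of the support and the decay of the Laplace transform *)

Section support.
Context {R : realType}.
Local Notation mR := (measurableTypeR R).
Variable mu0 : borel_measure R.
Hypothesis mu0_radon : radon_pos mu0.
Hypothesis mu0_neq0 : mu0 `]0, +oo[%classic <> 0%E.
Hypothesis mu0_mass : (moment1 mu0 < +oo)%E.
Local Notation b0 := (mass0 mu0_radon mu0_mass).
Local Notation G := (lap0 b0).
Local Notation m0 := (inf_supp mu0).

(* Lindelof: the intervals with rational endpoints form a countable basis. *)
Lemma locally_null (D : set mR) : measurable D ->
  (forall x, D x -> exists U : set R, [/\ open U, U x & mu0 U = 0%E]) -> mu0 D = 0%E.
Proof.
move=> mD hD.
pose J (p : rat * rat) : set mR := `](ratr p.1 : R), (ratr p.2 : R)[%classic.
pose F (n : nat) : set mR := if unpickle n is Some p then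
  (if mu0 (J p) == 0%E then J p else set0) else set0.
have nF n : mu0.-negligible (F n).
  rewrite /F; case: (unpickle n) => [p|]; last exact: negligible_set0.
  case: ifPn => [/eqP h|_]; last exact: negligible_set0.
  by apply/negligibleP => //; exact: measurable_itv.
apply: measure_negligible => //; apply: negligibleS (negligible_bigcup nF).
move=> x /hD[U [oU Ux U0]].
have /nbhs_ballP[e /= e0 eU] : nbhs x U by exact: open_nbhs_nbhs.
have xe : x - e < x by rewrite ltrBlDr ltrDl.
have xe' : x < x + e by rewrite ltrDl.
have [q1] := rat_in_itvoo xe; rewrite in_itv/= => /andP[q11 q12].
have [q2] := rat_in_itvoo xe'; rewrite in_itv/= => /andP[q21 q22].
exists (pickle (q1, q2)); first exact: I.
rewrite /F pickleK.
have -> : mu0 (J (q1, q2)) == 0%E.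
  rewrite eq_le measure_ge0 andbT -[leRHS]U0; apply: le_measure.
  - by rewrite inE; exact: measurable_itv.
  - by rewrite inE; exact: open_measurable.
  move=> y; rewrite /J/= in_itv/= => /andP[y1 y2]; apply: eU.
  by rewrite /ball/= ltr_norml; apply/andP; split; lra.
by rewrite /J/= in_itv/= q12.
Qed.

Lemma not_supp x : 0 < x -> ~ supp_pos mu0 x ->
  exists U : set R, [/\ open U, U x & mu0 U = 0%E].
Proof.
move=> x0 nx; apply: contrapT => h; apply: nx; split => // U oU Ux.
rewrite lt0e measure_ge0 andbT; apply/eqP => U0; apply: h; by exists U.
Qed.

Lemma supp_neq0 : supp_pos mu0 !=set0.
Proof.
apply/set0P/eqP => s0; apply: mu0_neq0; apply: locally_null; first exact: measurable_itv.
move=> x; rewrite /= in_itv/= andbT => x0; apply: not_supp => //.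
by rewrite s0.
Qed.

Lemma has_inf_supp : has_inf (supp_pos mu0).
Proof. by split; [exact: supp_neq0|exists 0 => x [/ltW]]. Qed.

Lemma inf_supp_ge0 : 0 <= m0.
Proof. by apply: lb_le_inf; [exact: supp_neq0|move=> x [/ltW]]. Qed.

Lemma mu0_below_supp : mu0 `]0, m0[%classic = 0%E.
Proof.
apply: locally_null; first exact: measurable_itv.
move=> x; rewrite /= in_itv/= => /andP[x0 xm]; apply: not_supp => // sx.
by move: xm; rewrite ltNge => /negP; apply; apply: ge_inf => //; exact: has_inf_supp.2.
Qed.

Section mass_bounds.
Variable A : set mR.
Hypothesis mA : measurable A.

Let mi : measurable_fun setT (\1_A : mR -> R). Proof. exact: measurable_indic. Qed.

Let b0E : (b0 A = pairing mu0 (fun m => m * \1_A m)%R)%E.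
Proof.
by rewrite -(integral_mass0 mu0_radon mu0_mass mi) integral_indic// setIT.
Qed.

Let mu0E (a : R) : 0 <= a -> (a%:E * mu0 A = pairing mu0 (fun m => a * \1_A m)%R)%E.
Proof.
move=> a0; rewrite pairingE; [|exact: mu0_radon.1|exact: measurable_funM].
under eq_integral do rewrite EFinM.
rewrite ge0_integralZl ?lee_fin//; last exact/measurable_EFinP.
by rewrite integral_indic// setIT.
Qed.

Lemma mass0_ge (a : R) : 0 <= a -> (forall m, A m -> a <= m) -> (a%:E * mu0 A <= b0 A)%E.
Proof.
move=> a0 Aa; rewrite mu0E// b0E; apply: le_pairing; try exact: measurable_funM.
move=> m mp; rewrite mulr_ge0//= indicE; have [|_] := boolP (m \in A); last by rewrite !mulr0.
by rewrite inE => /Aa h; rewrite ler_wpM2r.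
Qed.

Lemma mass0_le (a : R) : 0 <= a -> (forall m, A m -> m <= a) -> (b0 A <= a%:E * mu0 A)%E.
Proof.
move=> a0 Aa; rewrite mu0E// b0E; apply: le_pairing; try exact: measurable_funM.
move=> m mp; rewrite mulr_ge0 ?(ltW mp)//= indicE.
have [|_] := boolP (m \in A); last by rewrite !mulr0.
by rewrite inE => /Aa h; rewrite ler_wpM2r.
Qed.

End mass_bounds.

(** Some support point x lies below m0 + e, so an open interval around x has positive measure. Its
    lower end x / 2 keeps it away from 0, where the weight m would degenerate. *)
Lemma mass0_itv_gt0 (e : R) : 0 < e -> exists2 b : R, 0 < b &
  forall w, 0 <= w -> b * expR (- ((m0 + e) * w)) <= G w.
Proof.
move=> e0; have [x [x0 sx] xe] := inf_adherent e0 has_inf_supp.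
pose U : set mR := `]x / 2, m0 + e[%classic.
have mU : measurable U by exact: measurable_itv.
have U0 : (0 < mu0 U)%E.
  apply: sx; first exact: interval_open.
  by rewrite /U/= in_itv/= xe andbT; lra.
have ixU : (\int[b0]_m (\1_U m)%:E = b0 U)%E by rewrite integral_indic// setIT.
have bUE : ((x / 2)%:E * mu0 U <= b0 U)%E.
  apply: mass0_ge => //; first by rewrite divr_ge0// ltW.
  by move=> m; rewrite /U/= in_itv/= => /andP[/ltW].
have bUfin : b0 U \is a fin_num.
  rewrite ge0_fin_numE//; apply: le_lt_trans (mass0_fin mu0_radon mu0_mass).
  by rewrite le_measure// inE.
exists (fine (b0 U)).
  rewrite -lte_fin fineK//; apply: lt_le_trans bUE; rewrite mule_gt0// lte_fin divr_gt0//.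
move=> w w0; rewrite -lee_fin EFinM fineK// -(lap0E (mass0_fin mu0_radon mu0_mass) w0).
have mi : measurable_fun setT (fun m : mR => (\1_U m)%:E : \bar R).
  by apply/measurable_EFinP; exact: measurable_indic.
have k0 : (0 <= (expR (- ((m0 + e) * w)))%:E)%E by rewrite lee_fin expR_ge0.
rewrite -ixU -(ge0_integralZr b0 measurableT mi _ k0)//.
apply: ge0_le_integral => //.
- exact: emeasurable_funM.
- by apply/measurable_EFinP; exact: measurable_expRNM.
move=> m _; rewrite -EFinM lee_fin indicE; have [|_] := boolP (m \in U); last first.
  by rewrite mul0r expR_ge0.
rewrite inE /U/= in_itv/= => /andP[_ h]; rewrite mul1r ler_expR lerN2 [leRHS]mulrC.
by rewrite ler_wpM2l// ltW.
Qed.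

Lemma mass0_ae : {ae b0, forall m, m0 <= m}.
Proof.
have h1 : b0.-negligible (`]-oo, 0]%classic : set mR).
  by apply/negligibleP; [exact: measurable_itv|exact: tame_supp].
have mI : measurable (`]0, m0[%classic : set mR) by exact: measurable_itv.
have h2 : b0.-negligible (`]0, m0[%classic : set mR).
  apply/negligibleP => //; apply/eqP; rewrite eq_le measure_ge0 andbT.
  apply: le_trans (mass0_le mI inf_supp_ge0 _) _; last by rewrite mu0_below_supp mule0.
  by move=> m; rewrite /= in_itv/= => /andP[_ /ltW].
apply: negligibleS (negligibleU h1 h2).
move=> m /= nm; have [mn|mp] := leP m 0; [left|right]; rewrite /= in_itv//=.
by rewrite mp ltNge; apply/negP.
Qed.

Lemma mass0_point : b0 [set m0] = (m0 * fine (mu0 [set m0]))%:E.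
Proof.
have fin : mu0 [set m0] \is a fin_num.
  (* If m0 = 0 the atom lies outside (0, +oo) and is null; if m0 > 0 it is a compact subset of (0,
     +oo). *)
  rewrite ge0_fin_numE//; have := inf_supp_ge0; rewrite le_eqVlt => /predU1P[e|mp].
    apply: (@le_lt_trans _ _ (mu0 `]-oo, 0]%classic)); last by rewrite mu0_radon.1 ltry.
    apply: le_measure; [by rewrite inE|by rewrite inE; exact: measurable_itv|].
    by move=> _ ->; rewrite /= in_itv/= -e lexx.
  apply: mu0_radon.2; first exact: compact_set1.
  by move=> _ ->; rewrite /= in_itv/= mp.
rewrite EFinM fineK//; apply/eqP; rewrite eq_le.
by rewrite mass0_ge ?mass0_le ?inf_supp_ge0// => _ ->.
Qed.

(** Almost every m is at least m0. The absolute value makes the integrand bounded by 1 and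
    decreasing in w at every m. *)
Lemma lap0_shift w : 0 <= w -> (G w * expR (m0 * w))%:E =
  (\int[b0]_m (expR (- (w * `|m - m0|)))%:E)%E.
Proof.
move=> w0; rewrite EFinM -(lap0E (mass0_fin mu0_radon mu0_mass) w0).
have mE : measurable_fun setT (fun m : mR => (expR (- (w * m)))%:E : \bar R).
  by apply/measurable_EFinP; exact: measurable_expRNM.
have k0 : (0 <= (expR (m0 * w))%:E)%E by rewrite lee_fin expR_ge0.
rewrite -(ge0_integralZr b0 measurableT mE _ k0)//.
apply: ae_eq_integral => //.
- exact: emeasurable_funM.
- apply/measurable_EFinP; apply: (measurableT_comp (measurable_expRNM w)).
  by apply: measurableT_comp => //; exact: measurable_funB.
have [N [mN N0 hN]] := mass0_ae; exists N; split => // m nm; apply: hN => /= mm; apply: nm => _.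
rewrite -EFinM -expRD ger0_norm ?subr_ge0//.
by congr (EFin (expR _)); ring.
Qed.

(** Along the integers the integrand tends to the indicator of {m0}, dominated by 1; monotonicity in
    w extends the limit to real w. *)
Lemma lap0_shift_cvg : G w * expR (m0 * w) @[w --> +oo] --> m0 * fine (mu0 [set m0]).
Proof.
pose F (w : R) := G w * expR (m0 * w).
have mE w : measurable_fun setT (fun m : mR => (expR (- (w * `|m - m0|)))%:E : \bar R).
  apply/measurable_EFinP; apply: (measurableT_comp (measurable_expRNM w)).
  by apply: measurableT_comp => //; exact: measurable_funB.
have Fni v w : 0 <= v -> v <= w -> F w <= F v.
  move=> v0 vw; rewrite -lee_fin !lap0_shift ?(le_trans v0 vw)//.
  apply: ge0_le_integral => //; try by move=> m _; rewrite lee_fin expR_ge0.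
  by move=> m _; rewrite lee_fin ler_expR lerN2 ler_wpM2r.
have LE : (\int[b0]_m (\1_[set m0] m)%:E = (m0 * fine (mu0 [set m0]))%:E)%E.
  by rewrite integral_indic// setIT; exact: mass0_point.
have FL w : 0 <= w -> m0 * fine (mu0 [set m0]) <= F w.
  move=> w0; rewrite -lee_fin lap0_shift// -LE; apply: ge0_le_integral => //.
  - by apply/measurable_EFinP; exact: measurable_indic.
  move=> m _; rewrite lee_fin indicE; have [|_] := boolP (m \in _); last exact: expR_ge0.
  by rewrite inE => ->; rewrite subrr normr0 mulr0 oppr0 expR0.
have Fn : F n%:R @[n --> \oo] --> m0 * fine (mu0 [set m0]).
  suff : (F n%:R)%:E @[n --> \oo] --> (m0 * fine (mu0 [set m0]))%:E by move/fine_cvgP => [].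
  under eq_fun do rewrite lap0_shift//.
  rewrite -LE.
  have := @dominated_convergence _ mR R b0 setT measurableT
    (fun n m => (expR (- (n%:R * `|m - m0|)))%:E) (fun m => (\1_[set m0] m)%:E) (cst 1%E)
    (fun n => mE n%:R).
  case=> //.
  - by apply/measurable_EFinP; exact: measurable_indic.
  - apply: aeW => m _; apply: cvg_EFin; first exact: nearW.
    rewrite indicE; have [|] := boolP (m \in _).
      rewrite inE => ->; rewrite subrr normr0.
      by under eq_fun do rewrite /= mulr0 oppr0 expR0; exact: cvg_cst.
    rewrite notin_setE/= => /eqP mn; have d0 : 0 < `|m - m0| by rewrite normr_gt0 subr_eq0.
    have kc : n%:R * `|m - m0| @[n --> \oo] --> +oo.
      apply/cvgryPge => A; near=> n; rewrite -ler_pdivrMr//.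
      by near: n; exact: nbhs_infty_ger.
    exact: cvg_comp kc (@cvgr_expR R).
  - apply/integrableP; split => //; under eq_integral do rewrite abse1.
    by rewrite integral_cst// mul1e; exact: mass0_fin.
  - apply: aeW => m n _; rewrite gee0_abs; last by rewrite lee_fin expR_ge0.
    by rewrite /cst lee_fin.
apply/cvgrPdist_lt => e e0.
have /cvgrPdist_lt/(_ _ e0)[N _ /(_ N (leqnn N)) hN] := Fn.
near=> w; have Nw : N%:R <= w by near: w; exact: nbhs_pinfty_ge (num_real _).
have w0 : 0 <= w by exact: le_trans Nw.
apply: le_lt_trans hN; rewrite !ler0_norm ?subr_le0 ?FL// lerN2 lerB// Fni//.
Unshelve. all: end_near. Qed.

Lemma lap0_exp_bound w : 0 <= w -> G w <= G 0 * expR (- (m0 * w)).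
Proof.
move=> w0; rewrite expRN ler_pdivlMr ?expR_gt0// -lee_fin lap0_shift//.
rewrite -(lap0E (mass0_fin mu0_radon mu0_mass) (lexx 0)).
apply: ge0_le_integral => //.
- apply/measurable_EFinP; apply: (measurableT_comp (measurable_expRNM w)).
  by apply: measurableT_comp => //; exact: measurable_funB.
- by apply/measurable_EFinP; exact: measurable_expRNM.
- by move=> m _; rewrite lee_fin ler_expR mul0r lerN2 mulr_ge0.
Qed.

Local Notation flow := (flow mu0_radon mu0_mass).
Local Notation u := (gexp (mass0_fin mu0_radon mu0_mass)
  (@mass0_neq0 R mu0 mu0_radon mu0_neq0 mu0_mass)).

Lemma gexp_oo w : exists T, forall t, T <= t -> w < u t.
Proof.
suff H v : 0 < v -> exists T, forall t, T <= t -> v < u t.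
  have [|T hT] := H (Num.max w 1); first by rewrite lt_max ltr01 orbT.
  by exists T => t /hT; rewrite gt_max => /andP[].
move=> v0; have g0 : 0 < G 0 - G v := lap0_gap (mass0_fin mu0_radon mu0_mass)
  (@mass0_neq0 R mu0 mu0_radon mu0_neq0 mu0_mass) v0.
exists (v / (G 0 - G v) + 1) => t Tt; rewrite gexp_gt// /charf subr_lt0.
rewrite -ltr_pdivrMr//; apply: lt_le_trans Tt; by rewrite ltrDl.
Qed.

Let Gni v w : 0 <= v -> v <= w -> G w <= G v.
Proof. by move=> v0 vw; apply: le_lap0 => //; exact: mass0_fin. Qed.

Let G1 : G 1 < G 0.
Proof. exact: (lap0_lt (mass0_fin _ _) (@mass0_neq0 R mu0 mu0_radon mu0_neq0 mu0_mass) (lexx 0) ltr01). Qed.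

Lemma flow_mass_asymptotics :
  fine (moment1 (flow t)) * expR (m0 * fine (moment1 mu0) * t) @[t --> +oo]
    --> m0 * fine (mu0 [set m0]).
Proof.
have h := mass_exp_cvg inf_supp_ge0 (lap0_ge0 b0) Gni G1 (gexp_ge0 _ _) (gexpE _ _)
  gexp_oo lap0_exp_bound lap0_shift_cvg.
apply: cvg_trans h; apply: near_eq_cvg; near=> t.
rewrite (fine_mass mu0_radon mu0_mass) (fine_moment1_flow mu0_radon mu0_neq0 mu0_mass)//.
Unshelve. all: end_near. Qed.

Lemma flow_mass_lower (eps : R) : 0 < eps ->
  fine (moment1 (flow t)) * expR ((m0 + eps) * fine (moment1 mu0) * t) @[t --> +oo] --> +oo.
Proof.
move=> e0; have e2 : 0 < eps / 2 by rewrite divr_gt0.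
have [b bp hb] := mass0_itv_gt0 e2.
have h := mass_exp_dvg inf_supp_ge0 (lap0_ge0 b0) Gni G1 (gexp_ge0 _ _) (gexpE _ _)
  gexp_oo e0 bp hb.
apply: cvg_trans h; apply: near_eq_cvg; near=> t.
rewrite (fine_mass mu0_radon mu0_mass) (fine_moment1_flow mu0_radon mu0_neq0 mu0_mass)//.
Unshelve. all: end_near. Qed.

End support.

(** * Analyticity *)

(** [g] dominates the series of absolute values at radius r, hence all partial sums for |h| <= r,
    and each coefficient up to the factor r^-i. *)
Lemma cvg_integral_pseries d (T : measurableType d) (R : realType)
    (mu : {measure set T -> \bar R}) (q : nat -> T -> R) (f g : T -> R) (r h : R) :
  (forall i, measurable_fun setT (q i)) -> measurable_fun setT f ->
  mu.-integrable setT (EFin \o g) -> 0 < r -> `|h| <= r ->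
  (forall n x, \sum_(i < n) `|q i x| * r ^+ i <= g x) ->
  (forall x, pseries (q^~ x) h @ \oo --> f x) ->
  pseries (fun i => fine (\int[mu]_x (q i x)%:E)%E) h @ \oo --> fine (\int[mu]_x (f x)%:E)%E.
Proof.
move=> mq mf ig r0 hr qg qf.
have g0 x : 0 <= g x by have := qg 0%N x; rewrite big_ord0.
have qr i x : `|q i x| * r ^+ i <= g x.
  apply: le_trans (qg i.+1 x); rewrite big_ord_recr/= lerDr.
  by apply: sumr_ge0 => j _; rewrite mulr_ge0// exprn_ge0// ltW.
have iq i : mu.-integrable setT (EFin \o q i).
  have igr : mu.-integrable setT (fun x => ((r ^- i) * g x)%:E).
    by under [X in integrable _ _ X]eq_fun do rewrite EFinM; exact: integrableZl.
  apply: le_integrable igr => //; first exact/measurable_EFinP.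
  move=> x _ /=; rewrite lee_fin [leRHS]ger0_norm; last first.
    by rewrite mulr_ge0// invr_ge0 exprn_ge0// ltW.
  by rewrite mulrC ler_pdivlMr ?exprn_gt0.
have iqh i : mu.-integrable setT (fun x => (q i x * h ^+ i)%:E).
  exact: (integrableZr measurableT (h ^+ i) (iq i)).
have mS n : measurable_fun setT (fun x => pseries (q^~ x) h n).
  rewrite /pseries /series/=; apply: measurable_sum => i.
  exact: measurable_funM.
have SE n : (\int[mu]_x (pseries (q^~ x) h n)%:E)%E =
    (pseries (fun i => fine (\int[mu]_x (q i x)%:E)%E) h n)%:E.
  rewrite /pseries /series/=.
  under eq_integral do rewrite -sumEFin.
  rewrite integral_sum// -sumEFin; apply: eq_bigr => i _.
  under eq_integral do rewrite EFinM.
  rewrite (integralZr measurableT (iq i)) EFinM fineK//.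
  by apply: integrable_fin_num; [exact: measurableT|exact: iq].
have Sg n x : `|pseries (q^~ x) h n| <= g x.
  apply: le_trans (qg n x); rewrite /pseries /series/= big_mkord.
  apply: le_trans (ler_norm_sum _ _ _) _; apply: ler_sum => i _.
  by rewrite normrM ler_wpM2l// normrX lerXn2r ?nnegrE// ltW.
have [iF _ cv] : [/\ mu.-integrable setT (EFin \o f),
    (fun n => \int[mu]_x `|(pseries (q^~ x) h n)%:E - (f x)%:E|)%E @ \oo --> 0%E &
    (fun n => \int[mu]_x (pseries (q^~ x) h n)%:E)%E @ \oo --> (\int[mu]_x (f x)%:E)%E].
  apply: (dominated_convergence measurableT (g := EFin \o g)) => //.
  - by move=> n; apply/measurable_EFinP; exact: mS.
  - exact/measurable_EFinP.
  - by apply: aeW => x _; apply: cvg_EFin; [exact: nearW|exact: qf].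
  - by apply: aeW => x n _; rewrite lee_fin; exact: Sg.
have fin : (\int[mu]_x (f x)%:E)%E \is a fin_num by exact: integrable_fin_num.
suff : (pseries (fun i => fine (\int[mu]_x (q i x)%:E)%E) h n)%:E @[n --> \oo]
    --> (fine (\int[mu]_x (f x)%:E)%E)%:E by move/fine_cvgP => [].
rewrite fineK//; under eq_fun do rewrite -SE; exact: cv.
Qed.

Section taylor_coefficients.
Context {R : realType}.

(* Taylor coefficients at s = t0 of the function s |-> s ^+ k * expR (- (b * (s - t0))). *)
Fixpoint pexp_coef (t0 b : R) (k n : nat) : R :=
  match k with
  | 0 => (- b) ^+ n / n`!%:R
  | k'.+1 => t0 * pexp_coef t0 b k' n +
      (if n is n'.+1 then pexp_coef t0 b k' n' else 0)
  end.

Variables (t0 b : R).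

Lemma pexp_coef_cvg k h :
  pseries (pexp_coef t0 b k) h @ \oo --> (t0 + h) ^+ k * expR (- (b * h)).
Proof.
elim: k => [|k IH].
  rewrite expr0 mul1r (_ : pseries _ h = series (exp_coeff (- (b * h)))).
    exact: is_cvg_series_exp_coeff.
  apply/funext => n; rewrite /pseries /series/=; apply: eq_bigr => i _.
  by rewrite /exp_coeff/= -mulNr exprMn; ring.
rewrite -cvg_shiftS.
have e n : pseries (pexp_coef t0 b k.+1) h n.+1 =
    t0 * pseries (pexp_coef t0 b k) h n.+1 + h * pseries (pexp_coef t0 b k) h n.
  rewrite /pseries /series/= !big_mkord.
  under eq_bigr do rewrite mulrDl -mulrA.
  rewrite big_split/= -mulr_sumr; congr (_ + _).
  rewrite big_ord_recl/= mul0r add0r mulr_sumr; apply: eq_bigr => i _.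
  by rewrite /bump/= exprS mulrCA.
rewrite (funext e : (fun n => pseries (pexp_coef t0 b k.+1) h n.+1) = _).
rewrite exprS -mulrA mulrDl; apply: cvgD.
  by apply: cvgM; [exact: cvg_cst|rewrite cvg_shiftS].
by apply: cvgM; [exact: cvg_cst|].
Qed.

(** Taking absolute values of the coefficients amounts to reversing the sign of [b], whence a
    majorant at t0 + r with a growing exponential. *)
Lemma pexp_coef_abs k n r : 0 <= t0 -> 0 <= b -> 0 <= r ->
  \sum_(i < n) `|pexp_coef t0 b k i| * r ^+ i <= (t0 + r) ^+ k * expR (b * r).
Proof.
move=> t00 b00 r0; elim: k n => [|k IH] n.
  rewrite expr0 mul1r; have br : 0 <= b * r by rewrite mulr_ge0.
  have h : {homo series (exp_coeff (b * r)) : i j / (i <= j)%N >-> i <= j}.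
    apply/nondecreasing_seqP => i; rewrite seriesSr lerDl exp_coeff_ge0//.
  apply: le_trans (nondecreasing_cvgn_le h (is_cvg_series_exp_coeff _) n).
  rewrite /series/= big_mkord; apply: ler_sum => i _.
  rewrite normrM normfV normrX normrN (ger0_norm b00) (ger0_norm (ler0n _ _)).
  by rewrite /exp_coeff/= exprMn mulrAC.
have tr : 0 <= t0 + r by rewrite addr_ge0.
have pos i : 0 <= `|pexp_coef t0 b k i| * r ^+ i by rewrite mulr_ge0// exprn_ge0.
apply: (@le_trans _ _ (t0 * (\sum_(i < n) `|pexp_coef t0 b k i| * r ^+ i) +
   r * (\sum_(i < n) `|pexp_coef t0 b k i| * r ^+ i))).
  apply: (@le_trans _ _ (\sum_(i < n) (t0 * (`|pexp_coef t0 b k i| * r ^+ i) +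
      (if (i : nat) is j.+1 then `|pexp_coef t0 b k j| else 0) * r ^+ i))).
    apply: ler_sum => i _; rewrite mulrA -mulrDl ler_wpM2r ?exprn_ge0//=.
    apply: le_trans (ler_normD _ _) _; rewrite normrM (ger0_norm t00) lerD2l.
    by case: (i : nat) => // ; rewrite normr0.
  rewrite big_split/= -mulr_sumr lerD2l mulr_sumr.
  case: n => [|n]; first by rewrite !big_ord0.
  rewrite big_ord_recl/= mul0r add0r [leRHS]big_ord_recr/=.
  apply: (@le_trans _ _ (\sum_(i < n) r * (`|pexp_coef t0 b k i| * r ^+ i))).
    by apply: ler_sum => i _; rewrite /bump/= exprS mulrCA.
  by rewrite lerDl mulr_ge0.
by rewrite -mulrDl exprS -mulrA ler_wpM2l.
Qed.

End taylor_coefficients.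

(** * Analyticity of the mass beyond the gelation time *)

Section analyticity.
Context {R : realType}.
Local Notation mR := (measurableTypeR R).
Local Notation X := (nat * mR)%type.
Variable b0 : tame (R := R).
Hypothesis b0fin : (b0 setT < +oo)%E.
Hypothesis b0pos : b0 setT <> 0%E.
Local Notation Pi := (pos_nat b0).
Local Notation G := (lap0 b0).
Local Notation u := (gexp b0fin b0pos).

(** The characteristic started at some w in ]0, u_t[ ends strictly below t M_0, and the series
    converges there by [lap_le]. This leaves room to increase the power and decrease the exponent at
    once. *)
Lemma lap_beyond_gel t : 0 <= t -> 0 < u t ->
  exists2 r, 0 < r & (lap b0 (t + r) ((t - r) * G 0) < +oo)%E.
Proof.
move=> t0 ut; pose w := u t / 2; have w0 : 0 < w by rewrite divr_gt0.
have wu : w < u t by rewrite /w; lra.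
move: wu; rewrite gexp_gt// => cw.
have g0 := lap0_ge0 b0 0; have gw := lap0_ge0 b0 w.
have s0 : 0 < G w + G 0 + 1 by lra.
(* Chosen so that w + (t + r) G w = (t - r) M_0 - r; the summand 1 keeps the denominator
   positive. *)
pose r := - charf G t w / (G w + G 0 + 1).
have r0 : 0 < r by rewrite divr_gt0// oppr_gt0.
have rE : r * (G w + G 0 + 1) = - charf G t w by rewrite /r divfK// gt_eqF.
exists r => //; have tr : 0 <= t + r by lra.
apply: (@le_lt_trans _ _ (G w)%:E); last by rewrite ltry.
apply: le_trans (lap_le b0fin tr w0); apply: le_lap => //.
by move: rE; rewrite /charf; lra.
Qed.

(** Expanding s^k e^{- s M_0 m} around t, the absolute series at radius r is at most (t + r)^k e^{-
    (t - r) M_0 m}, which [lap_beyond_gel] makes integrable. *)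
Lemma lap_analytic t : 0 <= t -> 0 < u t ->
  exists2 r, 0 < r & exists a : nat -> R, forall h, `|h| <= r ->
    pseries a h @ \oo --> fine (lap b0 (t + h) ((t + h) * G 0)).
Proof.
move=> t0 ut; have [r r0 rfin] := lap_beyond_gel t0 ut; exists r => //.
have M00 : 0 <= G 0 := lap0_ge0 b0 0; move: (G 0) M00 rfin => M0 M00 rfin.
pose q i (x : X) := expR (- (t * M0 * `|x.2|)) * pexp_coef t (M0 * `|x.2|) x.1 i.
exists (fun i => fine (\int[Pi]_x (q i x)%:E)%E) => h hr.
pose g (x : X) := (t + r) ^+ x.1 * expR (- ((t - r) * M0 * `|x.2|)).
have mE (z : R) : measurable_fun setT (fun x : X => expR (- (z * `|x.2|))).
  by apply: (measurableT_comp (measurable_expRNM z)); exact: measurable_abs_snd.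
have mlap s z : measurable_fun setT (fun x : X => s ^+ x.1 * expR (- (z * `|x.2|))).
  by apply: measurable_funM => //; exact: (measurable_nat_fst (fun k => s ^+ k)).
have mpe i : measurable_fun setT (fun x : X => pexp_coef t (M0 * `|x.2|) x.1 i).
  apply: measurable_fun_natprod => k /=; elim: k i => [|k IH] i /=.
    apply: measurable_funM => //; apply: measurable_funX; apply: measurable_funN.
    exact: measurable_funM.
  apply: measurable_funD; first by apply: measurable_funM => //; exact: IH.
  by case: i => [|i]; [exact: measurable_cst|exact: IH].
have mq i : measurable_fun setT (q i) by exact: measurable_funM.
have ig : Pi.-integrable setT (EFin \o g).
  apply/integrableP; split; first by apply/measurable_EFinP; exact: mlap.
  apply: le_lt_trans rfin; rewrite lap_absE; apply: ge0_le_integral => //.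
  - apply: measurableT_comp => //; apply/measurable_EFinP; exact: mlap.
  - by apply/measurable_EFinP; exact: mlap.
  - move=> x _; rewrite /= lee_fin ger0_norm// mulr_ge0 ?expR_ge0// exprn_ge0//.
    by rewrite addr_ge0// ltW.
rewrite lap_absE.
apply: (cvg_integral_pseries (g := g) (r := r)) => //.
- move=> n x; rewrite /q /g.
  have k := @pexp_coef_abs R t (M0 * `|x.2|) x.1 n r t0 (mulr_ge0 M00 (normr_ge0 _)) (ltW r0).
  under eq_bigr => i _ do rewrite normrM (ger0_norm (expR_ge0 _)) -[_ * _ * r ^+ i]mulrA.
  rewrite -mulr_sumr; apply: le_trans (ler_wpM2l (expR_ge0 _) k) _.
  rewrite mulrCA -expRD le_eqVlt; apply/orP; left; apply/eqP; congr (_ * expR _); ring.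
move=> x; have k := @pexp_coef_cvg R t (M0 * `|x.2|) x.1 h.
have -> : pseries (q^~ x) h =
    (fun n => expR (- (t * M0 * `|x.2|)) * pseries (pexp_coef t (M0 * `|x.2|) x.1) h n).
  apply/funext => n; rewrite /pseries /series/= mulr_sumr; apply: eq_bigr => i _.
  by rewrite /q mulrA.
have -> : (t + h) ^+ x.1 * expR (- ((t + h) * M0 * `|x.2|)) =
    expR (- (t * M0 * `|x.2|)) * ((t + h) ^+ x.1 * expR (- (M0 * `|x.2| * h))).
  rewrite mulrCA -expRD; congr (_ * expR _); ring.
by apply: cvgM; [exact: cvg_cst|].
Qed.

End analyticity.

Section flow_analytic.
Context {R : realType}.
Variable mu0 : borel_measure R.
Hypothesis mu0_radon : radon_pos mu0.
Hypothesis mu0_neq0 : mu0 `]0, +oo[%classic <> 0%E.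
Hypothesis mu0_mass : (moment1 mu0 < +oo)%E.
Local Notation flow := (flow mu0_radon mu0_mass).
Local Notation Tgel := (gel_time mu0).

Lemma flow_mass_analytic :
  analytic_on [set t | 0 <= t /\ t <> Tgel] (fun t => fine (moment1 (flow t))).
Proof.
move=> t /= [t0 /eqP]; rewrite neq_lt => /orP[tT|Tt].
  exists (Tgel - t); split; first by rewrite subr_gt0.
  exists (fun n => if n is 0 then fine (moment1 mu0) else 0) => s [s0 _] st.
  have sT : s <= Tgel by move: st; rewrite ltr_norml => /andP[_]; lra.
  rewrite (mass_pre_gel mu0_radon mu0_neq0 mu0_mass)//; last by rewrite s0.
  rewrite -cvg_shiftS; apply: cvg_near_cst; apply: nearW => n.
  rewrite /pseries /series/= big_mkord big_ord_recl/= expr0 mulr1 big1 ?addr0//.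
  by move=> i _; rewrite mul0r.
have ut := post_gel_exp mu0_radon mu0_neq0 mu0_mass Tt.
have [r r0 [a ha]] := lap_analytic t0 ut.
exists r; split => //; exists a => s [s0 _] st.
have := ha _ (ltW st); rewrite subrKC moment1_flow//.
Qed.

End flow_analytic.

(** * Uniqueness *)

Section test_classes.
Context {R : realType}.
Local Notation mR := (measurableTypeR R).
Variable b : R.
Hypothesis b_gt0 : 0 < b.

(* The test functions are written m |-> m * psi m with psi of one of the two
   classes below; the second one need not vanish near 0. *)
Definition ctest (psi : R -> R) : Prop :=
  [/\ continuous psi, forall m, `|psi m| <= 1,
      exists2 a, 0 < a & forall m, m <= a -> psi m = 0 &
      forall m, b <= m -> psi m = 0].

Definition xtest (psi : R -> R) : Prop :=
  [/\ forall m, 0 < m -> {for m, continuous psi}, forall m, `|psi m| <= 1,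
      forall m, m <= 0 -> psi m = 0 & forall m, b <= m -> psi m = 0].

(** Piecewise linear: 0 up to 1 / (n + 1), and 1 from 2 / (n + 1) on. *)
Definition cutoff (n : nat) (m : R) : R := Num.min 1 (Num.max 0 (n.+1%:R * m - 1)).

Lemma cutoff_continuous n : continuous (cutoff n).
Proof.
apply: (@min_fun_continuous _ _ R (cst 1)); first exact: cst_continuous.
apply: (@max_fun_continuous _ _ R (cst 0)); first exact: cst_continuous.
move=> m; apply: cvgB; last exact: cvg_cst.
by apply: cvgM; [exact: cvg_cst|exact: cvg_id].
Qed.

Lemma cutoff_itv n m : 0 <= cutoff n m <= 1.
Proof. by rewrite /cutoff le_min ge_min !le_max ler01 !lexx. Qed.

Lemma cutoff0 n m : m <= n.+1%:R^-1 -> cutoff n m = 0.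
Proof.
move=> h; have : n.+1%:R * m <= 1 by rewrite mulrC -ler_pdivlMr// div1r.
by rewrite /cutoff -subr_le0 => h2; rewrite max_l// min_r.
Qed.

Lemma cutoff_cvg m : 0 < m -> cutoff n m @[n --> \oo] --> (1 : R).
Proof.
move=> m0; apply: cvg_near_cst.
exists (Num.truncn (2 / m)) => // n /= mn.
rewrite /cutoff min_l// le_max; apply/orP; right.
have : 2 / m < n.+1%:R by apply: lt_le_trans (truncnS_gt _) _; rewrite ler_nat.
rewrite ltr_pdivrMr//; lra.
Qed.

Lemma xtest_measurable psi : xtest psi -> measurable_fun setT (psi : mR -> mR).
Proof.
move=> [cpsi _ z _].
have mI : measurable (`]0, +oo[%classic : set mR) by exact: measurable_itv.
rewrite (_ : psi = psi \_ (`]0, +oo[%classic : set mR)); last first.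
  apply/funext => m; rewrite patchE; case: ifPn => //.
  by rewrite notin_setE/= in_itv/= andbT => /negP; rewrite -leNgt => /z.
apply/(measurable_restrictT _ mI); apply: open_continuous_measurable_fun.
  exact: interval_open.
by move=> m; rewrite inE/= in_itv/= andbT => /cpsi.
Qed.

Lemma xtest_cutoff psi n : xtest psi -> ctest (fun m => psi m * cutoff n m).
Proof.
move=> [c h z z']; have n0 : 0 < (n.+1%:R^-1 : R) by rewrite invr_gt0.
split.
- move=> m; have [m0|m0] := ltP 0 m.
    by apply: cvgM; [exact: c|exact: cutoff_continuous].
  rewrite /continuous_at z// mul0r; apply: cvg_near_cst.
  near=> x; rewrite cutoff0 ?mulr0//; apply: ltW; near: x.
  exact: lt_nbhsl (le_lt_trans m0 n0).
- move=> m; rewrite normrM -[leRHS]mulr1; have /andP[k0 k1] := cutoff_itv n m.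
  by apply: ler_pM => //; rewrite ger0_norm.
- by exists n.+1%:R^-1 => // m mn; rewrite cutoff0// mulr0.
- by move=> m mb; rewrite z'// mul0r.
Unshelve. all: end_near. Qed.

Lemma ctest_mulX psi : ctest psi -> continuous (fun m : R => m * psi m) /\
  forall m, `|m * psi m| <= b.
Proof.
move=> [c h [a a0 z] z']; split.
  by move=> m; apply: cvgM; [exact: cvg_id|exact: c].
move=> m; have [mb|bm] := ltP m b; last by rewrite z'// mulr0 normr0 ltW.
have [ma|am] := leP m a; first by rewrite z// mulr0 normr0 ltW.
rewrite normrM -[leRHS]mulr1; apply: ler_pM => //.
by rewrite gtr0_norm ?(lt_trans a0)// ltW.
Qed.

Lemma ctest_Cc psi : ctest psi -> Cc_pos (fun m : R => m * psi m).
Proof.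
move=> h; have [c _] := ctest_mulX h; split; first by move=> m _; exact: c.
have [_ _ [a a0 z] z'] := h.
exists `[a, b]%classic; split; first exact: segment_compact.
  by move=> m; rewrite /= !in_itv/= andbT => /andP[/(lt_le_trans a0)].
move=> m m0; rewrite /= in_itv/= => /negP; rewrite negb_and -!ltNge => /orP[] k.
  by rewrite z ?mulr0// ltW.
by rewrite z' ?mulr0// ltW.
Qed.

Section approximation.
Variable rho : {finite_measure set mR -> \bar R}.
Hypothesis rho0 : rho `]-oo, 0]%classic = 0%E.

Lemma xtest_approx psi : xtest psi ->
  \int[rho]_m (psi m * cutoff n m) @[n --> \oo] --> \int[rho]_m psi m.
Proof.
move=> h; have mpsi := xtest_measurable h; have [_ bd z _] := h.
have mc n : measurable_fun setT (fun m : mR => psi m * cutoff n m).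
  by apply: measurable_funM => //; apply: continuous_measurable_fun; exact: cutoff_continuous.
have bc n m : `|psi m * cutoff n m| <= 1 by have [] := xtest_cutoff n h.
have [_ _ cv] : [/\ rho.-integrable setT (fun m => (psi m)%:E),
    (fun n => \int[rho]_m `|(psi m * cutoff n m)%:E - (psi m)%:E|)%E @ \oo --> 0%E &
    (fun n => \int[rho]_m (psi m * cutoff n m)%:E)%E @ \oo --> (\int[rho]_m (psi m)%:E)%E].
  apply: (dominated_convergence measurableT (g := cst 1%E)) => //.
  - by move=> n; apply/measurable_EFinP; exact: mc.
  - exact/measurable_EFinP.
  - apply: aeW => m _; apply: cvg_EFin; first exact: nearW.
    have [m0|m0] := ltP 0 m; last first.
      by apply: cvg_near_cst; apply: nearW => n /=; rewrite z// mul0r.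
    by rewrite -[X in _ --> X]mulr1; apply: cvgM; [exact: cvg_cst|exact: cutoff_cvg].
  - by apply: (finite_integrable rho (f := cst 1) (C := 1)) => // m; rewrite normr1.
  - by apply: aeW => m n _; rewrite lee_fin.
have fin : (\int[rho]_m (psi m)%:E)%E \is a fin_num.
  by apply: integrable_fin_num => //; exact: (finite_integrable rho mpsi bd).
rewrite -[X in _ --> X]/(fine _).
suff : (\int[rho]_m (psi m * cutoff n m))%:E @[n --> \oo] --> (fine (\int[rho]_m (psi m)%:E)%E)%:E.
  by move/fine_cvgP => [].
rewrite fineK//; rewrite (_ : (fun n => _) = (fun n => \int[rho]_m (psi m * cutoff n m)%:E)%E)//.
apply/funext => n; rewrite /Rintegral fineK//; apply: integrable_fin_num => //.
exact: (finite_integrable rho (mc n) (bc n)).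
Qed.

End approximation.

Section convolution.
Variable rho : {finite_measure set mR -> \bar R}.
Hypothesis rho0 : rho `]-oo, 0]%classic = 0%E.
Variables (phi : R -> R) (C : R).
Hypotheses (cphi : continuous phi) (phiC : forall m, `|phi m| <= C).

Let mphiD x : measurable_fun setT (fun y : mR => phi (x + y)).
Proof.
by apply: (measurableT_comp (continuous_measurable_fun cphi)); exact: measurable_funD.
Qed.

Definition conv (x : R) : R := \int[rho]_y phi (x + y).

Lemma conv_continuous : continuous conv.
Proof.
move=> x; have xI : x \in (`]x - 1, x + 1[%classic : set R).
  by rewrite inE/= in_itv/=; apply/andP; split; lra.
apply: (@continuity_under_integral R _ _ rho (fun x y => phi (x + y)) setT measurableT
  (x - 1) (x + 1) _ _ (cst C) _ _ x xI).
- by move=> z _; exact: (finite_integrable rho (mphiD z) (fun y => phiC _)).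
- apply: aeW => y _ z _; apply: (continuous_comp (f := fun z => z + y)); last exact: cphi.
  by apply: cvgD; [exact: cvg_id|exact: cvg_cst].
- exact: (finite_integrable rho (measurable_cst C) (fun=> lexx `|C|)).
- by move=> z _; apply: aeW => y _; exact: phiC.
Qed.

Lemma conv_bound x : `|conv x| <= C * fine (rho setT).
Proof. exact: (finite_Rintegral_le rho (mphiD x) (fun y => phiC _)). Qed.

End convolution.
End test_classes.

(** * Comparison of two measures through truncated test functions *)

Section two_measures.
Context {R : realType}.
Local Notation mR := (measurableTypeR R).
Implicit Types rho : {finite_measure set mR -> \bar R}.

Lemma eq_supp_Rintegral rho (f g : mR -> R) : rho `]-oo, 0]%classic = 0%E ->
  measurable_fun setT f -> measurable_fun setT g -> (forall m, 0 < m -> f m = g m) ->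
  \int[rho]_m f m = \int[rho]_m g m.
Proof.
move=> rho0 mf mg fg; rewrite /Rintegral; congr fine; apply: eq_supp_integral => //.
- exact/measurable_EFinP.
- exact/measurable_EFinP.
- by move=> m /fg ->.
Qed.

Lemma conv_fubini rho rho' (phi : R -> R) (C : R) : continuous phi ->
  (forall m, `|phi m| <= C) -> \int[rho]_x conv rho' phi x = \int[rho']_x conv rho phi x.
Proof.
move=> cphi phiC.
have mphi : measurable_fun setT (phi : mR -> mR) by exact: continuous_measurable_fun.
have mD : measurable_fun setT (fun p : mR * mR => (phi (p.1 + p.2))%:E : \bar R).
  by apply/measurable_EFinP; apply: (measurableT_comp mphi); exact: measurable_funD.
have mx x : measurable_fun setT (fun y : mR => phi (x + y)).
  by apply: (measurableT_comp mphi); exact: measurable_funD.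
have ix (r : {finite_measure set mR -> \bar R}) x : r.-integrable setT (fun y => (phi (x + y))%:E).
  exact: (finite_integrable r (mx x) (fun y => phiC (x + y))).
have E (r r' : {finite_measure set mR -> \bar R}) :
    ((\int[r]_x conv r' phi x)%R = fine (\int[r]_x \int[r']_y (phi (x + y)%R)%:E))%E.
  rewrite /Rintegral; congr fine; apply: eq_integral => x _.
  by rewrite /conv /Rintegral fineK//; exact: (integrable_fin_num measurableT (ix r' x)).
rewrite !E; congr fine.
have -> : (\int[rho']_x \int[rho]_y (phi (x + y)%R)%:E =
    \int[rho']_x \int[rho]_y (phi (y + x)%R)%:E)%E.
  by apply: eq_integral => x _; apply: eq_integral => y _; rewrite addrC.
apply: (Fubini (m1 := rho) (m2 := rho') (f := fun p : mR * mR => (phi (p.1 + p.2))%:E)).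
apply/(integrable12ltyP rho rho' mD).
have rfin : rho' setT \is a fin_num by exact: fin_num_measure.
apply: (@le_lt_trans _ _ (\int[rho]_x (C%:E * rho' setT))%E); last first.
  have rfin' : rho setT \is a fin_num by exact: fin_num_measure.
  by rewrite integral_cst// ltey_eq fin_numM ?fin_numM.
have mabs : measurable_fun setT (fun p : mR * mR => `|(phi (p.1 + p.2))%:E|%E : \bar R).
  exact: measurableT_comp.
apply: ge0_le_integral => //.
- by move=> x _; apply: integral_ge0.
- exact: (measurable_fun_fubini_tonelli_F _ mabs).
move=> x _; rewrite -integral_cst//; apply: ge0_le_integral => //.
- exact: (measurableT_comp mabs (pair1_measurable _)).
- by move=> y _; rewrite lee_fin.
Qed.

Variables rho rho' : {finite_measure set mR -> \bar R}.
Hypotheses (rho0 : rho `]-oo, 0]%classic = 0%E) (rho'0 : rho' `]-oo, 0]%classic = 0%E).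
Variables (b B K : R).
Hypotheses (b_gt0 : 0 < b) (B_gt0 : 0 < B).
Hypothesis HB : forall psi, ctest b psi -> `|\int[rho]_m psi m| <= B.
Hypothesis HB' : forall psi, ctest b psi -> `|\int[rho']_m psi m| <= B.
Hypothesis HK : forall psi, ctest b psi -> `|\int[rho]_m psi m - \int[rho']_m psi m| <= K.

(** Convolving with a measure destroys the vanishing near 0, so the bounds known on [ctest] are
    extended to [xtest] by means of the cutoffs. *)
Lemma xtest_bound (r : {finite_measure set mR -> \bar R}) :
  r `]-oo, 0]%classic = 0%E -> (forall psi, ctest b psi -> `|\int[r]_m psi m| <= B) ->
  forall psi, xtest b psi -> `|\int[r]_m psi m| <= B.
Proof.
move=> r0 Hr psi h.
have cv : `|\int[r]_m (psi m * cutoff n m)| @[n --> \oo] --> `|\int[r]_m psi m|.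
  exact: cvg_norm (xtest_approx h).
by apply: (cvgr_to_le cv); apply: nearW => n; apply: Hr; exact: xtest_cutoff.
Qed.

Lemma xtest_diff psi : xtest b psi -> `|\int[rho]_m psi m - \int[rho']_m psi m| <= K.
Proof.
move=> h.
have cv : `|\int[rho]_m (psi m * cutoff n m) - \int[rho']_m (psi m * cutoff n m)|
    @[n --> \oo] --> `|\int[rho]_m psi m - \int[rho']_m psi m|.
  by apply: cvg_norm; apply: cvgB; exact: xtest_approx h.
by apply: (cvgr_to_le cv); apply: nearW => n; apply: HK; exact: xtest_cutoff.
Qed.

Variable psi : R -> R.
Hypothesis hpsi : ctest b psi.
Let phi m := m * psi m.
Let cphi : continuous phi := (ctest_mulX b_gt0 hpsi).1.
Let phib : forall m, `|phi m| <= b := (ctest_mulX b_gt0 hpsi).2.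
Let mphi : measurable_fun setT (phi : mR -> mR) := continuous_measurable_fun cphi.

Let mphiD x : measurable_fun setT (fun y : mR => phi (x + y)).
Proof. by apply: (measurableT_comp mphi); exact: measurable_funD. Qed.

Let phi_z m : b <= m -> phi m = 0.
Proof. by case: hpsi => _ _ _ z /z; rewrite /phi => ->; rewrite mulr0. Qed.

Let cut_cont (f : R -> R) m : 0 < m -> {for m, continuous f} ->
  {for m, continuous (fun x : R => if 0 < x then f x else 0)}.
Proof.
move=> m0 cf; rewrite /prop_for /continuous_at /= m0; apply: cvg_trans cf; apply: near_eq_cvg.
by near=> x; have x0 : 0 < x by [near: x; exact: lt_nbhsr]; rewrite x0.
Unshelve. all: end_near. Qed.

(** For x > 0 the function y |-> phi (x + y) / b, cut to (0, +oo), is again a test function. The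
    bound [B] thereby replaces the total mass, which is only known to be square integrable in
    time. *)
Lemma conv_pos_bound (r : {finite_measure set mR -> \bar R}) x :
  r `]-oo, 0]%classic = 0%E -> (forall psi, ctest b psi -> `|\int[r]_m psi m| <= B) ->
  0 < x -> `|conv r phi x| <= b * B.
Proof.
move=> r0 Hr x0; pose f y := if 0 < y then b^-1 * phi (x + y) else 0.
have hf : xtest b f.
  split.
  - move=> y y0; apply: (cut_cont (f := fun y => b^-1 * phi (x + y))) => //; apply: cvgM; first exact: cvg_cst.
    apply: (continuous_comp (f := fun z => x + z)); last exact: cphi.
    by apply: cvgD; [exact: cvg_cst|exact: cvg_id].
  - move=> y; rewrite /f; case: ifP => _; last by rewrite normr0.
    by rewrite normrM gtr0_norm ?invr_gt0// mulrC ler_pdivrMr// mul1r.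
  - by move=> y y0; rewrite /f ltNge y0.
  - move=> y yb; rewrite /f phi_z ?mulr0 ?if_same//; lra.
have := xtest_bound r0 Hr hf.
rewrite (eq_supp_Rintegral (g := fun y => b^-1 * phi (x + y)) r0); last 3 first.
- exact: xtest_measurable hf.
- by apply: measurable_funM => //; exact: mphiD.
- by move=> y y0; rewrite /f y0.
rewrite RintegralZl//; last exact: (finite_integrable r (mphiD x) (fun y => phib _)).
by rewrite normrM gtr0_norm ?invr_gt0// mulrC ler_pdivrMr// mulrC.
Qed.

Let conv_z (r : {finite_measure set mR -> \bar R}) x :
  r `]-oo, 0]%classic = 0%E -> b <= x -> conv r phi x = 0.
Proof.
move=> r0 bx; rewrite /conv (eq_supp_Rintegral (g := cst 0) r0) ?Rintegral_cst ?mul0r//.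
by move=> y y0; rewrite phi_z//; lra.
Qed.

Let iconv (r s : {finite_measure set mR -> \bar R}) :
  r.-integrable setT (EFin \o conv s phi).
Proof.
apply: (finite_integrable r (f := conv s phi)); last exact: conv_bound.
by apply: continuous_measurable_fun; exact: conv_continuous cphi phib.
Qed.

(** By symmetry of the convolution, the difference of the two squares is the product of rho - rho'
    with rho + rho'; convolving phi with rho + rho' and dividing by 2 b B gives a test function
    again. *)
Lemma gain_diff : `|\int[rho]_x conv rho phi x - \int[rho']_x conv rho' phi x| <= 2 * b * B * K.
Proof.
pose F x := conv rho phi x + conv rho' phi x.
have d0 : 0 < 2 * b * B by rewrite !mulr_gt0.
pose f x := if 0 < x then (2 * b * B)^-1 * F x else 0.
have cF : continuous F.
  by move=> x; apply: cvgD; apply: conv_continuous cphi phib _.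
have mF : measurable_fun setT (fun x : mR => (2 * b * B)^-1 * F x).
  by apply: measurable_funM => //; exact: continuous_measurable_fun.
have hf : xtest b f.
  split.
  - move=> x x0; apply: (cut_cont (f := fun x => (2 * b * B)^-1 * F x)) => //; apply: cvgM; first exact: cvg_cst.
    exact: cF.
  - move=> x; rewrite /f; case: ifPn => x0; last by rewrite normr0.
    rewrite normrM gtr0_norm ?invr_gt0// mulrC ler_pdivrMr// mul1r.
    apply: le_trans (ler_normD _ _) _.
    have h1 := conv_pos_bound rho0 HB x0; have h2 := conv_pos_bound rho'0 HB' x0.
    have -> : 2 * b * B = b * B + b * B by ring.
    exact: lerD.
  - by move=> x x0; rewrite /f ltNge x0.
  - by move=> x bx; rewrite /f /F !conv_z// addr0 mulr0 if_same.
have := xtest_diff hf.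
have E (r : {finite_measure set mR -> \bar R}) : r `]-oo, 0]%classic = 0%E ->
    \int[r]_x f x = (2 * b * B)^-1 * (\int[r]_x conv rho phi x + \int[r]_x conv rho' phi x).
  move=> r0; rewrite (eq_supp_Rintegral (g := fun x => (2 * b * B)^-1 * F x) r0)//; last 2 first.
  - exact: xtest_measurable hf.
  - by move=> x x0; rewrite /f x0.
  rewrite RintegralZl//; last exact: (integrableD measurableT (iconv r rho) (iconv r rho')).
  congr (_ * _); exact: (RintegralD measurableT (iconv r rho) (iconv r rho')).
rewrite !E// (conv_fubini rho rho' cphi phib) -mulrBr normrM gtr0_norm ?invr_gt0//.
rewrite mulrC ler_pdivrMr// [K * _]mulrC; apply: le_trans.
rewrite le_eqVlt; apply/orP; left; apply/eqP; congr `|_|.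
by move: (\int[rho]_x conv rho phi x) (\int[rho']_x conv rho phi x)
  (\int[rho']_x conv rho' phi x) => p q s; ring.
Qed.

Lemma loss_diff : `|\int[rho]_m phi m - \int[rho']_m phi m| <= b * K.
Proof.
pose f m := b^-1 * phi m.
have [c h [a a0 z] z'] := hpsi.
have hf : ctest b f.
  split.
  - by move=> m; apply: cvgM; [exact: cvg_cst|exact: cphi].
  - by move=> m; rewrite normrM gtr0_norm ?invr_gt0// mulrC ler_pdivrMr// mul1r.
  - by exists a => // m ma; rewrite /f /phi z// !mulr0.
  - by move=> m bm; rewrite /f phi_z// mulr0.
have := HK hf.
rewrite !RintegralZl//; last 2 first.
- exact: (finite_integrable rho' mphi phib).
- exact: (finite_integrable rho mphi phib).
by rewrite -mulrBr normrM gtr0_norm ?invr_gt0// mulrC ler_pdivrMr// mulrC.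
Qed.

End two_measures.

Section flory_rate.
Context {R : realType}.
Local Notation mR := (measurableTypeR R).
Variables (mu0 nu : borel_measure R) (nu0 : nu `]-oo, 0]%classic = 0%E).
Hypothesis mu0_mass : (moment1 mu0 < +oo)%E.
Hypothesis nu_mass : (moment1 nu < +oo)%E.
Local Notation rho := (fmass nu0 nu_mass).

(** The mass of [nu] has cancelled. What remains is quadratic and linear in m nu(dm), and both terms
    only see masses below b when [phi] vanishes above b. *)
Lemma flory_rateE (phi : R -> R) (C : R) : continuous phi -> (forall m, `|phi m| <= C) ->
  ((2^-1)%:E * coag_term nu phi - gel_term mu0 nu phi =
   (2^-1 * \int[rho]_x conv rho phi x - fine (moment1 mu0) * \int[rho]_m phi m)%:E)%E.
Proof.
move=> cphi phiC.
have mphi : measurable_fun setT (phi : mR -> mR) by exact: continuous_measurable_fun.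
have mx x : measurable_fun setT (fun y : mR => phi (x + y)).
  by apply: (measurableT_comp mphi); exact: measurable_funD.
rewrite (coag_termE nu0 nu_mass mphi phiC) (gel_termE nu0 nu_mass mphi phiC mu0_mass).
have <- : (\int[rho]_x conv rho phi x)%R = fine (\int[rho]_x \int[rho]_y (phi (x + y)%R)%:E)%E.
  rewrite /Rintegral; congr fine; apply: eq_integral => x _.
  rewrite /conv /Rintegral fineK//; apply: integrable_fin_num => //.
  exact: (finite_integrable rho (mx x) (fun y => phiC (x + y))).
have <- : (\int[rho]_m phi m)%R = fine (pairing nu (fun m => m * phi m)).
  by rewrite -(integral_fmass nu0 nu_mass mphi).
rewrite -EFinM -EFinB; congr EFin.
by move: (fine _) (fine _) (Rintegral _ _ _) (Rintegral _ _ _) => *; field.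
Qed.

End flory_rate.

(** * Radon measures are determined by continuous test functions *)

Section interval_measures.
Context {R : realType}.
Local Notation mR := (measurableTypeR R).

Definition tent (a c : R) (n : nat) (m : R) : R :=
  Num.min 1 (n%:R * Num.max 0 (Num.min (m - a) (c - m))).

Lemma tent_continuous a c n : continuous (tent a c n).
Proof.
apply: (@min_fun_continuous _ _ R (cst 1)); first exact: cst_continuous.
move=> x; apply: cvgM; first exact: cvg_cst.
move: x; apply: (@max_fun_continuous _ _ R (cst 0)); first exact: cst_continuous.
apply: (@min_fun_continuous _ _ R (fun m => m - a) (fun m => c - m)) => x.
  by apply: cvgB; [exact: cvg_id|exact: cvg_cst].
by apply: cvgB; [exact: cvg_cst|exact: cvg_id].
Qed.

Lemma tent_itv a c n m : 0 <= tent a c n m <= 1.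
Proof.
rewrite /tent le_min ge_min lexx ler01/= andbT mulr_ge0// le_max lexx//.
Qed.

Lemma tent_out a c n m : m <= a \/ c <= m -> tent a c n m = 0.
Proof.
move=> h; have h2 : Num.max 0 (Num.min (m - a) (c - m)) = 0.
  by apply: max_l; rewrite ge_min !subr_le0; apply/orP.
by rewrite /tent h2 mulr0 min_r.
Qed.

Lemma tent_nondecreasing a c m : nondecreasing_seq (fun n => tent a c n m).
Proof.
move=> i j ij; rewrite /tent le_min ge_min lexx/= ge_min; apply/orP; right.
by rewrite ler_wpM2r ?ler_nat// le_max lexx.
Qed.

Lemma tent_cvg a c m : tent a c n m @[n --> \oo] --> (\1_(`]a, c[%classic : set mR) m : R).
Proof.
rewrite indicE; have [|] := boolP (m \in _).
  rewrite inE/= in_itv/= => /andP[am mc].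
  pose d := Num.min (m - a) (c - m).
  have d0 : 0 < d by rewrite lt_min !subr_gt0 am.
  apply: cvg_near_cst; exists (Num.truncn d^-1).+1 => // n /= hn.
  rewrite /tent -/d max_r ?(ltW d0)// min_l// -ler_pdivrMr// mul1r ltW//.
  by apply: lt_le_trans (truncnS_gt _) _; rewrite ler_nat.
rewrite notin_setE/= in_itv/= => /negP; rewrite negb_and -!leNgt => /orP h.
by apply: cvg_near_cst; apply: nearW => n; exact: tent_out.
Qed.

Lemma open_itv_measure_cvg (nu : borel_measure R) a c : 0 < a ->
  nu `]-oo, 0]%classic = 0%E ->
  pairing nu (fun m => a * tent a c n m) @[n --> \oo] --> (a%:E * nu `]a, c[%classic)%E.
Proof.
move=> a0 nu0.
have mt n : measurable_fun setT (tent a c n : mR -> mR).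
  by apply: continuous_measurable_fun; exact: tent_continuous.
have pE n : (pairing nu (fun m => a * tent a c n m)%R = \int[nu]_m (a * tent a c n m)%:E)%E.
  by apply: (pairingE nu0); apply: measurable_funM; [exact: measurable_cst|exact: mt].
rewrite (funext pE).
have -> : (a%:E * nu `]a, c[%classic = \int[nu]_m (a * \1_(`]a, c[%classic : set mR) m)%:E)%E.
  under eq_integral do rewrite EFinM.
  rewrite ge0_integralZl ?lee_fin ?(ltW a0)//; last first.
    by apply/measurable_EFinP; exact: measurable_indic.
  by rewrite integral_indic// setIT.
apply: cvg_monotone_integral.
- by move=> n; apply/measurable_EFinP; apply: measurable_funM; [exact: measurable_cst|exact: mt].
- by move=> n m; rewrite lee_fin mulr_ge0 ?(ltW a0)//; case/andP: (tent_itv a c n m).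
- by move=> m i j ij; rewrite lee_fin ler_wpM2l ?(ltW a0)// tent_nondecreasing.
- move=> m; apply: cvg_EFin; first exact: nearW.
  by apply: cvgM; [exact: cvg_cst|exact: tent_cvg].
Qed.

(** The measures may be infinite near 0 and near +oo. They are compared on the intervals [D k],
    where they are finite, with the rays ]x, +oo[ as generating pi-system, and [D k] increases to
    (0, +oo). *)
Lemma eq_radon_pos (nu nu' : borel_measure R) : radon_pos nu -> radon_pos nu' ->
  (forall a c, 0 < a -> nu `]a, c[%classic = nu' `]a, c[%classic) ->
  forall A, measurable A -> nu A = nu' A.
Proof.
move=> [nu0 fin] [nu'0 fin'] e A mA.
pose D k : set mR := `]k.+1%:R^-1, k.+1%:R[%classic.
have mD k : measurable (D k) by exact: measurable_itv.
have k0 k : 0 < (k.+1%:R^-1 : R) by rewrite invr_gt0.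
have eqD k : nu (A `&` D k) = nu' (A `&` D k).
  rewrite -[LHS]/(mrestr nu (mD k) A) -[RHS]/(mrestr nu' (mD k) A).
  apply: (@measure_unique _ R mR (@RGenOInfty.G R) (fun n => `](- n%:R)%R, +oo[%classic) _ _ _ _
    [the {measure set mR -> \bar R} of mrestr nu (mD k)]
    [the {measure set mR -> \bar R} of mrestr nu' (mD k)]) => //.
  - exact: RGenOInfty.measurableE.
  - move=> _ _ [x ->] [y ->]; exists (Num.max x y).
    by apply/seteqP; split => z /=; rewrite !in_itv/= !andbT gt_max => /andP.
  - by move=> i; exists (- i%:R).
  - rewrite -subTset => x _; exists (Num.truncn `|x|).+1 => //=.
    by rewrite in_itv/= andbT; have := truncnS_gt `|x|; rewrite ltr_norml => /andP[].
  - move=> _ [x ->].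
    have E (r : borel_measure R) : mrestr r (mD k) `]x, +oo[%classic =
        r `](Num.max x k.+1%:R^-1), k.+1%:R[%classic.
      congr (r _); apply/seteqP; split => z /=; rewrite /D/= !in_itv/= gt_max.
        by move=> [/andP[-> _] /andP[-> ->]].
      by move=> /andP[/andP[-> ->] ->].
    have ee := e (Num.max x k.+1%:R^-1) k.+1%:R; rewrite lt_max k0 orbT in ee.
    exact: (etrans (E nu) (etrans (ee isT) (esym (E nu')))).
  - move=> n; apply: (@le_lt_trans _ _ (nu `[k.+1%:R^-1, k.+1%:R]%classic)).
      apply: le_measure; rewrite ?inE//.
        by apply: measurableI => //; exact: measurable_itv.
      by move=> z [_]; rewrite /D/= !in_itv/= => /andP[/ltW -> /ltW ->].
    apply: fin; first exact: segment_compact.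
    by move=> z; rewrite /= !in_itv/= andbT => /andP[/(lt_le_trans (k0 k))].
have cv (r : borel_measure R) : r `]-oo, 0]%classic = 0%E ->
    r (A `&` D k) @[k --> \oo] --> r A.
  move=> r0.
  have AE : r A = r (\bigcup_k (A `&` D k)).
    rewrite -setI_bigcupr; have -> : \bigcup_k D k = `]0, +oo[%classic.
      apply/seteqP; split => z.
        by move=> [k _]; rewrite /D/= !in_itv/= andbT => /andP[/(lt_trans (k0 k))].
      rewrite /= in_itv/= andbT => z0; exists (maxn (Num.truncn z) (Num.truncn z^-1)) => //.
      rewrite /D/= in_itv/=; apply/andP; split.
        rewrite invf_plt ?posrE//; apply: lt_le_trans (truncnS_gt _) _.
        by rewrite ler_nat ltnS leq_maxr.
      by apply: lt_le_trans (truncnS_gt _) _; rewrite ler_nat ltnS leq_maxl.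
    rewrite [LHS](_ : _ = r (A `&` `]0%R, +oo[) + r (A `&` `]-oo, 0%R]))%E.
      rewrite [X in (_ + X)%E](_ : _ = 0%E) ?adde0//.
      apply/eqP; rewrite eq_le measure_ge0 andbT -[leRHS]r0.
      by apply: le_measure; [rewrite inE; exact: measurableI|rewrite inE|exact: subIsetr].
    rewrite -measureU//.
    - congr (r _); rewrite -setIUr; have -> : `]0, +oo[ `|` `]-oo, 0] = setT :> set R.
        rewrite -subTset => z _; have [z0|z0] := ltP 0 z; [left|right].
          by rewrite /= in_itv/= z0.
        by rewrite /= in_itv.
      by rewrite setIT.
    - by apply: measurableI => //; exact: measurable_itv.
    - exact: measurableI.
    - apply/seteqP; split => // z [[_]] + [_].
      by rewrite /= !in_itv/= andbT => z0; rewrite leNgt z0.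
  rewrite AE; apply: nondecreasing_cvg_mu.
  - by move=> k; exact: measurableI.
  - by apply: bigcup_measurable => k _; exact: measurableI.
  - move=> i j ij; apply/subsetPset; apply: setIS => z.
    rewrite /D/= !in_itv/= => /andP[z1 z2]; apply/andP; split.
      by apply: le_lt_trans z1; rewrite lef_pV2 ?posrE// ler_nat ltnS.
    by apply: lt_le_trans z2 _; rewrite ler_nat ltnS.
have h1 := cv _ nu0; have h2 := cv _ nu'0.
rewrite (funext eqD : (fun k => nu (A `&` D k)) = _) in h1.
exact: (cvg_unique _ h1 h2).
Qed.

End interval_measures.

(** * Gronwall estimate for two solutions *)

Section uniqueness.
Context {R : realType}.
Local Notation mR := (measurableTypeR R).
Local Notation leb := (@lebesgue_measure R).
Variable mu0 : borel_measure R.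
Hypothesis mu0_mass : (moment1 mu0 < +oo)%E.
Variable b : R.
Hypothesis b_gt0 : 0 < b.
Local Notation M0 := (fine (moment1 mu0)).
Local Notation X psi := (fun m : R => m * psi m).

Let M00 : 0 <= M0.
Proof. by apply: fine_ge0; apply: pairing_ge0 => m /ltW. Qed.

Lemma le_abs_integral_itv (t : R) (f g : R -> \bar R) : leb.-integrable `[0, t] f ->
  measurable_fun `[0, t]%classic (g : mR -> \bar R) -> (forall s, (0 <= s)%R -> 0 <= g s)%E ->
  {ae leb, forall s, `[0, t]%classic s -> (`|f s| <= g s)%E} ->
  (`|\int[leb]_(s in `[0%R, t]) f s| <= \int[leb]_(s in `[0%R, t]) g s)%E.
Proof.
move=> fi mg g0 fg; have mf := measurable_int leb fi.
have mI : measurable (`[0, t]%classic : set mR) by exact: measurable_itv.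
apply: le_trans (le_abse_integral leb mI mf) _.
apply: ae_ge0_le_integral => //; first exact: measurableT_comp.
by move=> s; rewrite /= in_itv/= => /andP[s0 _]; exact: g0.
Qed.

Lemma pairing_init_bound psi : ctest b psi -> (`|pairing mu0 (X psi)| <= M0%:E)%E.
Proof.
move=> h; have [c bd] := ctest_mulX b_gt0 h; have [_ h1 _ _] := h.
have mX : measurable_fun setT (X psi : mR -> mR) by exact: continuous_measurable_fun.
have mI : measurable (`]0, +oo[%classic : set mR) by exact: measurable_itv.
have mXE : measurable_fun (`]0, +oo[%classic : set mR) (fun m : mR => (m * psi m)%:E : \bar R).
  by apply/measurable_EFinP; exact: measurable_funTS.
rewrite fineK; last first.
  by rewrite ge0_fin_numE//; apply: pairing_ge0 => m /ltW.
apply: le_trans (le_abse_integral mu0 mI mXE) _; apply: ge0_le_integral => //.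
- exact: measurableT_comp.
- by apply/measurable_EFinP; exact: measurable_funTS.
- move=> m; rewrite /= in_itv/= andbT => m0; rewrite lee_fin normrM gtr0_norm//.
  by rewrite ler_piMr// ltW.
Qed.

Lemma pairing_init_fin psi : ctest b psi -> pairing mu0 (X psi) \is a fin_num.
Proof.
move=> /pairing_init_bound h; rewrite -abse_fin_num ge0_fin_numE//.
by apply: le_lt_trans h _; rewrite ltry.
Qed.

(** The cross term b m M is at most half of b (m^2 + M^2), so the rate is controlled by the square
    of the mass, whose integrability in time is what a solution provides. *)
Lemma rate_bound_algebra (p q m M : R) : 0 <= M -> `|p| <= b * m * m -> `|q| <= b * m ->
  `|2^-1 * p - M * q| <= b * (m * m) + b * M ^+ 2 / 2.
Proof.
move=> M0 hp hq; apply: le_trans (ler_normB _ _) _; rewrite !normrM (ger0_norm M0).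
have -> : `|2^-1 : R| = 2^-1 by rewrite ger0_norm// invr_ge0.
have hq' := ler_wpM2l M0 hq.
have sq : 0 <= b * (m - M) ^+ 2 by rewrite mulr_ge0 ?sqr_ge0// ltW.
lra.
Qed.

Lemma rate_diff_algebra (p p' q q' M B K : R) : 0 <= M -> `|p - p'| <= 2 * b * B * K ->
  `|q - q'| <= b * K ->
  `|2^-1 * p - M * q - (2^-1 * p' - M * q')| <= b * (B + M) * K.
Proof.
move=> M0 hp hq.
have -> : 2^-1 * p - M * q - (2^-1 * p' - M * q') = 2^-1 * (p - p') - M * (q - q') by ring.
apply: le_trans (ler_normB _ _) _; rewrite !normrM (ger0_norm M0).
have -> : `|2^-1 : R| = 2^-1 by rewrite ger0_norm// invr_ge0.
have hq' := ler_wpM2l M0 hq; lra.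
Qed.

Lemma subeD2l (x y z : \bar R) : x \is a fin_num -> y \is a fin_num -> z \is a fin_num ->
  (x + y - (x + z) = y - z)%E.
Proof.
move: x y z => [x| |] [y| |] [z| |]// _ _ _; rewrite -!EFinN -!EFinD; congr EFin; ring.
Qed.

Section one_solution.
Variable nu : R -> borel_measure R.
Hypothesis Hnu : flory_solution mu0 nu.

Definition flory_rate (phi : R -> R) (s : R) : \bar R :=
  ((2^-1)%:E * coag_term (nu s) phi - gel_term mu0 (nu s) phi)%E.

Lemma flory_rate_spec phi t : Cc_pos phi -> 0 < t ->
  leb.-integrable `[0, t] (flory_rate phi) /\
  (pairing (nu t) phi = pairing mu0 phi + \int[leb]_(s in `[0%R, t]) flory_rate phi s)%E.
Proof.
move=> cphi t0; have [_ _ _ /(_ _ _ cphi t0)[ci gi ->] _] := Hnu.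
have mI : measurable (`[0, t]%classic : set mR) by exact: measurable_itv.
have cZ := integrableZl mI (2^-1) ci.
split; first exact: (integrableB mI cZ gi).
rewrite -addeA; congr (_ + _)%E; rewrite -(integralZl mI ci).
by rewrite -(integralB mI cZ gi).
Qed.

Lemma flory_init psi : pairing (nu 0) (X psi) = pairing mu0 (X psi).
Proof. by have [_ h _ _ _] := Hnu; apply: eq_measure_integral => A mA _; exact: h. Qed.

Lemma flory_supp s : 0 <= s -> nu s `]-oo, 0]%classic = 0%E.
Proof. by have [h _ _ _ _] := Hnu; move=> /h[]. Qed.

Lemma moment1_ge0 s : (0 <= moment1 (nu s))%E.
Proof. by apply: pairing_ge0 => m /ltW. Qed.

(** Square integrability in time makes the mass finite at almost every time only; the estimates of
    the rates hold for these times. *)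
Lemma flory_mass_ae t : 0 < t ->
  {ae leb, forall s, `[0, t]%classic s -> (moment1 (nu s) < +oo)%E}.
Proof.
move=> t0; have [_ _ /(_ _ t0)[mM fM] _ _] := Hnu.
have mI : measurable (`[0, t]%classic : set mR) by exact: measurable_itv.
have i2 : leb.-integrable `[0, t] (fun s => (moment1 (nu s) ^+ 2)%E).
  apply/integrableP; split; first exact: emeasurable_funM.
  by under eq_integral do rewrite gee0_abs ?sqre_ge0//.
have [N [mN N0 hN]] := integrable_ae mI i2.
exists N; split => // s ns; apply: hN => /= h; apply: ns => /h.
have := moment1_ge0 s; case: (moment1 (nu s)) => [r| |]//= _; first by rewrite ltry.
Qed.

Definition mass_of s (s0 : 0 <= s) (fin : (moment1 (nu s) < +oo)%E) :
  {finite_measure set mR -> \bar R} := fmass (flory_supp s0) fin.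

Lemma mass_of_supp s (s0 : 0 <= s) (fin : (moment1 (nu s) < +oo)%E) :
  mass_of s0 fin `]-oo, 0]%classic = 0%E.
Proof. exact: (mass_measure_supp (flory_supp s0)). Qed.

Lemma pairing_mass_of s (s0 : 0 <= s) (fin : (moment1 (nu s) < +oo)%E) psi : ctest b psi ->
  pairing (nu s) (X psi) = (\int[mass_of s0 fin]_m psi m)%:E.
Proof.
move=> [c h1 _ _]; have mpsi : measurable_fun setT (psi : mR -> mR).
  exact: continuous_measurable_fun.
rewrite /Rintegral fineK; first by rewrite integral_fmass.
by apply: integrable_fin_num => //; exact: (finite_integrable _ mpsi h1).
Qed.

Lemma flory_rate_bound s psi : 0 <= s -> (moment1 (nu s) < +oo)%E -> ctest b psi ->
  (`|flory_rate (X psi) s| <= b%:E * moment1 (nu s) ^+ 2 + (b * M0 ^+ 2 / 2)%:E)%E.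
Proof.
move=> s0 fin h; have [cX bX] := ctest_mulX b_gt0 h.
rewrite /flory_rate (flory_rateE (flory_supp s0) mu0_mass fin cX bX).
set rho := fmass _ _.
have rE : rho setT = moment1 (nu s) by exact: fmassT.
have mE : moment1 (nu s) = (fine (moment1 (nu s)))%:E.
  by rewrite fineK// ge0_fin_numE// moment1_ge0.
have h1 := conv_bound rho cX bX.
have mconv : measurable_fun setT (conv rho (X psi) : mR -> mR).
  by apply: continuous_measurable_fun; exact: conv_continuous cX bX.
have mX : measurable_fun setT (X psi : mR -> mR) by exact: continuous_measurable_fun.
have h2 := finite_Rintegral_le rho mconv h1.
have h3 := finite_Rintegral_le rho mX bX.
move: h2 h3; rewrite rE mE expe2 -!EFinM -EFinD lee_fin /= => h2 h3.
exact: rate_bound_algebra M00 h2 h3.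
Qed.

(** Integrating the rate bounds <nu_t, m psi> at every time, uniformly in [psi], although the mass
    is not bounded in time. The summand 1 makes [B] positive. *)
Lemma solution_bound T : 0 < T -> exists2 B, 0 < B &
  forall t psi, 0 <= t <= T -> ctest b psi -> (`|pairing (nu t) (X psi)| <= B%:E)%E.
Proof.
move=> T0; have [_ _ /(_ _ T0)[mM fM] _ _] := Hnu.
pose g s := (b%:E * moment1 (nu s) ^+ 2 + (b * M0 ^+ 2 / 2)%:E)%E.
have g0 s : (0 <= g s)%E.
  apply: adde_ge0; first by apply: mule_ge0; [rewrite lee_fin ltW|exact: sqre_ge0].
  by rewrite lee_fin divr_ge0// mulr_ge0 ?sqr_ge0// ltW.
have mM2 : measurable_fun `[0, T]%classic (fun s : mR => (moment1 (nu s) ^+ 2)%E).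
  exact: emeasurable_funM.
have mg : measurable_fun `[0, T]%classic (g : mR -> \bar R).
  by apply: emeasurable_funD => //; exact: emeasurable_funM.
have mI (t : R) : measurable (`[0, t]%classic : set mR) by exact: measurable_itv.
have gfin : (\int[leb]_(s in `[0%R, T]) g s < +oo)%E.
  have bM0 : 0 <= b * M0 ^+ 2 / 2 by rewrite divr_ge0 ?mulr_ge0 ?sqr_ge0// ltW.
  rewrite /g ge0_integralD//.
  - rewrite ge0_integralZl//; last 2 first.
    + by move=> s _; rewrite sqre_ge0.
    + by rewrite lee_fin ltW.
    rewrite lte_add_pinfty//; first by rewrite lte_mul_pinfty// lee_fin ltW.
    by rewrite integral_itv_cst ?ltry// ltW.
  - by move=> s _; rewrite mule_ge0 ?lee_fin ?(ltW b_gt0)// sqre_ge0.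
  - exact: emeasurable_funM.
have I0 : (0 <= \int[leb]_(s in `[0%R, T]) g s)%E by apply: integral_ge0.
exists (M0 + fine (\int[leb]_(s in `[0%R, T]) g s)%E + 1).
  by rewrite ltr_wpDl// addr_ge0// fine_ge0.
move=> t psi /andP[t0 tT] h.
apply: (@le_trans _ _ (M0%:E + \int[leb]_(s in `[0%R, T]) g s)%E); last first.
  have fI : (\int[leb]_(s in `[0%R, T]) g s)%E \is a fin_num by rewrite ge0_fin_numE.
  by move: fI; case: (\int[leb]_(s in `[0%R, T]) g s)%E => [x| |]//= _; rewrite -EFinD lee_fin lerDl.
move: t0; rewrite le_eqVlt => /predU1P[<-|t0].
  by rewrite flory_init (le_trans (pairing_init_bound h))// leeDl.
have [ri ->] := flory_rate_spec (ctest_Cc b_gt0 h) t0.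
apply: le_trans (lee_abs_add _ _) _; apply: leeD; first exact: pairing_init_bound.
have sub : `[0, t]%classic `<=` (`[0, T]%classic : set mR).
  by move=> s; rewrite /= !in_itv/= => /andP[-> /le_trans]; apply.
apply: (@le_trans _ _ (\int[leb]_(s in `[0%R, t]) g s)%E); last first.
  exact: ge0_subset_integral.
apply: le_abs_integral_itv => //; first exact: measurable_funS mg.
have [N [mN N0 hN]] := flory_mass_ae t0.
exists N; split => // s ns; apply: hN => /= hs; apply: ns => ts.
apply: flory_rate_bound => //; last exact: hs.
by move: ts; rewrite /= in_itv/= => /andP[].
Qed.

End one_solution.

Section two_solutions.
Variables nu nu' : R -> borel_measure R.
Hypotheses (Hnu : flory_solution mu0 nu) (Hnu' : flory_solution mu0 nu').
Variables (T B : R).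
Hypothesis B_gt0 : 0 < B.
Hypothesis HB : forall t psi, 0 <= t <= T -> ctest b psi ->
  (`|pairing (nu t) (X psi)| <= B%:E)%E.
Hypothesis HB' : forall t psi, 0 <= t <= T -> ctest b psi ->
  (`|pairing (nu' t) (X psi)| <= B%:E)%E.

Local Notation diff t psi := (pairing (nu t) (X psi) - pairing (nu' t) (X psi))%E.

Lemma rate_diff_bound s psi K : 0 <= s <= T -> (moment1 (nu s) < +oo)%E ->
  (moment1 (nu' s) < +oo)%E -> ctest b psi ->
  (forall psi, ctest b psi -> (`|diff s psi| <= K%:E)%E) ->
  (`|flory_rate nu (X psi) s - flory_rate nu' (X psi) s| <= (b * (B + M0) * K)%:E)%E.
Proof.
move=> sT fin fin' h HK; have s0 : 0 <= s by case/andP: sT.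
have [cX bX] := ctest_mulX b_gt0 h.
have E psi' (h' : ctest b psi') := pairing_mass_of Hnu s0 fin h'.
have E' psi' (h' : ctest b psi') := pairing_mass_of Hnu' s0 fin' h'.
have r0 := mass_of_supp Hnu s0 fin; have r'0 := mass_of_supp Hnu' s0 fin'.
have hB psi' : ctest b psi' -> `|\int[mass_of Hnu s0 fin]_m psi' m| <= B.
  by move=> h'; have := HB sT h'; rewrite (E _ h') lee_fin.
have hB' psi' : ctest b psi' -> `|\int[mass_of Hnu' s0 fin']_m psi' m| <= B.
  by move=> h'; have := HB' sT h'; rewrite (E' _ h') lee_fin.
have hK psi' : ctest b psi' -> `|\int[mass_of Hnu s0 fin]_m psi' m -
    \int[mass_of Hnu' s0 fin']_m psi' m| <= K.
  by move=> h'; have := HK _ h'; rewrite (E _ h') (E' _ h') -EFinB lee_fin.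
have g := gain_diff r0 r'0 b_gt0 B_gt0 hB hB' hK h.
have l := loss_diff b_gt0 hK h.
rewrite /flory_rate (flory_rateE (flory_supp Hnu s0) mu0_mass fin cX bX).
rewrite (flory_rateE (flory_supp Hnu' s0) mu0_mass fin' cX bX).
rewrite -EFinB lee_fin; exact: rate_diff_algebra M00 g l.
Qed.

(** One iteration of Gronwall's argument, run for all test functions at once, because the rate of
    one [psi] involves the difference tested against others. *)
Lemma diff_step (a : R) n : 0 <= a ->
  (forall t psi, 0 <= t <= T -> ctest b psi -> (`|diff t psi| <= (a * t ^+ n)%:E)%E) ->
  forall t psi, 0 <= t <= T -> ctest b psi ->
  (`|diff t psi| <= (b * (B + M0) * a / n.+1%:R * t ^+ n.+1)%:E)%E.
Proof.
move=> a0 Ha t psi /andP[t0 tT] h.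
have fin0 := pairing_init_fin h.
move: t0; rewrite le_eqVlt => /predU1P[<-|t0].
  by rewrite (flory_init Hnu) (flory_init Hnu') subee// abse0 expr0n mulr0.
have [ri ->] := flory_rate_spec Hnu (ctest_Cc b_gt0 h) t0.
have [ri' ->] := flory_rate_spec Hnu' (ctest_Cc b_gt0 h) t0.
have mI : measurable (`[0, t]%classic : set mR) by exact: measurable_itv.
have fi := integrable_fin_num mI ri; have fi' := integrable_fin_num mI ri'.
rewrite (subeD2l fin0 fi fi') -(integralB mI ri ri').
have K0 : 0 <= b * (B + M0) by rewrite mulr_ge0 ?addr_ge0// ltW.
rewrite -(integral_expn _ _ (ltW t0)).
apply: le_abs_integral_itv.
- exact: integrableB.
- apply/measurable_EFinP; apply: measurable_funM; first exact: measurable_cst.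
  by apply: measurable_funX; exact: measurable_id.
- move=> s s0; rewrite lee_fin mulr_ge0 ?exprn_ge0//.
  by rewrite mulr_ge0.
have [N [mN N0 hN]] := flory_mass_ae Hnu t0.
have [N' [mN' N'0 hN']] := flory_mass_ae Hnu' t0.
exists (N `|` N'); split; first exact: measurableU.
  apply/eqP; rewrite eq_le measure_ge0 andbT.
  apply: le_trans (measureU2 _ mN mN') _; rewrite -[leRHS]adde0.
  by apply: leeD; [rewrite -[leRHS]N0|rewrite -[leRHS]N'0].
move=> s ns; have [Ns|nNs] := pselect (N s); [by left|right].
apply: hN' => /= hs'; apply: ns => /= ts.
have hs : (moment1 (nu s) < +oo)%E by apply: contrapT => k; apply: nNs; apply: hN => /= /(_ ts).
have sT : 0 <= s <= T.
  by move: ts; rewrite in_itv/= => /andP[-> /le_trans]; exact.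
by rewrite -mulrA; apply: rate_diff_bound => //; [exact: hs'|move=> psi'; exact: Ha].
Qed.

Lemma diff_exp t psi n : 0 <= t <= T -> ctest b psi ->
  (`|diff t psi| <= (2 * B * exp_coeff (b * (B + M0) * t) n)%:E)%E.
Proof.
set k := b * (B + M0).
have k0 : 0 <= k by rewrite mulr_ge0 ?addr_ge0// ltW.
suff H m : forall t psi, 0 <= t <= T -> ctest b psi ->
    (`|diff t psi| <= (2 * B * (k ^+ m / m`!%:R) * t ^+ m)%:E)%E.
  move=> tT h; have := H n t psi tT h; rewrite /exp_coeff/= [(k * t) ^+ n]exprMn.
  by have -> : 2 * B * (k ^+ n / n`!%:R) * t ^+ n = 2 * B * (k ^+ n * t ^+ n / n`!%:R) by ring.
elim: m => [|m IH] s f sT hf.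
  rewrite !expr0 fact0 divr1 !mulr1; apply: le_trans (lee_abs_sub _ _) _.
  have -> : 2 * B = B + B by ring.
  by rewrite EFinD; apply: leeD; [exact: HB|exact: HB'].
have a0 : 0 <= 2 * B * (k ^+ m / m`!%:R).
  by rewrite mulr_ge0 ?divr_ge0 ?exprn_ge0// mulr_ge0// ltW.
have := diff_step a0 IH sT hf; rewrite -/k.
suff -> : k * (2 * B * (k ^+ m / m`!%:R)) / m.+1%:R = 2 * B * (k ^+ m.+1 / m.+1`!%:R) by [].
rewrite factS natrM invfM exprS; ring.
Qed.

Lemma diff_eq0 t psi : 0 <= t <= T -> ctest b psi ->
  pairing (nu t) (X psi) = pairing (nu' t) (X psi).
Proof.
move=> tT h.
have cv : (2 * B * exp_coeff (b * (B + M0) * t) n)%:E @[n --> \oo] --> (0%E : \bar R).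
  have cvr : 2 * B * exp_coeff (b * (B + M0) * t) n @[n --> \oo] --> 2 * B * 0.
    by apply: cvgM; [exact: cvg_cst|exact: cvg_exp_coeff].
  by apply: cvg_EFin; [exact: nearW|rewrite mulr0 in cvr; exact: cvr].
have f1 : pairing (nu t) (X psi) \is a fin_num.
  by rewrite -abse_fin_num ge0_fin_numE// (le_lt_trans (HB tT h))// ltry.
have f2 : pairing (nu' t) (X psi) \is a fin_num.
  by rewrite -abse_fin_num ge0_fin_numE// (le_lt_trans (HB' tT h))// ltry.
have : (`|diff t psi| <= 0)%E.
  by apply: (cvge_to_ge cv); apply: nearW => n; exact: diff_exp.
rewrite -(fineK f1) -(fineK f2) -EFinB lee_fin normr_le0 subr_eq0 => /eqP ->//.
Qed.

End two_solutions.
End uniqueness.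

Section flory_unique.
Context {R : realType}.
Local Notation mR := (measurableTypeR R).
Variable mu0 : borel_measure R.
Hypothesis mu0_mass : (moment1 mu0 < +oo)%E.

(** Made so that m times it is a multiple of [tent] on (0, +oo): dividing by max m a instead of m
    keeps it continuous, and the factor a keeps it at most 1. *)
Let tent_test (a c : R) n m := a / Num.max m a * tent a c n m.

Lemma ctest_tent a c n : 0 < a -> ctest c (tent_test a c n).
Proof.
move=> a0; have mx m : 0 < Num.max m a by rewrite lt_max a0 orbT.
split.
- move=> m; apply: cvgM; last exact: tent_continuous.
  apply: cvgM; first exact: cvg_cst.
  apply: cvgV; first by rewrite gt_eqF.
  apply: (@max_fun_continuous _ _ R (fun m => m) (cst a)); last exact: cst_continuous.
  by move=> x; exact: cvg_id.
- move=> m; have /andP[t0 t1] := tent_itv a c n m.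
  rewrite ger0_norm ?mulr_ge0 ?divr_ge0 ?invr_ge0 ?(ltW a0) ?(ltW (mx _))//.
  rewrite -[leRHS]mulr1; apply: ler_pM => //; first by rewrite divr_ge0 ?(ltW a0) ?(ltW (mx _)).
  by rewrite ler_pdivrMr// mul1r le_max lexx orbT.
- by exists a => // m ma; rewrite /tent_test tent_out ?mulr0//; left.
- by move=> m cm; rewrite /tent_test tent_out ?mulr0//; right.
Qed.

Lemma tent_testE a c n m : 0 < m -> 0 < a -> m * tent_test a c n m = a * tent a c n m.
Proof.
move=> m0 a0; rewrite /tent_test; have [ma|am] := leP m a.
  by rewrite tent_out ?mulr0//; left.
by rewrite mulrA mulrCA divff ?mulr1 ?gt_eqF.
Qed.

Lemma flory_solution_unique (nu nu' : R -> borel_measure R) :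
  flory_solution mu0 nu -> flory_solution mu0 nu' ->
  forall t, 0 <= t -> forall A, measurable A -> nu t A = nu' t A.
Proof.
move=> H H' t t0; have [r _ _ _ _] := H; have [r' _ _ _ _] := H'.
apply: eq_radon_pos; [exact: r|exact: r'|] => a c a0.
have [ca|ac] := leP c a.
  by rewrite set_itv_ge ?measure0// bnd_simp -leNgt.
(* The horizon t + 1 is positive even for t = 0. The right end c is the threshold above which the
   test functions vanish. *)
have c0 := lt_trans a0 ac; have T0 : 0 < t + 1 by rewrite ltr_wpDl.
have [B1 B10 h1] := solution_bound mu0_mass c0 H T0.
have [B2 B20 h2] := solution_bound mu0_mass c0 H' T0.
pose B := Num.max B1 B2; have B0 : 0 < B by rewrite lt_max B10.
have tT : 0 <= t <= t + 1 by rewrite t0 lerDl ler01.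
have e n : pairing (nu t) (fun m => a * tent a c n m) = pairing (nu' t) (fun m => a * tent a c n m).
  transitivity (pairing (nu t) (fun m => m * tent_test a c n m)).
    by apply: eq_pairing => m m0; rewrite tent_testE.
  rewrite (diff_eq0 mu0_mass c0 H H' B0 (T := t + 1))//; last exact: ctest_tent.
  - by apply: eq_pairing => m m0; rewrite tent_testE.
  - by move=> s psi sT hp; apply: le_trans (h1 _ _ sT hp) _; rewrite lee_fin le_max lexx.
  - by move=> s psi sT hp; apply: le_trans (h2 _ _ sT hp) _; rewrite lee_fin le_max lexx orbT.
have k1 := @open_itv_measure_cvg R (nu t) a c a0 (r _ t0).1.
have k2 := @open_itv_measure_cvg R (nu' t) a c a0 (r' _ t0).1.
rewrite (funext e : (fun n => pairing (nu t) _) = _) in k1.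
have aE : (a%:E * nu t `]a, c[%classic = a%:E * nu' t `]a, c[%classic)%E.
  exact: (cvg_unique _ k1 k2).
have ai : ((a^-1)%:E * a%:E = 1 :> \bar R)%E by rewrite -EFinM mulVf// gt_eqF.
by rewrite -[LHS]mul1e -[RHS]mul1e -ai -!muleA aE.
Qed.

End flory_unique.

Unset Implicit Arguments.
Set Strict Implicit.
Set Printing Implicit Defensive.

Theorem theorem3p2 (R : realType) (mu0 : borel_measure R)
    (mu0_radon : radon_pos mu0)
    (mu0_neq0 : mu0 `]0, +oo[%classic <> 0%E)
    (mu0_mass : (moment1 mu0 < +oo)%E) :
  let M0 : R := fine (moment1 mu0) in
  let Tgel : R := gel_time mu0 in
  let g0 : R -> R := fun x => fine (genfun mu0 x) in
  let m0 : R := inf_supp mu0 in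
  0 < M0 /\ (0 < moment2 mu0)%E /\
  exists mu : R -> borel_measure R,
    let M : R -> R := fun t => fine (moment1 (mu t)) in
    flory_solution mu0 mu /\
    (forall nu : R -> borel_measure R, flory_solution mu0 nu ->
       forall t, 0 <= t -> forall A, measurable A -> nu t A = mu t A) /\
    (exists l : R -> R,
      (* (1) *)
      ((forall t, 0 <= t <= Tgel -> l t = 1) /\
       (forall t, Tgel < t ->
          [/\ 0 <= l t < 1, l t = expR (- (t * (M0 - g0 (l t)))) &
              forall y, 0 <= y < 1 -> y = expR (- (t * (M0 - g0 y))) ->
                y = l t]) /\
       (forall t, 0 <= t -> moment1 (mu t) = (g0 (l t))%:E) /\
       {within `[0, +oo[, continuous M} /\
       (forall t, 0 <= t <= Tgel -> M t = M0) /\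
       (forall s t, Tgel <= s -> s < t -> M t < M s) /\
       analytic_on [set t | 0 <= t /\ t <> Tgel] M) /\
      (* (2) *)
      (exists h : R -> R -> R, forall t x, 0 <= t -> 0 <= x <= 1 ->
         [/\ 0 <= h t x <= l t,
             h t x * expR (t * (M0 - g0 (h t x))) = x &
             genfun (mu t) x = (g0 (h t x))%:E])) /\
    (* (3) *)
    ((M t * expR (m0 * M0 * t)) @[t --> +oo] --> m0 * fine (mu0 [set m0]) /\
     (forall eps : R, 0 < eps ->
       (M t * expR ((m0 + eps) * M0 * t)) @[t --> +oo] --> +oo)) /\
    (* (4) *)
    ((forall t, 0 <= t -> t <> Tgel -> (moment2 (mu t) < +oo)%E) /\
     moment2 (mu Tgel) = +oo%E).

Proof.
move=> M0 Tgel g0 m0.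
have M1 := moment1_gt0 mu0_radon mu0_neq0; split; first by rewrite fine_gt0// M1.
split; first exact: moment2_gt0.
exists (flow mu0_radon mu0_mass) => M; split; first exact: flow_solution.
split.
  move=> nu nu_sol; apply: (flory_solution_unique mu0_mass nu_sol).
  exact: flow_solution.
split.
  exists (gel_l mu0_radon mu0_neq0 mu0_mass); split; last exact: genfun_right_inverse.
  split; first exact: gel_l_pre.
  split; first exact: gel_l_post.
  split; first exact: moment1_flow_l.
  split; first exact: mass_continuous.
  split; first exact: mass_pre_gel.
  split; first exact: mass_post_gel.
  exact: flow_mass_analytic.
split; split.
- exact: flow_mass_asymptotics.
- exact: flow_mass_lower.
- exact: moment2_flow_lty.
- exact: moment2_flow_gel.
Qed.
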